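(* There is an algorithm with the following guarantee for every sufficiently small $\epsilon>0$. Given an instance of Restricted Strip Cover and $\epsilon$, it runs in time polynomial in $n$ and $1/\epsilon$ and outputs a valid schedule of duration at least \[ \frac{L}{1+\epsilon} - O\!\left(d_{\max}\log n\cdot \frac{1}{\epsilon^3}\log\frac{d_{\max}}{d_{\min}}\right). \]
   Context: An instance of Restricted Strip Cover (RSC) is a set $\mathcal{S}$ of $n$ sensors. Each sensor $s$ has a half-open interval $R(s)=[\ell(s),r(s))$ on the real line, with integer endpoints, and a positive integer duration $d(s)$. Let $d_{\min}=\min_s d(s)$, $d_{\max}=\max_s d(s)$, and $U=\bigcup_{s\in\mathcal{S}}R(s)$. A schedule assigns to each sensor either a start time $t(s)\ge 0$ or marks it unused, and then $s$ is active exactly during $[t(s),t(s)+d(s))$. A schedule is valid with duration $T$ if for every $x\in U$ and every $0\le t<T$ there is a sensor $s$ with $x\in R(s)$ and $t(s)\le t<t(s)+d(s)$. The load at $x$ is $L(x)=\sum_{s:\,x\in R(s)}d(s)$, and $L=\min_{x\in U}L(x)$. *)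

(* Defs.v *)
From Stdlib Require Import Reals ZArith List.
Import ListNotations.

Record sensor := Sensor { lo : Z; hi : Z; dur : Z }.

(** The n sensors are the positions of the list: two distinct sensors may have
    the same interval and the same duration. *)
Definition instance := list sensor.

Definition wf_sensor (s : sensor) : Prop := (lo s < hi s)%Z /\ (0 < dur s)%Z.

Definition wf_instance (I : instance) : Prop := I <> [] /\ Forall wf_sensor I.

Definition dmin (I : instance) : Z :=
  match I with
  | [] => 0%Z
  | s :: I' => fold_right (fun s' m => Z.min (dur s') m) (dur s) I'
  end.

Definition dmax (I : instance) : Z :=
  match I with
  | [] => 0%Z
  | s :: I' => fold_right (fun s' m => Z.max (dur s') m) (dur s) I'
  end.

Definition in_range (s : sensor) (x : R) : Prop :=
  (IZR (lo s) <= x < IZR (hi s))%R.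

Definition in_range_dec (s : sensor) (x : R) :
  {in_range s x} + {~ in_range s x}.
Proof.
  unfold in_range.
  destruct (Rle_dec (IZR (lo s)) x) as [H1 | H1];
    destruct (Rlt_dec x (IZR (hi s))) as [H2 | H2]; tauto.
Defined.

Definition in_union (I : instance) (x : R) : Prop :=
  exists s, In s I /\ in_range s x.

Definition load (I : instance) (x : R) : Z :=
  fold_right
    (fun s acc => ((if in_range_dec s x then dur s else 0) + acc)%Z) 0%Z I.

(** [is_min_load I L]: L is the minimum of [load I] over the union of the
    intervals; it exists, and is unique, for every well-formed instance. *)
Definition is_min_load (I : instance) (L : Z) : Prop :=
  (exists x, in_union I x /\ load I x = L) /\
  (forall x, in_union I x -> (L <= load I x)%Z).

(** The i-th sensor starts at [t i]; it is unused if [t i = None]. *)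
Definition schedule := nat -> option R.

Definition valid (I : instance) (t : schedule) (T : R) : Prop :=
  (forall i ti, (i < length I)%nat -> t i = Some ti -> (0 <= ti)%R) /\
  (forall x u, in_union I x -> (0 <= u < T)%R ->
     exists i s ti, nth_error I i = Some s /\ t i = Some ti /\
       in_range s x /\ (ti <= u < ti + IZR (dur s))%R).

(** Programs for a word RAM.

    The memory consists of arrays, named by natural numbers and indexed by
    integers; a program mentions finitely many of them, and cell 0 of an array
    can be used as a scalar variable.  Every number that is read or computed
    must fit in a word of [w] bits plus a sign: otherwise evaluation is stuck
    ([None]).  Without such a bound, unit-cost multiplication would not be a
    reasonable measure of time. *)

Definition mem := nat -> Z -> Z.

Inductive binop := Add | Sub | Mul | Div | Lt | Eq.

Inductive expr :=
| Num (z : Z)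
| Read (a : nat) (i : expr)
| Op (o : binop) (e1 e2 : expr).

(** [Div] is floor division, with [x / 0 = 0]; tests return 0 or 1. *)
Definition binop_sem (o : binop) (x y : Z) : Z :=
  match o with
  | Add => x + y
  | Sub => x - y
  | Mul => x * y
  | Div => x / y
  | Lt => if x <? y then 1 else 0
  | Eq => if x =? y then 1 else 0
  end%Z.

Definition fit (w v : Z) : option Z :=
  if (Z.abs v <? 2 ^ w)%Z then Some v else None.

Fixpoint eval (w : Z) (m : mem) (e : expr) : option Z :=
  match e with
  | Num z => fit w z
  | Read a i =>
      match eval w m i with
      | Some j => fit w (m a j)
      | None => None
      end
  | Op o e1 e2 =>
      match eval w m e1, eval w m e2 with
      | Some x, Some y => fit w (binop_sem o x y)
      | _, _ => None
      end
  end.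

Inductive cmd :=
| Skip
| Write (a : nat) (i e : expr)
| Seq (c1 c2 : cmd)
| If (e : expr) (c1 c2 : cmd)
| While (e : expr) (c : cmd).

Definition upd (m : mem) (a : nat) (j v : Z) : mem :=
  fun a' j' => if (Nat.eqb a' a && Z.eqb j' j)%bool then v else m a' j'.

(** [exec w c m m' t]: with word length [w], the program [c] started in memory
    [m] halts in memory [m'] after [t] steps.  Evaluating an expression counts
    as one step, since the expressions of a program have bounded size. *)
Inductive exec (w : Z) : cmd -> mem -> mem -> nat -> Prop :=
| exec_skip m : exec w Skip m m 1
| exec_write a i e m j v :
    eval w m i = Some j -> eval w m e = Some v ->
    exec w (Write a i e) m (upd m a j v) 1
| exec_seq c1 c2 m m1 m2 t1 t2 :
    exec w c1 m m1 t1 -> exec w c2 m1 m2 t2 ->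
    exec w (Seq c1 c2) m m2 (t1 + t2)
| exec_if_true e c1 c2 m m' v t :
    eval w m e = Some v -> v <> 0%Z -> exec w c1 m m' t ->
    exec w (If e c1 c2) m m' (1 + t)
| exec_if_false e c1 c2 m m' t :
    eval w m e = Some 0%Z -> exec w c2 m m' t ->
    exec w (If e c1 c2) m m' (1 + t)
| exec_while_true e c m m1 m2 v t1 t2 :
    eval w m e = Some v -> v <> 0%Z ->
    exec w c m m1 t1 -> exec w (While e c) m1 m2 t2 ->
    exec w (While e c) m m2 (1 + t1 + t2)
| exec_while_false e c m :
    eval w m e = Some 0%Z -> exec w (While e c) m m 1.

Definition cells (l : list Z) : Z -> Z :=
  fun j => if (j <? 0)%Z then 0%Z else nth (Z.to_nat j) l 0%Z.

(** Input: the instance [I] and epsilon = p / q. *)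
Definition input (I : instance) (p q : Z) : mem :=
  fun a =>
    match a with
    | 0 => cells [Z.of_nat (length I); p; q]
    | 1 => cells (map lo I)
    | 2 => cells (map hi I)
    | 3 => cells (map dur I)
    | _ => fun _ => 0%Z
    end.

(** Length in bits of the largest input number. *)
Definition input_bits (I : instance) (p q : Z) : Z :=
  (1 + Z.log2
    (fold_right (fun v acc => Z.max (Z.abs v) acc) 0
       ([Z.of_nat (length I); p; q] ++ map lo I ++ map hi I ++ map dur I)))%Z.

(** Output, in array 4: cell i is the start time of the i-th sensor, and any
    negative value means "unused".  Integral start times lose nothing: as the
    durations are integers, rounding all start times of a valid schedule up
    keeps it valid with the same duration. *)
Definition output (m : mem) : schedule :=
  fun i => let v := m 4 (Z.of_nat i) in
           if (v <? 0)%Z then None else Some (IZR v).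

(** Up to the choice of K, any polynomial in n and 1/eps. *)
Definition poly_bound (K n : nat) (eps : R) : R :=
  (INR K * (INR n + 1 / eps) ^ K)%R.

(** With time and word length (relative to the input numbers) both polynomial
    in n and 1/eps, [prog] takes time polynomial in n and 1/eps also on words
    that just hold the input numbers, by multi-word arithmetic. *)
Definition computes_in_poly_time
    (prog : cmd) (K : nat) (I : instance) (p q : Z) (t : schedule) : Prop :=
  let B := poly_bound K (length I) (IZR p / IZR q) in
  exists (w : Z) (m : mem) (steps : nat),
    (IZR w <= B * IZR (input_bits I p q))%R /\
    (INR steps <= B)%R /\
    exec w prog (input I p q) m steps /\
    t = output m.

(* Main.v *)
(** The sensors are bundled into boxes: sets of sensors of total duration at
    least [D], scheduled one after the other, so that the intersection of their
    intervals is covered for [D] time units.  Boxes all last [D], and intervals of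
    equal duration can be scheduled without loss: treat them by increasing left
    end and give each one to the colour that so far reaches least far to the
    right; if every point lies in at least [N] boxes, each of the [N] colours then
    covers every point.  The schedule lasts [N * D].

    Let [k] be about [3 / eps].  If [dmax <= (1 + 1/k) dmin], every sensor is a
    box, with [D = dmin].  Otherwise [D = k dmax], and the penalty term is at
    least of order [dmax log n / eps ^ 2].  Distribute the sensors over the nodes
    of a dyadic tree on the ranks of their left ends: a point concerns one node in
    each of the [log n] levels, and the sensors of a node share a point.  So the
    sensors of a node that contain [x] form a prefix in the order of the left ends
    (for [x] to the left of the shared point), or in that of the right ends.  Let
    [al] and [be] be the total durations of the sensors of the node that precede a
    given one in these two orders.  A sensor joins layer [al / M] of the first
    side if [al <= be], and layer [be / M] of the second side otherwise, where
    [M = k (k + 1) dmax]; a layer is sorted by the other order than the one that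
    defined it and cut into pieces of duration [(k + 1) dmax], each of which
    contains a box.  If the sensors of the node that contain [x] weigh [c], they
    meet at most [c / M + 1] layers on either side, by the choice of sides.  They
    come first in each of these layers on one side, and on the other side they are
    the whole of each of these layers but the last.  So every layer wastes less
    than a piece, except for one that may be lost, and the total loss is about
    [2 c / k] plus [O(k ^ 2 dmax)] per node. *)

Require Import Defs.
From Stdlib Require Import Reals ZArith List Lia Lra Bool ZifyBool.
Import Defs ListNotations.
Open Scope Z_scope.

(** * Word-RAM programs without growth *)

(** Evaluation without word bound. [eval] agrees with it as long as every intermediate number fits,
    which [eval_slow] ensures. *)
Fixpoint ev (m : mem) (e : expr) : Z :=
  match e with
  | Num z => z
  | Read a i => m a (ev m i)
  | Op o x y => binop_sem o (ev m x) (ev m y)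
  end.

Definition fits (m : mem) (b : Z) : Prop := forall a z, Z.abs (m a z) < 2 ^ b.

Fixpoint is_test (e : expr) : bool :=
  match e with
  | Op Lt _ _ | Op Eq _ _ => true
  | Op Mul x y => is_test x && is_test y
  | _ => false
  end.

(** Products are allowed only with a 0/1 left factor, for conjunctions and conditionals, so that
    numbers never grow faster than under addition. Genuine products have to be computed by repeated
    addition in loops. *)
Fixpoint slow (e : expr) : bool :=
  match e with
  | Num _ => true
  | Read _ i => slow i
  | Op Mul x y => is_test x && slow x && slow y
  | Op _ x y => slow x && slow y
  end.

(** The number of bits that an expression may add to the numbers in memory. The crude charge for a
    literal suffices, since literals belong to the fixed program. *)
Fixpoint width (e : expr) : Z :=
  match e with
  | Num z => Z.abs z + 1
  | Read _ i => width i
  | Op _ x y => width x + width y + 1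
  end.

Lemma width_pos (e : expr) : 1 <= width e.
Proof. induction e; simpl; lia. Qed.

Lemma is_test_01 (m : mem) (e : expr) :
  is_test e = true -> ev m e = 0 \/ ev m e = 1.
Proof.
  induction e as [z | a i IH | o x IHx y IHy]; simpl; try discriminate.
  destruct o; simpl; try discriminate; intros H.
  - apply andb_prop in H as [Hx Hy].
    destruct (IHx Hx) as [-> | ->], (IHy Hy) as [-> | ->]; simpl; auto.
  - destruct (_ <? _); auto.
  - destruct (_ =? _); auto.
Qed.

Lemma abs_lt_pow2 (z : Z) : Z.abs z < 2 ^ Z.abs z.
Proof. apply Z.pow_gt_lin_r; lia. Qed.

Lemma pow2_mono (b c : Z) : b <= c -> 2 ^ b <= 2 ^ c.
Proof. intros; apply Z.pow_le_mono_r; lia. Qed.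

Lemma abs_div_le (x y : Z) : Z.abs (x / y) <= Z.abs x.
Proof.
  destruct (Z.eq_dec y 0) as [-> | Hy]; [rewrite Zdiv_0_r; lia |].
  pose proof (Z.div_mod x y Hy) as E.
  destruct (Z.lt_trichotomy y 0) as [H | [H | H]]; [| lia |].
  - pose proof (Z.mod_neg_bound x y H). nia.
  - pose proof (Z.mod_pos_bound x y H). nia.
Qed.

Lemma fit_some (w v : Z) : Z.abs v < 2 ^ w -> fit w v = Some v.
Proof. intros H. unfold fit. apply Z.ltb_lt in H. now rewrite H. Qed.

(** Widths add up under an operation, which leaves one bit for a sum or difference. A quotient is no
    larger than its dividend, and a product with a test is no larger than its other factor. *)
Lemma eval_slow (w b : Z) (m : mem) (e : expr) :
  0 <= b -> fits m b -> slow e = true -> b + width e <= w ->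
  eval w m e = Some (ev m e) /\ Z.abs (ev m e) < 2 ^ (b + width e).
Proof.
  intros Hb Hm. induction e as [z | a i IH | o x IHx y IHy]; simpl; intros Hs Hw.
  - assert (Z.abs z < 2 ^ (b + (Z.abs z + 1))).
    { eapply Z.lt_le_trans; [apply abs_lt_pow2 | apply pow2_mono; lia]. }
    split; [apply fit_some | assumption].
    eapply Z.lt_le_trans; [eassumption | apply pow2_mono; lia].
  - destruct (IH Hs Hw) as [-> _]. pose proof (width_pos i). split.
    + apply fit_some. eapply Z.lt_le_trans; [apply Hm | apply pow2_mono; lia].
    + eapply Z.lt_le_trans; [apply Hm | apply pow2_mono; lia].
  - pose proof (width_pos x). pose proof (width_pos y).
    assert (slow x = true /\ slow y = true /\ (o = Mul -> is_test x = true))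
      as (Hx & Hy & Ht).
    { destruct o; repeat (apply andb_prop in Hs as [Hs ?]); repeat split;
        congruence. }
    destruct (IHx Hx) as [-> Bx]; [lia |].
    destruct (IHy Hy) as [-> By]; [lia |].
    assert (Px : 2 ^ (b + width x) <= 2 ^ (b + width x + width y))
      by (apply pow2_mono; lia).
    assert (Py : 2 ^ (b + width y) <= 2 ^ (b + width x + width y))
      by (apply pow2_mono; lia).
    assert (P2 : 2 ^ (b + (width x + width y + 1)) = 2 * 2 ^ (b + width x + width y)).
    { replace (b + (width x + width y + 1)) with (Z.succ (b + width x + width y)) by lia.
      apply Z.pow_succ_r; lia. }
    assert (P0 : 0 < 2 ^ (b + width x + width y)) by (apply Z.pow_pos_nonneg; lia).
    assert (G : Z.abs (binop_sem o (ev m x) (ev m y)) < 2 ^ (b + (width x + width y + 1))).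
    { rewrite P2. destruct o; cbn [binop_sem].
      - lia.
      - lia.
      - destruct (is_test_01 m x (Ht eq_refl)) as [-> | ->]; lia.
      - pose proof (abs_div_le (ev m x) (ev m y)). lia.
      - destruct (_ <? _); lia.
      - destruct (_ =? _); lia. }
    split; [apply fit_some | exact G].
    eapply Z.lt_le_trans; [exact G | apply pow2_mono; lia].
Qed.

(** * Bounded loops: semantics, compilation and cost *)

Inductive stm :=
| SWr (a : nat) (i e : expr)
| SSq (s1 s2 : stm)
| SFor (v a : nat) (s : stm).

Local Notation scal a := (Read a (Num 0)).

Fixpoint compile (s : stm) : cmd :=
  match s with
  | SWr a i e => Write a i e
  | SSq s1 s2 => Seq (compile s1) (compile s2)
  | SFor v a s =>
      Seq (Write v (Num 0) (Num 0))
        (While (Op Lt (scal v) (scal a))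
           (Seq (compile s) (Write v (Num 0) (Op Add (scal v) (Num 1)))))
  end.

(** The number of rounds is fixed in advance and the counter is set outright, whereas the compiled
    loop rereads its bound and increments a cell. The two agree because [ok] forbids the body to
    write either of them. *)
Fixpoint loop (body : mem -> mem) (v k : nat) (i : Z) (m : mem) : mem :=
  match k with
  | O => m
  | S k => loop body v k (i + 1) (upd (body m) v 0 (i + 1))
  end.

Fixpoint run (s : stm) (m : mem) : mem :=
  match s with
  | SWr a i e => upd m a (ev m i) (ev m e)
  | SSq s1 s2 => run s2 (run s1 m)
  | SFor v a s => loop (run s) v (Z.to_nat (m a 0)) 0 (upd m v 0 0)
  end.

Fixpoint writes (s : stm) (a : nat) : bool :=
  match s with
  | SWr b _ _ => Nat.eqb a b
  | SSq s1 s2 => writes s1 a || writes s2 a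
  | SFor v _ s => Nat.eqb a v || writes s a
  end.

Definition inb (a : nat) (l : list nat) : bool := existsb (Nat.eqb a) l.

Lemma inb_In (a : nat) (l : list nat) : inb a l = true <-> In a l.
Proof.
  unfold inb. rewrite existsb_exists. split.
  - intros (b & Hb & E). apply Nat.eqb_eq in E. now subst.
  - intros H. exists a. split; [assumption | apply Nat.eqb_refl].
Qed.

(** The arrays of [B] hold the bounds of the loops and must not be written. *)
Fixpoint ok (kappa : Z) (B : list nat) (s : stm) : bool :=
  match s with
  | SWr a i e =>
      slow i && slow e && (width i <=? kappa) && (width e <=? kappa) && negb (inb a B)
  | SSq s1 s2 => ok kappa B s1 && ok kappa B s2
  | SFor v a s => inb a B && negb (inb v B) && negb (writes s v) && ok kappa B s
  end.

Fixpoint cost (N : Z) (s : stm) : Z :=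
  match s with
  | SWr _ _ _ => 1
  | SSq s1 s2 => cost N s1 + cost N s2
  | SFor _ _ s => 2 + N * (cost N s + 2)
  end.

Lemma upd_same (m : mem) (a : nat) (j v : Z) : upd m a j v a j = v.
Proof. unfold upd. now rewrite Nat.eqb_refl, Z.eqb_refl. Qed.

Lemma upd_array (m : mem) (a b : nat) (j v z : Z) : b <> a -> upd m a j v b z = m b z.
Proof. intros H. unfold upd. apply Nat.eqb_neq in H. now rewrite H. Qed.

Lemma upd_cell (m : mem) (a : nat) (j v z : Z) : z <> j -> upd m a j v a z = m a z.
Proof. intros H. unfold upd. apply Z.eqb_neq in H. now rewrite H, andb_false_r. Qed.

Lemma loop_ind (body : mem -> mem) (v k : nat) (Inv : Z -> mem -> Prop) (i : Z) (m : mem) :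
  Inv i m ->
  (forall j m', i <= j < i + Z.of_nat k -> Inv j m' ->
     Inv (j + 1) (upd (body m') v 0 (j + 1))) ->
  Inv (i + Z.of_nat k) (loop body v k i m).
Proof.
  revert i m. induction k as [| k IH]; intros i m H0 Hs; simpl loop.
  - now replace (i + Z.of_nat 0) with i by lia.
  - replace (i + Z.of_nat (S k)) with (i + 1 + Z.of_nat k) by lia.
    apply IH; [apply Hs; [lia | assumption] |].
    intros j m' Hj. apply Hs. lia.
Qed.

Lemma run_frame (s : stm) (a : nat) :
  writes s a = false -> forall m z, run s m a z = m a z.
Proof.
  induction s as [b i e | s1 IH1 s2 IH2 | v b s IH]; simpl; intros H m z.
  - apply Nat.eqb_neq in H. now apply upd_array.
  - apply orb_false_elim in H as [H1 H2]. now rewrite IH2, IH1.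
  - apply orb_false_elim in H as [H1 H2]. apply Nat.eqb_neq in H1.
    apply (loop_ind (run s) v _ (fun _ m' => m' a z = m a z)).
    + now apply upd_array.
    + intros j m' _ E. rewrite upd_array by assumption. now rewrite IH.
Qed.

Lemma fits_mono (m : mem) (b c : Z) : b <= c -> fits m b -> fits m c.
Proof.
  intros H Hm a z. eapply Z.lt_le_trans; [apply Hm | now apply pow2_mono].
Qed.

Lemma fits_upd (m : mem) (b : Z) (a : nat) (j v : Z) :
  fits m b -> Z.abs v < 2 ^ b -> fits (upd m a j v) b.
Proof. intros Hm Hv a' z. unfold upd. destruct (_ && _); [assumption | apply Hm]. Qed.

Lemma cost_pos (N : Z) (s : stm) : 0 <= N -> 1 <= cost N s.
Proof. intros HN. induction s; cbn [cost]; nia. Qed.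

Lemma ok_frame (kappa : Z) (B : list nat) (s : stm) (a : nat) :
  ok kappa B s = true -> In a B -> writes s a = false.
Proof.
  intros H Ha. apply inb_In in Ha. induction s as [b i e | s1 IH1 s2 IH2 | v b s IH]; simpl in *.
  - apply andb_prop in H as [_ H]. destruct (Nat.eqb_spec a b) as [-> |]; [| reflexivity].
    now rewrite Ha in H.
  - apply andb_prop in H as [H1 H2]. now rewrite IH1, IH2.
  - apply andb_prop in H as [H H4]. apply andb_prop in H as [H H3].
    apply andb_prop in H as [H1 H2]. rewrite IH by assumption.
    destruct (Nat.eqb_spec a v) as [-> |]; [| reflexivity]. now rewrite Ha in H2.
Qed.

(** Numbers grow by at most [kappa] bits per step, so that a bound on the
    running time is also a bound on the word length. *)
Lemma exec_run (w kappa : Z) (B : list nat) (N : Z) (s : stm) :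
  4 <= kappa -> 0 <= N -> ok kappa B s = true ->
  forall m b, 0 <= b -> fits m b -> (forall a, In a B -> m a 0 <= N) ->
    b + kappa * cost N s <= w ->
    exists t, exec w (compile s) m (run s m) t /\ Z.of_nat t <= cost N s /\
      fits (run s m) (b + kappa * cost N s).
Proof.
  intros Hk HN. induction s as [a i e | s1 IH1 s2 IH2 | v a s IH]; cbn [ok compile run cost];
    intros Hok m b Hb Hm HB Hw.
  - repeat (apply andb_prop in Hok as [Hok ?]).
    repeat match goal with H : (_ <=? _) = true |- _ => apply Z.leb_le in H end.
    destruct (eval_slow w b m i) as [Ei _]; try assumption; [lia |].
    destruct (eval_slow w b m e) as [Ee Be]; try assumption; [lia |].
    exists 1%nat. split; [now apply exec_write |]. split; [lia |].
    apply fits_upd; [eapply fits_mono; [| eassumption]; lia |].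
    eapply Z.lt_le_trans; [exact Be | apply pow2_mono; lia].
  - apply andb_prop in Hok as [H1 H2].
    pose proof (cost_pos N s1 HN). pose proof (cost_pos N s2 HN).
    destruct (IH1 H1 m b) as (t1 & X1 & T1 & B1); try assumption; [nia |].
    destruct (IH2 H2 (run s1 m) (b + kappa * cost N s1)) as (t2 & X2 & T2 & B2);
      try assumption; [nia | | nia |].
    { intros a Ha. rewrite run_frame by (eapply ok_frame; eassumption). auto. }
    exists (t1 + t2)%nat. split; [econstructor; eassumption |]. split; [lia |].
    eapply fits_mono; [| exact B2]; nia.
  - apply andb_prop in Hok as [Hok Hs]. apply andb_prop in Hok as [Hok Hv].
    apply andb_prop in Hok as [Ha HvB]. apply negb_true_iff in Hv, HvB.
    apply inb_In in Ha.
    assert (Hva : v <> a).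
    { intros ->. apply inb_In in Ha. congruence. }
    pose proof (cost_pos N s HN) as Hc. set (c := cost N s) in *.
    (* [k] rounds remain. Each costs a test, the body and an increment, that is [c + 2]; the leading
       1 pays for the test that ends the loop. *)
    assert (Hloop : forall k i m b, m v 0 = i -> k = Z.to_nat (m a 0 - i) ->
      0 <= b -> fits m b -> (forall a, In a B -> m a 0 <= N) ->
      b + kappa * (1 + Z.of_nat k * (c + 2)) <= w ->
      exists t, exec w (While (Op Lt (scal v) (scal a))
           (Seq (compile s) (Write v (Num 0) (Op Add (scal v) (Num 1)))))
           m (loop (run s) v k i m) t /\
        Z.of_nat t <= 1 + Z.of_nat k * (c + 2) /\
        fits (loop (run s) v k i m) (b + kappa * (Z.of_nat k * (c + 2)))).
    { clear m b Hb Hm HB Hw. intros k. induction k as [| k IHk]; intros i m b Ei Ek Hb Hm HB Hw.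
      - exists 1%nat. destruct (eval_slow w b m (Op Lt (scal v) (scal a))) as [E _];
          try assumption; try reflexivity; [simpl; lia |].
        simpl ev in E. rewrite Ei in E.
        destruct (Z.ltb_spec i (m a 0)); [lia |].
        split; [now apply exec_while_false |]. split; [lia |].
        simpl loop. eapply fits_mono; [| eassumption]. lia.
      - assert (Hi : i < m a 0) by lia.
        destruct (eval_slow w b m (Op Lt (scal v) (scal a))) as [E _];
          try assumption; try reflexivity; [simpl; nia |].
        simpl ev in E. rewrite Ei in E.
        destruct (Z.ltb_spec i (m a 0)); [| lia].
        destruct (IH Hs m b) as (t1 & X1 & T1 & B1); try assumption; [nia |].
        assert (Rv : run s m v 0 = i) by (rewrite run_frame; assumption).
        assert (Ra : run s m a 0 = m a 0)
          by (apply run_frame; eapply ok_frame; eassumption).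
        set (m1 := run s m) in *. set (b1 := b + kappa * c) in *.
        assert (Hb1 : 0 <= b1) by (unfold b1; nia).
        destruct (eval_slow w b1 m1 (Num 0)) as [E0 _];
          try assumption; try reflexivity; [simpl; unfold b1; nia |].
        destruct (eval_slow w b1 m1 (Op Add (scal v) (Num 1))) as [E1 Be];
          try assumption; try reflexivity; [simpl; unfold b1; nia |].
        simpl ev in E0, E1, Be. rewrite Rv in E1, Be.
        destruct (IHk (i + 1) (upd m1 v 0 (i + 1)) (b1 + kappa)) as (t2 & X2 & T2 & B2).
        + apply upd_same.
        + rewrite upd_array by auto. rewrite Ra. lia.
        + lia.
        + apply fits_upd; [eapply fits_mono; [| eassumption]; lia |].
          eapply Z.lt_le_trans; [exact Be | apply pow2_mono; simpl; lia].
        + intros a' Ha'. rewrite upd_array.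
          * unfold m1. rewrite run_frame by (eapply ok_frame; eassumption). auto.
          * intros ->. apply inb_In in Ha'. congruence.
        + unfold b1. nia.
        + exists (1 + (t1 + 1) + t2)%nat. split; [| split].
          * simpl loop. eapply exec_while_true; [exact E | lia | | exact X2].
            econstructor; [exact X1 |]. now apply exec_write.
          * lia.
          * simpl loop. eapply fits_mono; [| exact B2]. unfold b1. nia. }
    assert (Hka : Z.of_nat (Z.to_nat (m a 0)) <= N) by (specialize (HB a Ha); lia).
    assert (Hmul : Z.of_nat (Z.to_nat (m a 0)) * (c + 2) <= N * (c + 2)) by nia.
    destruct (Hloop (Z.to_nat (m a 0)) 0 (upd m v 0 0) b) as (t & X & T & Bd).
    + apply upd_same.
    + rewrite upd_array by auto. f_equal. lia.
    + assumption.
    + apply fits_upd; [assumption |]. simpl. apply Z.pow_pos_nonneg; lia.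
    + intros a' Ha'. rewrite upd_array; [auto |].
      intros ->. apply inb_In in Ha'. congruence.
    + nia.
    + exists (1 + t)%nat. split; [| split].
      * econstructor; [| exact X].
        destruct (eval_slow w b m (Num 0)) as [E0 _];
          try assumption; try reflexivity; [simpl; nia |].
        now apply exec_write.
      * lia.
      * eapply fits_mono; [| exact Bd]. nia.
Qed.

Fixpoint weight (s : stm) : Z :=
  match s with
  | SWr _ _ _ => 1
  | SSq s1 s2 => weight s1 + weight s2
  | SFor _ _ s => weight s + 4
  end.

Fixpoint depth (s : stm) : nat :=
  match s with
  | SWr _ _ _ => 0
  | SSq s1 s2 => Nat.max (depth s1) (depth s2)
  | SFor _ _ s => S (depth s)
  end.

(** Each loop contributes one factor [N + 1]; the 4 that [weight] adds for it absorbs the overhead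
    [2 + 2 * N]. So the exponent is the nesting depth and the coefficient is independent of [N]. *)
Lemma cost_le (N : Z) (s : stm) :
  0 <= N -> cost N s <= weight s * (N + 1) ^ Z.of_nat (depth s) /\ 1 <= weight s.
Proof.
  intros HN. induction s as [a i e | s1 [IH1 P1] s2 [IH2 P2] | v a s [IH P]]; 
    cbn [cost weight depth].
  - simpl. lia.
  - split; [| lia].
    assert ((N + 1) ^ Z.of_nat (depth s1) <= (N + 1) ^ Z.of_nat (Nat.max (depth s1) (depth s2)))
      by (apply Z.pow_le_mono_r; lia).
    assert ((N + 1) ^ Z.of_nat (depth s2) <= (N + 1) ^ Z.of_nat (Nat.max (depth s1) (depth s2)))
      by (apply Z.pow_le_mono_r; lia).
    rewrite Z.mul_add_distr_r. apply Z.add_le_mono.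
    + eapply Z.le_trans; [exact IH1 | apply Z.mul_le_mono_nonneg_l; lia].
    + eapply Z.le_trans; [exact IH2 | apply Z.mul_le_mono_nonneg_l; lia].
  - split; [| lia].
    replace (Z.of_nat (S (depth s))) with (Z.succ (Z.of_nat (depth s))) by lia.
    rewrite Z.pow_succ_r by lia.
    set (x := (N + 1) ^ Z.of_nat (depth s)) in *.
    assert (1 <= x) by (unfold x; assert (0 < (N + 1) ^ Z.of_nat (depth s)) by (apply Z.pow_pos_nonneg; lia); lia).
    assert (N * (cost N s + 2) <= N * (weight s * x + 2)) by (apply Z.mul_le_mono_nonneg_l; lia).
    assert (N * 1 <= N * x) by (apply Z.mul_le_mono_nonneg_l; lia).
    assert (0 <= weight s * x) by nia.
    nia.
Qed.

(** * Arrays defined by nested loops *)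

Fixpoint zfold (k : nat) (g : Z -> Z -> Z) (z : Z) : Z :=
  match k with
  | O => z
  | S k => g (Z.of_nat k) (zfold k g z)
  end.

Lemma zfold_ext (k : nat) (g g' : Z -> Z -> Z) (z : Z) :
  (forall j acc, 0 <= j < Z.of_nat k -> g j acc = g' j acc) -> zfold k g z = zfold k g' z.
Proof.
  induction k as [| k IH]; intros H; simpl; [reflexivity |].
  rewrite IH; [apply H; lia | intros; apply H; lia].
Qed.

Local Notation vi := 5%nat.
Local Notation vj := 6%nat.

(** [TI] and [TJ] are the indices of the outer and the inner loop; [TAcc] is
    the cell being computed. *)
Inductive texp :=
| TNum (z : Z)
| TI
| TJ
| TAcc
| TRd (a : nat) (e : texp)
| TOp (o : binop) (e1 e2 : texp).

Fixpoint tev (E : mem) (i j acc : Z) (e : texp) : Z :=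
  match e with
  | TNum z => z
  | TI => i
  | TJ => j
  | TAcc => acc
  | TRd a e => E a (tev E i j acc e)
  | TOp o e1 e2 => binop_sem o (tev E i j acc e1) (tev E i j acc e2)
  end.

Fixpoint tcomp (X : nat) (e : texp) : expr :=
  match e with
  | TNum z => Num z
  | TI => scal vi
  | TJ => scal vj
  | TAcc => Read X (scal vi)
  | TRd a e => Read a (tcomp X e)
  | TOp o e1 e2 => Op o (tcomp X e1) (tcomp X e2)
  end.

Fixpoint reads (L : list nat) (e : texp) : bool :=
  match e with
  | TRd a e => inb a L && reads L e
  | TOp _ e1 e2 => reads L e1 && reads L e2
  | _ => true
  end.

Lemma ev_tcomp (X : nat) (L : list nat) (E m : mem) (i j acc : Z) (e : texp) :
  reads L e = true -> (forall a z, In a L -> m a z = E a z) ->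
  m vi 0 = i -> m vj 0 = j -> m X i = acc -> ev m (tcomp X e) = tev E i j acc e.
Proof.
  intros He HL Hi Hj Ha. induction e as [z | | | | a e IH | o e1 IH1 e2 IH2]; simpl in *; auto.
  - now rewrite Hi.
  - apply andb_prop in He as [H1 H2]. rewrite IH by assumption.
    apply HL. now apply inb_In.
  - apply andb_prop in He as [H1 H2]. now rewrite IH1, IH2.
Qed.

(** Fill cell [i] of array [tgt], for each [i], starting from [ini] and
    iterating [stp] as often as cell 0 of array [bnd] says. *)
Record tab := Tab { tgt : nat; bnd : nat; ini : texp; stp : texp }.

Definition tab_stm (T : tab) : stm :=
  SFor vi 0 (SSq (SWr (tgt T) (scal vi) (tcomp (tgt T) (ini T)))
    (SFor vj (bnd T) (SWr (tgt T) (scal vi) (tcomp (tgt T) (stp T))))).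

Definition tab_val (E : mem) (T : tab) (i : Z) : Z :=
  zfold (Z.to_nat (E (bnd T) 0)) (fun j acc => tev E i j acc (stp T))
    (tev E i 0 0 (ini T)).

(** The initial value of a cell is computed before the inner index and the cell are reset, when both
    still hold leftovers; it may depend on neither. *)
Fixpoint no_acc (e : texp) : bool :=
  match e with
  | TJ | TAcc => false
  | TRd _ e => no_acc e
  | TOp _ e1 e2 => no_acc e1 && no_acc e2
  | _ => true
  end.

Lemma tev_no_acc (E : mem) (i j acc j' acc' : Z) (e : texp) :
  no_acc e = true -> tev E i j acc e = tev E i j' acc' e.
Proof.
  induction e as [z | | | | a e IH | o e1 IH1 e2 IH2]; simpl; try discriminate; auto.
  - intros H. now rewrite IH.
  - intros H. apply andb_prop in H as [H1 H2]. now rewrite IH1, IH2.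
Qed.

Definition wf_tab (L : list nat) (T : tab) : bool :=
  inb (bnd T) L && reads L (ini T) && reads L (stp T) && no_acc (ini T).

(** [L] lists the arrays already available. The run writes none of them, and both expressions read
    only them and the cell under construction, so every value can be computed from the initial
    memory. *)
Lemma run_tab (L : list nat) (E : mem) (T : tab) :
  wf_tab L T = true -> ~ In (tgt T) L -> In 0%nat L -> ~ In vi L -> ~ In vj L ->
  tgt T <> vi -> tgt T <> vj ->
  let E' := run (tab_stm T) E in
  (forall a z, In a L -> E' a z = E a z) /\
  (forall i, 0 <= i < E 0%nat 0 -> E' (tgt T) i = tab_val E T i).
Proof.
  destruct T as [X b e0 e1]. unfold wf_tab, tab_val. cbn [tgt bnd ini stp].
  intros Hwf HX H0 HLi HLj Hi Hj.
  apply andb_prop in Hwf as [Hwf Hna]. apply andb_prop in Hwf as [Hwf R1].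
  apply andb_prop in Hwf as [Hb R0]. apply inb_In in Hb.
  set (val := fun i k => zfold k (fun j acc => tev E i j acc e1) (tev E i 0 0 e0)).
  set (kb := Z.to_nat (E b 0)).
  assert (Hloop : forall k,
    (fun i m => (forall a z, In a L -> m a z = E a z) /\ m vi 0 = i /\
       (forall z, 0 <= z < i -> m X z = val z kb))
    (0 + Z.of_nat k)
    (loop (run (SSq (SWr X (scal vi) (tcomp X e0))
        (SFor vj b (SWr X (scal vi) (tcomp X e1))))) vi k 0 (upd E vi 0 0))).
  { intros k. apply loop_ind.
    - split; [| split; [apply upd_same | lia]].
      intros a z Ha. apply upd_array. intros ->. contradiction.
    - intros i m Hi0 (HL & Hvi & HXz). cbn [run].
      set (m1 := upd m X (ev m (scal vi)) (ev m (tcomp X e0))).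
      assert (Em1 : ev m (scal vi) = i) by exact Hvi.
      assert (Ini : ev m (tcomp X e0) = tev E i 0 0 e0).
      { rewrite (ev_tcomp X L E m i (m vj 0) (m X i)) by auto.
        now apply tev_no_acc. }
      assert (HL1 : forall a z, In a L -> m1 a z = E a z).
      { intros a z Ha. unfold m1. rewrite upd_array; [auto |]. intros ->. contradiction. }
      (* Inner invariant: cell [i] has gone through [j] iterations, and the earlier cells are
         final. *)
      assert (Hin : (fun j m => (forall a z, In a L -> m a z = E a z) /\ m vi 0 = i /\
         m vj 0 = j /\ m X i = val i (Z.to_nat j) /\
         (forall z, 0 <= z < i -> m X z = val z kb))
       (0 + Z.of_nat kb)
       (loop (run (SWr X (scal vi) (tcomp X e1))) vj kb 0 (upd m1 vj 0 0))).
      { apply loop_ind.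
        - refine (conj _ (conj _ (conj _ (conj _ _)))).
          + intros a z Ha. rewrite upd_array; [auto |]. intros ->. contradiction.
          + rewrite upd_array by discriminate. unfold m1. now rewrite upd_array by auto.
          + apply upd_same.
          + rewrite upd_array by auto. unfold m1. rewrite Em1, upd_same. exact Ini.
          + intros z Hz. rewrite upd_array by auto. unfold m1.
            rewrite Em1, upd_cell by lia. now apply HXz.
        - intros j m' Hj0 (HL' & Hvi' & Hvj' & HXi & HXz'). cbn [run].
          assert (Em' : ev m' (scal vi) = i) by exact Hvi'.
          assert (Stp : ev m' (tcomp X e1) = tev E i j (m' X i) e1)
            by (now apply (ev_tcomp X L E m')).
          refine (conj _ (conj _ (conj _ (conj _ _)))).
          + intros a z Ha. rewrite !upd_array; [auto | |]; intros ->; contradiction.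
          + rewrite upd_array by discriminate. now rewrite upd_array by auto.
          + apply upd_same.
          + rewrite upd_array by auto. rewrite Em', upd_same, Stp, HXi.
            replace (Z.to_nat (j + 1)) with (S (Z.to_nat j)) by lia.
            unfold val. cbn [zfold]. now rewrite Z2Nat.id by lia.
          + intros z Hz. rewrite upd_array by auto.
            rewrite Em', upd_cell by lia. now apply HXz'. }
      replace (Z.to_nat (m1 b 0)) with kb by (unfold kb; now rewrite HL1).
      cbv beta in Hin. set (m2 := loop _ _ _ _ _) in *.
      destruct Hin as (HL2 & Hvi2 & _ & HXi2 & HXz2). split; [| split].
      + intros a z Ha. rewrite upd_array; [auto |]. intros ->. contradiction.
      + apply upd_same.
      + intros z Hz. rewrite upd_array by auto.
        destruct (Z.eq_dec z i) as [-> |]; [| apply HXz2; lia].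
        rewrite HXi2. f_equal. lia. }
  specialize (Hloop (Z.to_nat (E 0%nat 0))). cbv beta in Hloop.
  cbn [tab_stm run tgt bnd ini stp].
  destruct Hloop as (HL & _ & HXz). split; [exact HL |].
  intros i Hi0. apply HXz. lia.
Qed.

Fixpoint tabs_stm (T : tab) (Ts : list tab) : stm :=
  match Ts with
  | [] => tab_stm T
  | T' :: Ts => SSq (tab_stm T) (tabs_stm T' Ts)
  end.

Fixpoint wf_tabs (L : list nat) (Ts : list tab) : bool :=
  match Ts with
  | [] => true
  | T :: Ts =>
      wf_tab L T && negb (inb (tgt T) L) && negb (Nat.eqb (tgt T) vi) &&
      negb (Nat.eqb (tgt T) vj) && wf_tabs (tgt T :: L) Ts
  end.

Lemma wf_tabs_cons (L : list nat) (T : tab) (Ts : list tab) :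
  wf_tabs L (T :: Ts) = true ->
  wf_tab L T = true /\ ~ In (tgt T) L /\ tgt T <> vi /\ tgt T <> vj /\
  wf_tabs (tgt T :: L) Ts = true.
Proof.
  cbn [wf_tabs]. rewrite !andb_true_iff, !negb_true_iff, !Nat.eqb_neq.
  intros [[[[H1 H2] H3] H4] H5]. repeat split; try assumption.
  intros H. apply inb_In in H. congruence.
Qed.

Lemma reads_tev (L : list nat) (E E' : mem) (i j acc : Z) (e : texp) :
  reads L e = true -> (forall a z, In a L -> E a z = E' a z) ->
  tev E i j acc e = tev E' i j acc e.
Proof.
  intros He HL. induction e as [z | | | | a e IH | o e1 IH1 e2 IH2]; simpl in *; auto.
  - apply andb_prop in He as [H1 H2]. rewrite IH by assumption.
    apply HL. now apply inb_In.
  - apply andb_prop in He as [H1 H2]. now rewrite IH1, IH2.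
Qed.

Lemma tab_val_ext (L : list nat) (E E' : mem) (T : tab) (i : Z) :
  wf_tab L T = true -> (forall a z, In a L -> E a z = E' a z) ->
  tab_val E T i = tab_val E' T i.
Proof.
  intros Hwf HL. unfold wf_tab in Hwf.
  apply andb_prop in Hwf as [Hwf _]. apply andb_prop in Hwf as [Hwf R1].
  apply andb_prop in Hwf as [Hb R0]. apply inb_In in Hb.
  unfold tab_val. rewrite (HL _ _ Hb), (reads_tev L E E' i 0 0 (ini T)) by assumption.
  apply zfold_ext. intros. now apply (reads_tev L).
Qed.

(** Every array is written once, after the arrays that it depends on: hence
    the equations defining them all hold in the final memory. *)
Lemma run_tabs (Ts : list tab) (T : tab) (L : list nat) (E : mem) :
  wf_tabs L (T :: Ts) = true -> In 0%nat L -> ~ In vi L -> ~ In vj L ->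
  let E' := run (tabs_stm T Ts) E in
  (forall a z, In a L -> E' a z = E a z) /\
  Forall (fun T => forall i, 0 <= i < E 0%nat 0 -> E' (tgt T) i = tab_val E' T i) (T :: Ts).
Proof.
  revert T L E. induction Ts as [| T' Ts IH]; intros T L E Hwf H0 Hi Hj;
    apply wf_tabs_cons in Hwf as (Hwf & HX & HXi & HXj & Hrest);
    destruct (run_tab L E T) as [F V]; try assumption; cbn [tabs_stm run].
  - split; [exact F |]. constructor; [| constructor].
    intros i Hr. rewrite V by assumption.
    apply (tab_val_ext L); [assumption |]. intros. symmetry. now apply F.
  - set (E1 := run (tab_stm T) E) in *.
    destruct (IH T' (tgt T :: L) E1) as [F' V'].
    + exact Hrest.
    + now right.
    + intros [K | K]; contradiction.
    + intros [K | K]; contradiction.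
    + set (E' := run (tabs_stm T' Ts) E1) in *.
      assert (FL : forall a z, In a L -> E' a z = E a z).
      { intros a z Ha. rewrite F' by now right. now apply F. }
      split; [exact FL |].
      rewrite F in V' by assumption. constructor; [| exact V'].
      intros i Hr. rewrite F' by now left. rewrite V by assumption.
      apply (tab_val_ext L); [assumption |]. intros. symmetry. now apply FL.
Qed.

(** * Sums and tilings *)

Fixpoint zsum (n : nat) (f : Z -> Z) : Z :=
  match n with
  | O => 0
  | S k => zsum k f + f (Z.of_nat k)
  end.

Local Notation rng n i := (0 <= i < Z.of_nat n).

Lemma zsum_le (n : nat) (f g : Z -> Z) :
  (forall i, rng n i -> f i <= g i) -> zsum n f <= zsum n g.
Proof.
  induction n as [| n IH]; intros H; cbn [zsum]; [lia |].
  assert (zsum n f <= zsum n g) by (apply IH; intros; apply H; lia).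
  specialize (H (Z.of_nat n)). lia.
Qed.

Lemma zsum_ext (n : nat) (f g : Z -> Z) :
  (forall i, rng n i -> f i = g i) -> zsum n f = zsum n g.
Proof.
  intros H. apply Z.le_antisymm; apply zsum_le; intros i Hi; rewrite H by assumption; lia.
Qed.

Lemma zsum_add (n : nat) (f g : Z -> Z) :
  zsum n (fun i => f i + g i) = zsum n f + zsum n g.
Proof. induction n as [| n IH]; cbn [zsum]; lia. Qed.

Lemma zsum_scal (n : nat) (c : Z) (f : Z -> Z) :
  zsum n (fun i => c * f i) = c * zsum n f.
Proof. induction n as [| n IH]; cbn [zsum]; lia. Qed.

Lemma zsum_const (n : nat) (c : Z) : zsum n (fun _ => c) = Z.of_nat n * c.
Proof. induction n as [| n IH]; cbn [zsum]; lia. Qed.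

Lemma zsum_nonneg (n : nat) (f : Z -> Z) :
  (forall i, rng n i -> 0 <= f i) -> 0 <= zsum n f.
Proof.
  intros H. pose proof (zsum_const n 0). rewrite Z.mul_0_r in H0. rewrite <- H0.
  now apply zsum_le.
Qed.

Lemma zsum_swap (n m : nat) (f : Z -> Z -> Z) :
  zsum n (fun i => zsum m (f i)) = zsum m (fun j => zsum n (fun i => f i j)).
Proof.
  induction n as [| n IH]; cbn [zsum].
  - rewrite zsum_const. lia.
  - rewrite IH. now rewrite zsum_add.
Qed.

Lemma zsum_single (n : nat) (j : Z) (f : Z -> Z) :
  zsum n (fun i => if i =? j then f i else 0) = if (0 <=? j) && (j <? Z.of_nat n) then f j else 0.
Proof.
  induction n as [| n IH]; cbn [zsum].
  - destruct (_ && _) eqn:E; lia.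
  - rewrite IH. destruct (Z.eqb_spec (Z.of_nat n) j) as [<- |].
    + replace ((0 <=? Z.of_nat n) && (Z.of_nat n <? Z.of_nat n)) with false by lia.
      replace ((0 <=? Z.of_nat n) && (Z.of_nat n <? Z.of_nat (S n))) with true by lia. lia.
    + replace ((0 <=? j) && (j <? Z.of_nat (S n))) with ((0 <=? j) && (j <? Z.of_nat n)) by lia.
      lia.
Qed.

Lemma zsum_split (n : nat) (j : Z) (f : Z -> Z) :
  rng n j -> zsum n f = f j + zsum n (fun i => if i =? j then 0 else f i).
Proof.
  intros Hj. pose proof (zsum_single n j f) as E.
  replace ((0 <=? j) && (j <? Z.of_nat n)) with true in E by lia.
  rewrite <- E, <- zsum_add. apply zsum_ext. intros i _. destruct (i =? j); lia.
Qed.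

Lemma zsum_ge_term (n : nat) (j : Z) (f : Z -> Z) :
  rng n j -> (forall i, rng n i -> 0 <= f i) -> f j <= zsum n f.
Proof.
  intros Hj Hf. rewrite (zsum_split n j) by assumption.
  assert (0 <= zsum n (fun i => if i =? j then 0 else f i)); [| lia].
  apply zsum_nonneg. intros i Hi. destruct (i =? j); [lia | auto].
Qed.

Lemma zsum_pos_ex (n : nat) (f : Z -> Z) :
  0 < zsum n f -> exists i, rng n i /\ 0 < f i.
Proof.
  induction n as [| n IH]; cbn [zsum]; [lia |]. intros H.
  destruct (Z_lt_le_dec 0 (f (Z.of_nat n))) as [L | L].
  - exists (Z.of_nat n). lia.
  - destruct IH as (i & Hi & Hf); [lia |]. exists i. lia.
Qed.

(** Summation along the fibres of [key]. Only nonzero terms must have their key in range. *)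
Lemma zsum_key (n G : nat) (key f : Z -> Z) :
  (forall i, rng n i -> f i <> 0 -> rng G (key i)) ->
  zsum n f = zsum G (fun g => zsum n (fun i => if key i =? g then f i else 0)).
Proof.
  intros H. rewrite zsum_swap. apply zsum_ext. intros i Hi.
  rewrite (zsum_ext G _ (fun g => if g =? key i then f i else 0))
    by (intros; now rewrite Z.eqb_sym).
  rewrite (zsum_single G (key i) (fun _ => f i)).
  destruct (_ && _) eqn:E; [reflexivity |].
  destruct (Z.eq_dec (f i) 0) as [| Hf]; [assumption |]. specialize (H i Hi Hf). lia.
Qed.

Lemma zsum_key_le (n G : nat) (key f : Z -> Z) :
  (forall i, rng n i -> 0 <= f i) ->
  zsum G (fun g => zsum n (fun i => if key i =? g then f i else 0)) <= zsum n f.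
Proof.
  intros H. rewrite zsum_swap. apply zsum_le. intros i Hi.
  rewrite (zsum_ext G _ (fun g => if g =? key i then f i else 0))
    by (intros; now rewrite Z.eqb_sym).
  rewrite (zsum_single G (key i) (fun _ => f i)).
  specialize (H i Hi). destruct (_ && _); lia.
Qed.

Definition wsum (n : nat) (P : Z -> bool) (d : Z -> Z) : Z :=
  zsum n (fun i => if P i then d i else 0).

Definition count (n : nat) (P : Z -> bool) : Z := wsum n P (fun _ => 1).

Lemma wsum_le (n : nat) (P Q : Z -> bool) (d : Z -> Z) :
  (forall i, rng n i -> 0 <= d i) ->
  (forall i, rng n i -> P i = true -> Q i = true) -> wsum n P d <= wsum n Q d.
Proof.
  intros Hd H. apply zsum_le. intros i Hi. specialize (Hd i Hi). specialize (H i Hi).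
  destruct (P i), (Q i); lia.
Qed.

Lemma wsum_ext (n : nat) (P Q : Z -> bool) (d : Z -> Z) :
  (forall i, rng n i -> P i = Q i) -> wsum n P d = wsum n Q d.
Proof. intros H. apply zsum_ext. intros i Hi. now rewrite H. Qed.

Lemma wsum_split (n : nat) (P Q : Z -> bool) (d : Z -> Z) :
  wsum n P d = wsum n (fun i => P i && Q i) d + wsum n (fun i => P i && negb (Q i)) d.
Proof.
  unfold wsum. rewrite <- zsum_add. apply zsum_ext. intros i _.
  destruct (P i), (Q i); simpl; lia.
Qed.

Lemma wsum_key (n G : nat) (P : Z -> bool) (key d : Z -> Z) :
  (forall i, rng n i -> P i = true -> rng G (key i)) ->
  wsum n P d = zsum G (fun g => wsum n (fun i => P i && (key i =? g)) d).
Proof.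
  intros H. unfold wsum. rewrite (zsum_key n G key).
  - apply zsum_ext. intros g _. apply zsum_ext. intros i _.
    destruct (P i), (key i =? g); reflexivity.
  - intros i Hi. specialize (H i Hi). destruct (P i); [auto | lia].
Qed.

Lemma wsum_key_le (n G : nat) (P : Z -> bool) (key d : Z -> Z) :
  (forall i, rng n i -> 0 <= d i) ->
  zsum G (fun g => wsum n (fun i => P i && (key i =? g)) d) <= wsum n P d.
Proof.
  intros H. unfold wsum. eapply Z.le_trans; [| apply (zsum_key_le n G key)].
  - apply zsum_le. intros g _. apply zsum_le. intros i _.
    destruct (P i), (key i =? g); simpl; lia.
  - intros i Hi. specialize (H i Hi). destruct (P i); lia.
Qed.

(** The fibres of [key] are disjoint, and each of the [G] fibres contributes at least one element of
    [Q]. *)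
Lemma count_pigeon (n G : nat) (Q : Z -> bool) (key : Z -> Z) :
  (forall g, rng G g -> exists i, rng n i /\ Q i = true /\ key i = g) ->
  Z.of_nat G <= count n Q.
Proof.
  intros H. unfold count. eapply Z.le_trans; [| apply (wsum_key_le n G Q key); lia].
  rewrite <- (Z.mul_1_r (Z.of_nat G)), <- zsum_const. apply zsum_le. intros g Hg.
  destruct (H g Hg) as (i & Hi & Qi & Ki). unfold wsum.
  eapply Z.le_trans; [| apply (zsum_ge_term n i); [assumption |]].
  - cbv beta. rewrite Qi, Ki, Z.eqb_refl. simpl. lia.
  - intros j _. destruct (_ && _); lia.
Qed.

(** * Extremal elements of finite total orders *)

Lemma exists_least (n : nat) (R : Z -> Z -> bool) (Q : Z -> bool) :
  (forall i j l, R i j = true -> R j l = true -> R i l = true) ->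
  (forall i j, i <> j -> R i j = true \/ R j i = true) ->
  (exists i, rng n i /\ Q i = true) ->
  exists i, rng n i /\ Q i = true /\
    forall j, rng n j -> Q j = true -> j = i \/ R i j = true.
Proof.
  intros Ht Htot. induction n as [| n IH]; intros (i & Hi & Qi); [lia |].
  destruct (Q (Z.of_nat n)) eqn:En.
  - destruct (existsb (fun k => Q (Z.of_nat k)) (seq 0 n)) eqn:Ex.
    + apply existsb_exists in Ex as (k & Hk & Qk). apply in_seq in Hk.
      destruct IH as (i0 & Hi0 & Q0 & H0); [exists (Z.of_nat k); split; [lia | assumption] |].
      destruct (Htot i0 (Z.of_nat n)) as [H1 | H1]; [lia | |].
      * exists i0. split; [lia |]. split; [assumption |]. intros j Hj Qj.
        destruct (Z.eq_dec j (Z.of_nat n)) as [-> |]; [now right | apply H0; [lia | assumption]].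
      * exists (Z.of_nat n). split; [lia |]. split; [assumption |]. intros j Hj Qj.
        destruct (Z.eq_dec j (Z.of_nat n)) as [-> |]; [now left |]. right.
        destruct (H0 j) as [-> | H2]; [lia | assumption | assumption |]. eapply Ht; eassumption.
    + exists (Z.of_nat n). split; [lia |]. split; [assumption |]. intros j Hj Qj.
      destruct (Z.eq_dec j (Z.of_nat n)) as [-> |]; [now left |]. exfalso.
      assert (existsb (fun k => Q (Z.of_nat k)) (seq 0 n) = true); [| congruence].
      apply existsb_exists. exists (Z.to_nat j). rewrite in_seq, Z2Nat.id by lia.
      split; [lia | assumption].
  - destruct IH as (i0 & Hi0 & Q0 & H0).
    + exists i. split; [| assumption].
      destruct (Z.eq_dec i (Z.of_nat n)) as [-> |]; [congruence | lia].
    + exists i0. split; [lia |]. split; [assumption |]. intros j Hj Qj.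
      apply H0; [| assumption].
      destruct (Z.eq_dec j (Z.of_nat n)) as [-> |]; [congruence | lia].
Qed.

(** Ties are broken by the index: the order is strict and total for any key, so that tiles laid in
    this order never overlap. *)
Definition bef (key : Z -> Z) (j i : Z) : bool :=
  (key j <? key i) || ((key j =? key i) && (j <? i)).

Lemma exists_first (n : nat) (key : Z -> Z) (Q : Z -> bool) :
  (exists i, rng n i /\ Q i = true) ->
  exists i, rng n i /\ Q i = true /\
    forall j, rng n j -> Q j = true -> j = i \/ bef key i j = true.
Proof. apply exists_least; unfold bef; lia. Qed.

Lemma exists_last (n : nat) (key : Z -> Z) (Q : Z -> bool) :
  (exists i, rng n i /\ Q i = true) ->
  exists i, rng n i /\ Q i = true /\
    forall j, rng n j -> Q j = true -> j = i \/ bef key j i = true.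
Proof. apply (exists_least n (fun i j => bef key j i)); unfold bef; lia. Qed.

(** * Tiles laid end to end in the order of a key *)

Section Positions.
Context (n : nat) (key d : Z -> Z) (dm : Z) (P : Z -> bool).
Hypothesis d_bounds : forall i, rng n i -> 1 <= d i <= dm.

(** Laid end to end in the order [bef key], the elements of [P] tile
    [[0, wsum n P d)], and [offset i] is the left end of the tile of [i]. *)
Definition offset (i : Z) : Z := wsum n (fun j => P j && bef key j i) d.

Lemma d_nonneg (i : Z) : rng n i -> 0 <= d i.
Proof. intros Hi. specialize (d_bounds i Hi). lia. Qed.

Lemma offset_nonneg (i : Z) : 0 <= offset i.
Proof.
  apply zsum_nonneg. intros j Hj. specialize (d_bounds j Hj). destruct (_ && _); lia.
Qed.

Lemma wsum_upto (Q : Z -> bool) (i : Z) :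
  rng n i ->
  (forall j, rng n j -> Q j = true -> P j = true /\ (j = i \/ bef key j i = true)) ->
  wsum n Q d <= offset i + d i.
Proof.
  intros Hi HQ. pose proof (zsum_single n i d) as E.
  replace ((0 <=? i) && (i <? Z.of_nat n)) with true in E by lia.
  rewrite <- E. unfold offset, wsum. rewrite <- zsum_add. apply zsum_le. intros j Hj.
  specialize (HQ j Hj). specialize (d_bounds j Hj). destruct (Q j).
  - destruct HQ as [-> [-> | ->]]; [reflexivity | rewrite Z.eqb_refl; simpl; destruct (bef key i i); lia |].
    simpl. destruct (j =? i); lia.
  - destruct (_ && _), (j =? i); lia.
Qed.

Lemma wsum_upto_ge (Q : Z -> bool) (i : Z) :
  rng n i -> Q i = true ->
  (forall j, rng n j -> P j = true -> bef key j i = true -> Q j = true) ->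
  offset i + d i <= wsum n Q d.
Proof.
  intros Hi Qi HQ. pose proof (zsum_single n i d) as E.
  replace ((0 <=? i) && (i <? Z.of_nat n)) with true in E by lia.
  rewrite <- E. unfold offset, wsum. rewrite <- zsum_add. apply zsum_le. intros j Hj.
  specialize (HQ j Hj). specialize (d_bounds j Hj).
  destruct (Z.eqb_spec j i) as [-> |].
  - rewrite Qi. replace (bef key i i) with false by (unfold bef; lia).
    rewrite andb_false_r. lia.
  - destruct (P j), (bef key j i); simpl; [rewrite HQ by reflexivity; lia | | |];
      destruct (Q j); lia.
Qed.

(** All tiles before the first one that starts at [s] or later start below [s], and they fill the
    space up to it. If no tile starts that late, all of them count. *)
Lemma wsum_below_ge (s : Z) :
  s <= wsum n P d -> s <= wsum n (fun i => P i && (offset i <? s)) d.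
Proof.
  intros Hs.
  destruct (existsb (fun k => P (Z.of_nat k) && (s <=? offset (Z.of_nat k))) (seq 0 n)) eqn:Ex.
  - apply existsb_exists in Ex as (k & Hk & Qk). apply in_seq in Hk.
    destruct (exists_first n key (fun i => P i && (s <=? offset i))) as (i & Hi & Qi & Hmin).
    { exists (Z.of_nat k). split; [lia | assumption]. }
    apply andb_prop in Qi as [Pi Si].
    apply Z.le_trans with (offset i); [lia |]. apply wsum_le; [apply d_nonneg |].
    intros j Hj H. apply andb_prop in H as [Pj Bj]. rewrite Pj. simpl.
    destruct (Z.ltb_spec (offset j) s) as [| G]; [reflexivity |]. exfalso.
    destruct (Hmin j Hj) as [-> | H]; [rewrite Pj; lia | unfold bef in *; lia | unfold bef in *; lia].
  - eapply Z.le_trans; [exact Hs |]. apply wsum_le; [apply d_nonneg |].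
    intros i Hi Pi. rewrite Pi. simpl. destruct (Z.ltb_spec (offset i) s) as [| G]; [reflexivity |].
    exfalso. assert (existsb (fun k => P (Z.of_nat k) && (s <=? offset (Z.of_nat k))) (seq 0 n) = true); [| congruence].
    apply existsb_exists. exists (Z.to_nat i). rewrite in_seq, Z2Nat.id, Pi by lia.
    split; [lia |]. simpl. lia.
Qed.

Lemma wsum_pos_ex (Q : Z -> bool) :
  0 < wsum n Q d -> exists i, rng n i /\ Q i = true.
Proof.
  intros H. apply zsum_pos_ex in H as (i & Hi & H). exists i. split; [assumption |].
  destruct (Q i); [reflexivity | lia].
Qed.

(** The last tile that starts below [s] ends less than [dm] after it. The maximum with 0 accounts
    for [n = 0], where [d_bounds] does not determine the sign of [dm]. *)
Lemma wsum_below_le (s : Z) :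
  0 <= s -> wsum n (fun i => P i && (offset i <? s)) d <= s + Z.max 0 dm.
Proof.
  intros Hs. destruct (Z_lt_le_dec 0 (wsum n (fun i => P i && (offset i <? s)) d)) as [H | H]; [| lia].
  apply wsum_pos_ex in H. apply (exists_last n key) in H as (i & Hi & Qi & Hmax).
  eapply Z.le_trans; [apply (wsum_upto _ i Hi) |].
  - intros j Hj Qj. split; [now apply andb_prop in Qj | now apply Hmax].
  - specialize (d_bounds i Hi). apply andb_prop in Qi as [_ Qi]. lia.
Qed.

(** The tiles that start at or before [v] weigh at least [v + 1], so the last of them extends beyond
    [v]. *)
Lemma tile_at (v : Z) :
  0 <= v < wsum n P d -> exists i, rng n i /\ P i = true /\ offset i <= v < offset i + d i.
Proof.
  intros Hv. assert (H : v + 1 <= wsum n P d) by lia.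
  apply wsum_below_ge in H. set (Q := fun i => P i && (offset i <? v + 1)) in *.
  assert (Ex : 0 < wsum n Q d) by lia.
  apply wsum_pos_ex, (exists_last n key) in Ex as (i & Hi & Qi & Hmax).
  exists i. pose proof Qi as Qi'. unfold Q in Qi'. apply andb_prop in Qi' as [Pi Li].
  split; [assumption |]. split; [assumption |]. split; [lia |].
  assert (wsum n Q d <= offset i + d i); [| lia].
  apply wsum_upto; [assumption |]. intros j Hj Qj. split; [now apply andb_prop in Qj | now apply Hmax].
Qed.

Section Prefix.
Context (V : Z -> bool).
Hypothesis V_closed : forall i j, rng n i -> rng n j -> P i = true -> P j = true ->
  bef key i j = true -> V j = true -> V i = true.

Let c := wsum n (fun i => P i && V i) d.

(** Together with [pos_outside]: the members of the initial segment [V] tile exactly [[0, c)], so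
    membership can be read off from offsets. *)
Lemma pos_in_prefix (i : Z) : rng n i -> P i = true -> V i = true -> offset i + d i <= c.
Proof.
  intros Hi Pi Vi. apply wsum_upto_ge; [assumption | now rewrite Pi, Vi |].
  intros j Hj Pj Bj. rewrite Pj. simpl. now apply (V_closed j i).
Qed.

Lemma pos_outside (i : Z) : rng n i -> P i = true -> V i = false -> c <= offset i.
Proof.
  intros Hi Pi Vi. apply wsum_le; [apply d_nonneg |].
  intros j Hj Q. apply andb_prop in Q as [Pj Vj]. rewrite Pj. simpl.
  destruct (bef key j i) eqn:B; [reflexivity |].
  assert (V i = true); [| congruence]. destruct (Z.eq_dec i j) as [-> |]; [assumption |].
  apply (V_closed i j); try assumption. unfold bef in *. lia.
Qed.

Lemma below_in_prefix (i : Z) :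
  rng n i -> P i = true -> offset i < c -> V i = true.
Proof.
  intros Hi Pi Hc. destruct (V i) eqn:Vi; [reflexivity |].
  pose proof (pos_outside i Hi Pi Vi). lia.
Qed.

(** The tiles that start below [s] all belong to the prefix and already weigh at least [s]. *)
Lemma prefix_tail (s : Z) :
  s <= c -> wsum n (fun i => P i && V i && (s <=? offset i)) d <= c - s.
Proof.
  intros Hs.
  assert (HW : s <= wsum n P d).
  { eapply Z.le_trans; [exact Hs |]. apply wsum_le; [apply d_nonneg |].
    intros i _ H. now apply andb_prop in H. }
  apply wsum_below_ge in HW.
  unfold c. rewrite (wsum_split n (fun i => P i && V i) (fun i => s <=? offset i)).
  assert (wsum n (fun i => P i && (offset i <? s)) d <=
          wsum n (fun i => P i && V i && negb (s <=? offset i)) d); [| lia].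
  apply wsum_le; [apply d_nonneg |]. intros i Hi H. apply andb_prop in H as [Pi Li].
  rewrite Pi. rewrite (below_in_prefix i Hi Pi) by lia. simpl. lia.
Qed.

(** Cut the tiling every [Dp]: the pieces that lie in the prefix [V] all weigh
    at least [D]. *)
Lemma pieces_count (Dp D : Z) (lead : Z -> Z) (box : Z -> bool) :
  0 <= dm -> 0 < D -> D + dm <= Dp ->
  (forall i, rng n i -> P i = true ->
     rng n (lead i) /\ P (lead i) = true /\ offset (lead i) / Dp = offset i / Dp /\
     lead (lead i) = lead i) ->
  (forall l, rng n l -> P l = true -> lead l = l ->
     D <= wsum n (fun j => P j && (offset j / Dp =? offset l / Dp)) d ->
     (forall j, rng n j -> P j = true -> offset j / Dp = offset l / Dp -> V j = true) ->
     box l = true) ->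
  c <= Dp * count n (fun i => P i && box i) + Dp.
Proof.
  intros Hdm HD HDp Hlead Hbox.
  assert (Hc0 : 0 <= c).
  { apply zsum_nonneg. intros i Hi. specialize (d_bounds i Hi). destruct (_ && _); lia. }
  assert (H : Z.of_nat (Z.to_nat (c / Dp)) <= count n (fun i => P i && box i)).
  { apply (count_pigeon n _ _ (fun i => offset i / Dp)). intros g Hg.
    assert (Hgc : (g + 1) * Dp <= c).
    { pose proof (Z.mul_div_le c Dp). rewrite Z2Nat.id in Hg by (apply Z.div_pos; lia). nia. }
    assert (HcW : c <= wsum n P d).
    { apply wsum_le; [apply d_nonneg |]. intros i _ H. now apply andb_prop in H. }
    (* Piece [g] is what starts below [(g + 1) * Dp] but not below [g * Dp]. The former weighs at
       least [(g + 1) * Dp], the rest at most [g * Dp + dm], so the piece weighs at least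
       [Dp - dm >= D]. *)
    assert (A1 := wsum_below_ge ((g + 1) * Dp) ltac:(lia)).
    assert (A2 := wsum_below_le (g * Dp) ltac:(nia)).
    assert (A3 : wsum n (fun i => P i && (offset i <? (g + 1) * Dp)) d <=
      wsum n (fun i => P i && (offset i <? g * Dp)) d +
      wsum n (fun i => P i && (offset i / Dp =? g)) d).
    { unfold wsum. rewrite <- zsum_add. apply zsum_le. intros i Hi.
      specialize (d_bounds i Hi).
      destruct (P i); simpl; [| lia].
      destruct (Z.ltb_spec (offset i) ((g + 1) * Dp)), (Z.ltb_spec (offset i) (g * Dp)),
        (Z.eqb_spec (offset i / Dp) g); try lia.
      exfalso. apply n0. symmetry. apply Z.div_unique with (offset i - g * Dp); lia. }
    assert (A4 : D <= wsum n (fun i => P i && (offset i / Dp =? g)) d) by lia.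
    assert (A5 : 0 < wsum n (fun i => P i && (offset i / Dp =? g)) d) by lia.
    apply wsum_pos_ex in A5 as (i & Hi & Qi). apply andb_prop in Qi as [Pi Gi].
    apply Z.eqb_eq in Gi.
    destruct (Hlead i Hi Pi) as (Hl & Pl & Gl & Ll).
    exists (lead i). split; [assumption |]. split; [| congruence].
    rewrite Pl. simpl. apply Hbox; try assumption.
    - rewrite Gl, Gi. exact A4.
    - intros j Hj Pj Gj. apply below_in_prefix; try assumption.
      rewrite Gl, Gi in Gj. pose proof (Z.mul_succ_div_gt (offset j) Dp). nia. }
  rewrite Z2Nat.id in H by (apply Z.div_pos; lia).
  pose proof (Z.mul_succ_div_gt c Dp). nia.
Qed.

End Prefix.
End Positions.

(** * Counting boxes *)

Section Node.
Context (n : nat) (d q kap lay : Z -> Z) (PN V X box : Z -> bool) (dm Dp M : Z).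
Hypothesis d_bounds : forall i, rng n i -> 1 <= d i <= dm.
Hypothesis Dp_pos : 0 < Dp.
Hypothesis M_pos : 0 < M.
Hypothesis V_closed : forall i j, rng n i -> rng n j -> PN i = true -> PN j = true ->
  bef q i j = true -> V j = true -> V i = true.
Let be := offset n q d PN.
(** [q] is the order in which [V] is a prefix. [X] marks the sensors layered by the other order and
    sorted by [q] within their layer; those with flag [false] are layered by [q] itself. Which side
    plays the role of [X] depends on the position of the query point. *)
Let layer (b : bool) (j i : Z) : bool := PN i && Bool.eqb (X i) b && (lay i =? j).
Hypothesis lay_X : forall i, rng n i -> PN i = true -> X i = true -> 0 <= lay i <= be i / M.
Hypothesis lay_Y : forall i, rng n i -> PN i = true -> X i = false -> lay i = be i / M.
Hypothesis kap_X : forall i, rng n i -> PN i = true -> X i = true -> kap i = q i.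
Hypothesis layer_count : forall b j,
  (forall i i', rng n i -> rng n i' -> layer b j i = true -> layer b j i' = true ->
     bef kap i i' = true -> V i' = true -> V i = true) ->
  wsum n (fun i => layer b j i && V i) d
    <= Dp * count n (fun i => layer b j i && box i) + Dp.

(** In the layers [X] the prefix [V] cuts every layer that it meets into two
    parts, at a loss of one piece each; of the other layers, all but the last
    one that it meets lie within [V]. *)
Lemma node_count (c : Z) :
  c = wsum n (fun i => PN i && V i) d ->
  c <= Dp * count n (fun i => PN i && box i) + (2 * (c / M) + 1) * Dp + M.
Proof.
  intros Ec.
  assert (Hc0 : 0 <= c).
  { rewrite Ec. apply zsum_nonneg. intros i Hi. specialize (d_bounds i Hi). destruct (_ && _); lia. }
  assert (HJ : 0 <= c / M) by (apply Z.div_pos; lia).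
  assert (Hbe0 : forall i, 0 <= be i) by (intros i; apply (offset_nonneg n q d dm PN d_bounds)).
  assert (Hbe : forall i, rng n i -> PN i = true -> V i = true -> be i < c).
  { intros i Hi Pi Vi. pose proof (pos_in_prefix n q d dm PN d_bounds V V_closed i Hi Pi Vi).
    specialize (d_bounds i Hi). unfold be. lia. }
  set (J := Z.to_nat (c / M)).
  (* Sensors of [V] have [be i < c], and no layer index exceeds [be i / M], so only the layers [0]
     to [c / M] are met. *)
  assert (Hrange : forall i, rng n i -> PN i = true -> V i = true -> rng (S J) (lay i)).
  { intros i Hi Pi Vi. specialize (Hbe i Hi Pi Vi).
    assert (be i / M <= c / M) by (apply Z.div_le_mono; lia).
    assert (0 <= be i / M) by (apply Z.div_pos; [apply Hbe0 | lia]).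
    destruct (X i) eqn:Xi.
    - specialize (lay_X i Hi Pi Xi). unfold J. lia.
    - rewrite (lay_Y i Hi Pi Xi). unfold J. lia. }
  assert (EX : wsum n (fun i => PN i && V i && X i) d =
    zsum (S J) (fun j => wsum n (fun i => layer true j i && V i) d)).
  { rewrite (wsum_key n (S J) _ lay).
    - apply zsum_ext. intros j _. apply wsum_ext. intros i _. unfold layer.
      destruct (PN i), (V i), (X i), (lay i =? j); reflexivity.
    - intros i Hi H. apply andb_prop in H as [H _]. apply andb_prop in H as [H1 H2]. auto. }
  assert (EY : wsum n (fun i => PN i && V i && negb (X i)) d =
    zsum (S J) (fun j => wsum n (fun i => layer false j i && V i) d)).
  { rewrite (wsum_key n (S J) _ lay).
    - apply zsum_ext. intros j _. apply wsum_ext. intros i _. unfold layer.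
      destruct (PN i), (V i), (X i), (lay i =? j); reflexivity.
    - intros i Hi H. apply andb_prop in H as [H _]. apply andb_prop in H as [H1 H2]. auto. }
  assert (CX : zsum (S J) (fun j => wsum n (fun i => layer true j i && V i) d) <=
     zsum (S J) (fun j => Dp * count n (fun i => layer true j i && box i) + Dp)).
  { apply zsum_le. intros j _. apply layer_count. unfold layer.
    intros i i' Hi Hi' H H'.
    apply andb_prop in H as [H _]. apply andb_prop in H as [H1 H2]. apply eqb_prop in H2.
    apply andb_prop in H' as [H' _]. apply andb_prop in H' as [H1' H2']. apply eqb_prop in H2'.
    unfold bef. rewrite !kap_X by assumption. now apply V_closed. }
  (* For [j < J] every offset in the layer is below [M * (j + 1) <= c]: the whole layer lies in [V],
     which is thus trivially a prefix of it in the order [kap]. *)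
  assert (CY : zsum J (fun j => wsum n (fun i => layer false j i && V i) d) <=
     zsum J (fun j => Dp * count n (fun i => layer false j i && box i) + Dp)).
  { apply zsum_le. intros j Hj. apply layer_count. unfold layer.
    intros i i' Hi Hi' H _ _ _.
    apply andb_prop in H as [H H3]. apply andb_prop in H as [H1 H2]. apply eqb_prop in H2.
    apply Z.eqb_eq in H3. rewrite (lay_Y i Hi H1 H2) in H3.
    apply (below_in_prefix n q d dm PN d_bounds V V_closed); try assumption.
    rewrite <- Ec. pose proof (Z.mul_succ_div_gt (be i) M M_pos) as H4. rewrite H3 in H4.
    pose proof (Z.mul_div_le c M M_pos). fold (be i).
    assert (M * Z.succ j <= M * (c / M)) by (apply Z.mul_le_mono_nonneg_l; unfold J in Hj; lia).
    lia. }
  (* The last layer by [be] may be cut arbitrarily and is given up. Its part in [V] is a tail of the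
     prefix, of weight at most [c - M * (c / M)]. *)
  assert (CL : wsum n (fun i => layer false (Z.of_nat J) i && V i) d <= M).
  { pose proof (Z.mul_div_le c M M_pos). pose proof (Z.mul_succ_div_gt c M M_pos).
    pose proof (prefix_tail n q d dm PN d_bounds V V_closed (M * (c / M))) as T.
    rewrite <- Ec in T. specialize (T ltac:(lia)).
    eapply Z.le_trans; [| apply Z.le_trans with (c - M * (c / M)); [exact T | lia]].
    apply wsum_le; [intros i Hi; specialize (d_bounds i Hi); lia |].
    unfold layer. intros i Hi K. apply andb_prop in K as [K Vi].
    apply andb_prop in K as [K H3]. apply andb_prop in K as [H1 H2]. apply eqb_prop in H2.
    rewrite H1, Vi. simpl. rewrite (lay_Y i Hi H1 H2) in H3.
    fold (be i). pose proof (Z.mul_div_le (be i) M M_pos).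
    assert (be i / M = c / M) as E by (unfold J in H3; lia). rewrite E in *. lia. }
  assert (BX : zsum (S J) (fun j => count n (fun i => layer true j i && box i)) <=
     count n (fun i => PN i && box i && X i)).
  { eapply Z.le_trans; [| apply (wsum_key_le n (S J) _ lay); lia].
    apply Z.eq_le_incl, zsum_ext. intros j _. apply wsum_ext. intros i _. unfold layer.
    destruct (PN i), (box i), (X i), (lay i =? j); reflexivity. }
  assert (BY : zsum J (fun j => count n (fun i => layer false j i && box i)) <=
     count n (fun i => PN i && box i && negb (X i))).
  { eapply Z.le_trans; [| apply (wsum_key_le n J _ lay); lia].
    apply Z.eq_le_incl, zsum_ext. intros j _. apply wsum_ext. intros i _. unfold layer.
    destruct (PN i), (box i), (X i), (lay i =? j); reflexivity. }
  rewrite zsum_add, zsum_scal, zsum_const in CX, CY.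
  rewrite (wsum_split n (fun i => PN i && V i) X), EX, EY in Ec.
  cbn [zsum] in EX, EY, Ec. cbn [zsum] in CX, BX.
  pose proof (wsum_split n (fun i => PN i && box i) X (fun _ => 1)) as S0.
  unfold count in *. 
  replace (Z.of_nat (S J)) with (c / M + 1) in CX by (unfold J; lia).
  replace (Z.of_nat J) with (c / M) in CY by (unfold J; lia).
  set (a := wsum n (fun i => PN i && box i && X i) (fun _ => 1)) in *.
  set (b := wsum n (fun i => PN i && box i && negb (X i)) (fun _ => 1)) in *.
  apply (Z.mul_le_mono_nonneg_l _ _ Dp) in BX; [| lia].
  apply (Z.mul_le_mono_nonneg_l _ _ Dp) in BY; [| lia].
  rewrite S0. lia.
Qed.
End Node.

Lemma count_lt (n : nat) (P Q : Z -> bool) (i : Z) :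
  (forall j, rng n j -> P j = true -> Q j = true) -> rng n i -> P i = false -> Q i = true ->
  count n P < count n Q.
Proof.
  intros H Hi Pi Qi. unfold count, wsum. 
  rewrite (zsum_split n i (fun j => if P j then 1 else 0)) by assumption.
  rewrite (zsum_split n i (fun j => if Q j then 1 else 0)) by assumption.
  rewrite Pi, Qi.
  assert (zsum n (fun j => if j =? i then 0 else if P j then 1 else 0) <=
          zsum n (fun j => if j =? i then 0 else if Q j then 1 else 0)); [| lia].
  apply zsum_le. intros j Hj. specialize (H j Hj).
  destruct (j =? i), (P j), (Q j); lia.
Qed.

Lemma count_le (n : nat) (P Q : Z -> bool) :
  (forall j, rng n j -> P j = true -> Q j = true) -> count n P <= count n Q.
Proof. intros H. apply wsum_le; [lia | exact H]. Qed.

Lemma count_le_n (n : nat) (P : Z -> bool) : 0 <= count n P <= Z.of_nat n.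
Proof.
  split; [apply zsum_nonneg; intros; destruct (P i); lia |].
  rewrite <- (Z.mul_1_r (Z.of_nat n)), <- zsum_const. apply zsum_le.
  intros i _. destruct (P i); lia.
Qed.

(** * Nodes, layers and pieces, and the boxes that they yield at a query point *)

Section Grouping.
Context (n : nat) (lo hi d w h al be side lay kap ga g lead gw ba bb : Z -> Z).
Context (k dm D Dp M : Z).
Hypothesis d_bounds : forall i, rng n i -> 1 <= d i <= dm.

(** A node of the dyadic tree is named by its power of two [w] and by [h], where [h * w] is the rank
    shared by its sensors. Layers ([same]) and pieces ([grp]) refine this partition. *)
Definition node (i j : Z) : bool := (w j =? w i) && (h j =? h i).
Definition same (i j : Z) : bool := node i j && (side j =? side i) && (lay j =? lay i).
Definition grp (i j : Z) : bool := same i j && (g j =? g i).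

Hypothesis al_def : forall i, rng n i -> al i = wsum n (fun j => node i j && bef lo j i) d.
Hypothesis be_def : forall i, rng n i ->
  be i = wsum n (fun j => node i j && bef (fun j => - hi j) j i) d.
Hypothesis side_def : forall i, rng n i -> side i = if be i <? al i then 1 else 0.
Hypothesis lay_def : forall i, rng n i -> lay i = (if side i =? 1 then be i else al i) / M.
Hypothesis kap_def : forall i, rng n i -> kap i = if side i =? 1 then lo i else - hi i.
Hypothesis ga_def : forall i, rng n i -> ga i = wsum n (fun j => same i j && bef kap j i) d.
Hypothesis g_def : forall i, rng n i -> g i = ga i / Dp.
Hypothesis lead_in : forall i, rng n i -> rng n (lead i) /\ grp i (lead i) = true.
Hypothesis lead_eq : forall i j, rng n i -> rng n j -> grp i j = true -> lead j = lead i.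
Hypothesis gw_def : forall i, rng n i -> gw i = wsum n (grp i) d.
Hypothesis box_in : forall l x, rng n l -> lead l = l -> D <= gw l ->
  (forall j, rng n j -> grp l j = true -> lo j <= x < hi j) -> ba l <= x < bb l.

Let cov (x i : Z) : bool := (lo i <=? x) && (x <? hi i).
Let inbox (x i : Z) : bool := (ba i <=? x) && (x <? bb i).

Section Query.
Context (x : Z).
Hypothesis D_pos : 0 < D.
Hypothesis Dp_ge : D + dm <= Dp.
Hypothesis dm_pos : 0 <= dm.
Hypothesis M_pos : 0 < M.

(** When [P] is a full layer, the offsets within [P] are the computed [ga], and its pieces are the
    classes of [grp]; so [pieces_count] applies with the boxes built by the program. *)
Lemma layer_pieces (P : Z -> bool) :
  (forall i j, rng n i -> rng n j -> P i = true -> P j = same i j) ->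
  (forall i j, rng n i -> rng n j -> P i = true -> P j = true ->
     bef kap i j = true -> cov x j = true -> cov x i = true) ->
  wsum n (fun i => P i && cov x i) d <= Dp * count n (fun i => P i && inbox x i) + Dp.
Proof.
  intros HP HV.
  assert (Hpos : forall i, rng n i -> P i = true -> offset n kap d P i / Dp = g i).
  { intros i Hi Pi. rewrite g_def, ga_def by assumption. f_equal.
    apply wsum_ext. intros j Hj. now rewrite (HP i j). }
  assert (Hgrp : forall i j, rng n i -> rng n j -> P i = true ->
    P j && (offset n kap d P j / Dp =? g i) = grp i j).
  { intros i j Hi Hj Pi. unfold grp. rewrite <- (HP i j) by assumption.
    destruct (P j) eqn:Pj; simpl; [now rewrite Hpos | reflexivity]. }
  apply (pieces_count n kap d dm P d_bounds (cov x) HV Dp D lead (inbox x)); try assumption.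
  - intros i Hi Pi. destruct (lead_in i Hi) as [Hl Gl].
    pose proof Gl as Gl'. rewrite <- Hgrp in Gl' by assumption.
    apply andb_prop in Gl' as [Pl El]. apply Z.eqb_eq in El.
    rewrite El, Hpos by assumption. repeat split; try lia; try assumption.
    now apply lead_eq.
  - intros l Hl Pl Ll Hw HV'.
    assert (ba l <= x < bb l); [| unfold inbox; lia].
    apply box_in; try assumption.
    + rewrite gw_def by assumption. eapply Z.le_trans; [exact Hw |].
      apply Z.eq_le_incl, wsum_ext. intros j Hj. rewrite (Hpos l) by assumption. now apply Hgrp.
    + intros j Hj Gj. rewrite <- Hgrp in Gj by assumption.
      apply andb_prop in Gj as [Pj Ej]. apply Z.eqb_eq in Ej.
      assert (cov x j = true) by (apply HV'; try assumption; now rewrite (Hpos l)).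
      unfold cov in *. lia.
Qed.

(** If all left ends are at most [x], containing [x] depends on the right ends only, and the sensors
    containing [x] form a prefix by decreasing [hi]; side 0, sorted by that key, plays [X]. In the
    other case they form a prefix by [lo], and side 1 plays [X]. *)
Lemma node_query (i0 c : Z) :
  rng n i0 ->
  (forall j, rng n j -> node i0 j = true -> lo j <= x) \/
  (forall j, rng n j -> node i0 j = true -> x < hi j) ->
  c = wsum n (fun i => node i0 i && cov x i) d ->
  c <= Dp * count n (fun i => node i0 i && inbox x i) + (2 * (c / M) + 1) * Dp + M.
Proof.
  intros Hi0 HQ Ec.
  assert (Hnode : forall i j, rng n i -> node i0 i = true -> node i j = node i0 j)
    by (unfold node; intros; lia).
  assert (Hal : forall i, rng n i -> node i0 i = true -> offset n lo d (node i0) i = al i).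
  { intros i Hi Ni. rewrite al_def by assumption. apply wsum_ext. intros j _.
    now rewrite (Hnode i j). }
  assert (Hbe : forall i, rng n i -> node i0 i = true ->
    offset n (fun j => - hi j) d (node i0) i = be i).
  { intros i Hi Ni. rewrite be_def by assumption. apply wsum_ext. intros j _.
    now rewrite (Hnode i j). }
  assert (Hal0 : forall i, rng n i -> node i0 i = true -> 0 <= al i).
  { intros i Hi Ni. rewrite <- Hal by assumption. now apply (offset_nonneg n lo d dm). }
  assert (Hbe0 : forall i, rng n i -> node i0 i = true -> 0 <= be i).
  { intros i Hi Ni. rewrite <- Hbe by assumption. now apply (offset_nonneg n _ d dm). }
  assert (Hlayer : forall X, (X = (fun i => side i =? 0) \/ X = (fun i => side i =? 1)) ->
    forall b j i i', rng n i -> rng n i' ->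
    node i0 i && Bool.eqb (X i) b && (lay i =? j) = true ->
    node i0 i' && Bool.eqb (X i') b && (lay i' =? j) = same i i').
  { intros X HX b j i i' Hi Hi' H. apply andb_prop in H as [H H3]. apply andb_prop in H as [H1 H2].
    unfold same. rewrite (Hnode i i') by assumption. apply eqb_prop in H2. subst b.
    apply Z.eqb_eq in H3. subst j. f_equal. f_equal.
    pose proof (side_def i Hi) as Si. pose proof (side_def i' Hi') as Si'.
    destruct HX as [-> | ->]; destruct (_ <? _), (be i' <? _); rewrite Si, Si'; reflexivity. }
  destruct HQ as [HQ | HQ].
  - apply (node_count n d (fun j => - hi j) kap lay (node i0) (cov x) (fun i => side i =? 0)
      (inbox x) dm Dp M); try assumption; try lia.
    + intros i j Hi Hj Ni Nj B Cj. specialize (HQ i Hi Ni). unfold bef, cov in *. lia.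
    + intros i Hi Ni Si. rewrite Hbe by assumption. rewrite lay_def by assumption.
      specialize (Hal0 i Hi Ni). rewrite side_def in * by assumption.
      destruct (Z.ltb_spec (be i) (al i)); [discriminate |]. simpl.
      split; [apply Z.div_pos; lia | apply Z.div_le_mono; lia].
    + intros i Hi Ni Si. rewrite Hbe by assumption. rewrite lay_def by assumption.
      rewrite side_def in * by assumption.
      destruct (Z.ltb_spec (be i) (al i)); [reflexivity | discriminate].
    + intros i Hi Ni Si. rewrite kap_def by assumption.
      apply Z.eqb_eq in Si. now rewrite Si.
    + intros b j HV. apply layer_pieces; [| exact HV]. intros i i' Hi Hi' Pi. apply (Hlayer (fun i => side i =? 0) (or_introl eq_refl) b j); assumption.
  - apply (node_count n d lo kap lay (node i0) (cov x) (fun i => side i =? 1)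
      (inbox x) dm Dp M); try assumption; try lia.
    + intros i j Hi Hj Ni Nj B Cj. specialize (HQ i Hi Ni). unfold bef, cov in *. lia.
    + intros i Hi Ni Si. rewrite Hal by assumption. rewrite lay_def by assumption.
      specialize (Hbe0 i Hi Ni). rewrite side_def in * by assumption.
      destruct (Z.ltb_spec (be i) (al i)); [| discriminate]. simpl.
      split; [apply Z.div_pos; lia | apply Z.div_le_mono; lia].
    + intros i Hi Ni Si. rewrite Hal by assumption. rewrite lay_def by assumption.
      rewrite side_def in * by assumption.
      destruct (Z.ltb_spec (be i) (al i)); [discriminate | reflexivity].
    + intros i Hi Ni Si. rewrite kap_def by assumption. now rewrite Si.
    + intros b j HV. apply layer_pieces; [| exact HV]. intros i i' Hi Hi' Pi. apply (Hlayer (fun i => side i =? 1) (or_intror eq_refl) b j); assumption.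
Qed.

Context (rl rr : Z -> Z) (e : Z -> Z) (H : nat).
Hypothesis rl_def : forall i, rng n i -> rl i = count n (fun j => lo j <? lo i).
Hypothesis rr_def : forall i, rng n i -> rr i = count n (fun j => lo j <? hi i).
Hypothesis w_def : forall i, rng n i -> w i = 2 ^ e i /\ rng H (e i) /\
  rl i / w i < rr i / w i /\ rr i / (w i + w i) <= rl i / (w i + w i).
Hypothesis h_def : forall i, rng n i -> h i = rr i / w i.

Let rx := count n (fun j => lo j <=? x).

(** Passing to ranks turns a sensor into the integer interval [(rl i, rr i]] and the point [x] into
    [rx]. Strictness on the left holds because the left end of [i] itself is counted in [rx]. *)
Lemma rx_bounds (i : Z) : rng n i -> cov x i = true -> rl i < rx <= rr i.
Proof.
  intros Hi Ci. rewrite rl_def, rr_def by assumption. unfold rx, cov in *. split.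
  - apply (count_lt n _ _ i); [intros; lia | assumption | lia | lia].
  - apply count_le. intros. lia.
Qed.

(** No multiple of [2 * w i] lies in [(rl i, rr i]], so [rl i], [rx] and [rr i] have the same
    quotient by [2 * w i]. The interval contains exactly one multiple of [w i], an odd one, and it
    is determined by [rx]. Hence a point concerns one node per level. *)
Lemma h_unique (i : Z) : rng n i -> cov x i = true -> h i = 2 * (rx / (2 * w i)) + 1.
Proof.
  intros Hi Ci. destruct (w_def i Hi) as (Hw & He & H1 & H2).
  pose proof (rx_bounds i Hi Ci) as Hrx. rewrite h_def by assumption.
  assert (Hw0 : 0 < w i) by (rewrite Hw; apply Z.pow_pos_nonneg; lia).
  replace (w i + w i) with (2 * w i) in H2 by lia.
  assert (Hl : rl i / (2 * w i) <= rx / (2 * w i)) by (apply Z.div_le_mono; lia).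
  assert (Hr : rx / (2 * w i) <= rr i / (2 * w i)) by (apply Z.div_le_mono; lia).
  rewrite (Z.mul_comm 2 (w i)) in *.
  rewrite <- !Z.div_div in * by lia.
  pose proof (Z.div_mod (rl i / w i) 2). pose proof (Z.mod_pos_bound (rl i / w i) 2).
  pose proof (Z.div_mod (rr i / w i) 2). pose proof (Z.mod_pos_bound (rr i / w i) 2).
  lia.
Qed.

(** All sensors of the node contain the rank [h i0 * w i0]; the side of this rank on which [rx] lies
    decides which of the two ends matters. *)
Lemma node_one_sided (i0 : Z) : rng n i0 ->
  (forall j, rng n j -> node i0 j = true -> lo j <= x) \/
  (forall j, rng n j -> node i0 j = true -> x < hi j).
Proof.
  intros Hi0.
  assert (Hp : forall j, rng n j -> node i0 j = true ->
    rl j < h i0 * w i0 <= rr j).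
  { intros j Hj Nj. unfold node in Nj. apply andb_prop in Nj as [W E].
    apply Z.eqb_eq in W, E. destruct (w_def j Hj) as (Hw & He & H1 & _).
    rewrite <- W, <- E, h_def by assumption.
    assert (Hw0 : 0 < w j) by (rewrite Hw; apply Z.pow_pos_nonneg; lia).
    pose proof (Z.mul_div_le (rr j) (w j) Hw0). split; [| lia].
    pose proof (Z.mul_succ_div_gt (rl j) (w j) Hw0). nia. }
  destruct (Z_le_gt_dec (h i0 * w i0) rx) as [L | L].
  - left. intros j Hj Nj. specialize (Hp j Hj Nj).
    destruct (Z_le_gt_dec (lo j) x) as [| G]; [assumption |]. exfalso.
    assert (rx <= rl j); [| lia]. rewrite rl_def by assumption.
    apply count_le. intros. lia.
  - right. intros j Hj Nj. specialize (Hp j Hj Nj).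
    destruct (Z_lt_le_dec x (hi j)) as [| G]; [assumption |]. exfalso.
    assert (rr j <= rx); [| lia]. rewrite rr_def by assumption.
    apply count_le. intros. lia.
Qed.

(** By [h_unique] the sensors of level [l] that contain [x] are those of a single node, and the
    boxes of that node are among the boxes of the level. *)
Lemma level_count (l c : Z) :
  c = wsum n (fun i => cov x i && (e i =? l)) d ->
  c <= Dp * count n (fun i => inbox x i && (e i =? l)) + (2 * (c / M) + 1) * Dp + M.
Proof.
  intros Ec.
  pose proof (proj1 (count_le_n n (fun i => inbox x i && (e i =? l)))) as Hcnt.
  destruct (Z_lt_le_dec 0 c) as [Hc | Hc].
  - rewrite Ec in Hc. apply wsum_pos_ex in Hc as (i0 & Hi0 & Q).
    apply andb_prop in Q as [C0 E0]. apply Z.eqb_eq in E0.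
    eapply Z.le_trans; [apply (node_query i0 c Hi0 (node_one_sided i0 Hi0)) |].
    + rewrite Ec. apply wsum_ext. intros i Hi.
      destruct (cov x i) eqn:Ci; [| now rewrite andb_false_r]. rewrite andb_true_r. simpl.
      pose proof (h_unique i Hi Ci). pose proof (h_unique i0 Hi0 C0).
      destruct (w_def i Hi) as (Hw & He & _). destruct (w_def i0 Hi0) as (Hw0 & He0 & _).
      unfold node. destruct (Z.eqb_spec (e i) l) as [El | El].
      * assert (w i = w i0) as W by (rewrite Hw, Hw0; congruence).
        rewrite W in *. lia.
      * assert (w i <> w i0); [| lia].
        intros W. apply El. rewrite Hw, Hw0 in W. apply Z.pow_inj_r in W; lia.
    + assert (count n (fun i => node i0 i && inbox x i) <=
              count n (fun i => inbox x i && (e i =? l))); [| nia].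
      apply count_le. intros i Hi Q. apply andb_prop in Q as [Ni Bi]. rewrite Bi. simpl.
      destruct (w_def i Hi) as (Hw & He & _). destruct (w_def i0 Hi0) as (Hw0 & He0 & _).
      unfold node in Ni. apply andb_prop in Ni as [W _]. apply Z.eqb_eq in W.
      rewrite Hw, Hw0 in W. apply Z.pow_inj_r in W; lia.
  - assert (0 <= c).
    { rewrite Ec. apply zsum_nonneg. intros i Hi. specialize (d_bounds i Hi).
      destruct (_ && _); lia. }
    assert (c = 0) as -> by lia. rewrite Z.div_0_l by lia. nia.
Qed.

Lemma boxes_count :
  0 < k -> M = k * Dp ->
  k * wsum n (cov x) d <=
    k * Dp * count n (inbox x) + 2 * wsum n (cov x) d + Z.of_nat H * (k * (k + 1) * Dp).
Proof.
  intros Hk EM.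
  rewrite (wsum_key n H (cov x) e) by (intros i Hi _; now apply (w_def i)).
  assert (Hcnt : zsum H (fun l => count n (fun i => inbox x i && (e i =? l)))
    <= count n (inbox x)) by (apply wsum_key_le; lia).
  assert (Hz : zsum H (fun l => k * wsum n (fun i => cov x i && (e i =? l)) d) <=
    zsum H (fun l => k * Dp * count n (fun i => inbox x i && (e i =? l)) +
      (2 * wsum n (fun i => cov x i && (e i =? l)) d + k * (k + 1) * Dp))).
  { apply zsum_le. intros l _. set (c := wsum _ _ _).
    pose proof (level_count l c eq_refl) as L.
    pose proof (Z.mul_div_le c M M_pos) as Hm.
    generalize dependent (c / M). intros q L Hm.
    set (cnt := count _ _) in *.
    apply (Z.mul_le_mono_nonneg_l _ _ k) in L; [| lia].
    (* As [M = k * Dp], the loss of [2 * (c / M)] pieces, multiplied by [k], is at most [2 * c]. The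
       remaining [Dp + M] gives [k * (k + 1) * Dp] per level. *)
    assert (E1 : k * (2 * q + 1) * Dp = 2 * (M * q) + k * Dp) by (rewrite EM; ring).
    assert (E2 : k * M = k * k * Dp) by (rewrite EM; ring).
    lia. }
  rewrite zsum_scal, !zsum_add, !zsum_scal, zsum_const in Hz.
  assert (k * Dp * zsum H (fun l => count n (fun i => inbox x i && (e i =? l)))
    <= k * Dp * count n (inbox x)) by (apply Z.mul_le_mono_nonneg_l; nia).
  lia.
Qed.
End Query.
End Grouping.

(** * Colouring the boxes *)

Definition tand (c c' : expr) : expr := Op Mul c c'.
(** A conditional without branching. When [c] is a test, both products have a test on the left, as
    [slow] demands. *)
Definition tite (c a b : expr) : expr := Op Add (Op Mul c a) (Op Mul (Op Eq c (Num 0)) b).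

Definition b2z (b : bool) : Z := if b then 1 else 0.

Lemma ev_tite (m : mem) (c a b : expr) (t : bool) :
  ev m c = b2z t -> ev m (tite c a b) = if t then ev m a else ev m b.
Proof. intros H. cbn [tite ev binop_sem]. rewrite H.
  destruct t; unfold b2z; [change (1 =? 0) with false | change (0 =? 0) with true]; cbv iota; ring.
Qed.

Section Colouring.
Context (n : nat) (ba bb : Z -> Z) (N x : Z).
Let inbox (i : Z) : bool := (ba i <=? x) && (x <? bb i).

(** As long as no handled box starts to the right of [x], a colour covers [x] exactly if it reaches
    beyond [x]. Afterwards [reach] says nothing about [x], so by then the first alternative must
    hold: every colour already has a box at [x]. *)
Definition covered (Pr : Z -> bool) (reach col : Z -> Z) : Prop :=
  (forall c, 0 <= c < N -> exists l, rng n l /\ Pr l = true /\ col l = c /\ inbox l = true) \/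
  ((forall l, rng n l -> Pr l = true -> ba l <= x) /\
   Z.min N (count n (fun l => Pr l && inbox l)) <= count (Z.to_nat N) (fun c => x <? reach c) /\
   (forall c, 0 <= c < N -> x < reach c ->
      exists l, rng n l /\ Pr l = true /\ col l = c /\ inbox l = true)).

Lemma covered_ext (Pr Pr' : Z -> bool) (reach reach' col col' : Z -> Z) :
  (forall i, rng n i -> Pr i = Pr' i) -> (forall c, reach c = reach' c) ->
  (forall i, col i = col' i) -> covered Pr reach col -> covered Pr' reach' col'.
Proof.
  intros HP Hr Hc [G | (H1 & H2 & H3)]; [left | right].
  - intros c Hc0. destruct (G c Hc0) as (l & Hl & Pl & Cl & Bl). exists l.
    rewrite <- HP, <- Hc by assumption. auto.
  - split; [| split].
    + intros l Hl Pl. apply H1; [assumption | now rewrite HP].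
    + unfold count in *. rewrite (wsum_ext n _ (fun l => Pr l && inbox l))
        by (intros; now rewrite HP).
      rewrite (wsum_ext (Z.to_nat N) _ (fun c => x <? reach c)) by (intros; now rewrite Hr).
      exact H2.
    + intros c Hc0 Hx. rewrite <- Hr in Hx.
      destruct (H3 c Hc0 Hx) as (l & Hl & Pl & Cl & Bl). exists l.
      rewrite <- HP, <- Hc by assumption. auto.
Qed.

Lemma count_all (P : Z -> bool) (m : nat) :
  Z.of_nat m <= count m P -> forall c, rng m c -> P c = true.
Proof.
  intros H c Hc. destruct (P c) eqn:E; [reflexivity |].
  assert (count m P < count m (fun _ => true)) by (apply (count_lt m _ _ c); auto).
  pose proof (count_le_n m (fun _ => true)). lia.
Qed.

Lemma count_true (m : nat) (P : Z -> bool) :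
  (forall c, rng m c -> P c = true) -> count m P = Z.of_nat m.
Proof.
  intros H. pose proof (count_le_n m P).
  assert (count m (fun _ => true) <= count m P) by (apply count_le; auto).
  unfold count at 1, wsum in H1. rewrite zsum_const in H1. lia.
Qed.

(** As long as a point [x] is not covered in some colour, every new box that
    contains [x] goes to a colour where [x] is not yet covered. *)
Lemma covered_step (Pr Pr' : Z -> bool) (reach reach' col col' : Z -> Z) (i best : Z) :
  0 <= N <= count n inbox -> rng n i -> Pr i = false ->
  (forall j, rng n j -> Pr' j = Pr j || (j =? i)) ->
  (x < ba i -> forall l, rng n l -> ba l <= x -> Pr l = true) ->
  0 <= best < N -> (forall c, 0 <= c < N -> reach best <= reach c) ->
  (forall j, j <> i -> col' j = col j) -> col' i = best ->
  (forall c, c <> best -> reach' c = reach c) ->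
  reach' best = Z.max (reach best) (bb i) ->
  covered Pr reach col -> covered Pr' reach' col'.
Proof.
  intros HN Hi Pi HPr Hord Hb Hmin Hcol Hcoli Hr Hrb Hcov.
  assert (Hkeep : forall l c, rng n l -> Pr l = true -> col l = c -> inbox l = true ->
    exists l, rng n l /\ Pr' l = true /\ col' l = c /\ inbox l = true).
  { intros l c Hl Pl Cl Bl. exists l. split; [assumption |].
    rewrite HPr, Pl by assumption. split; [reflexivity |]. split; [| assumption].
    rewrite Hcol; [assumption |]. intros ->. congruence. }
  destruct Hcov as [G | (H1 & H2 & H3)].
  { left. intros c Hc. destruct (G c Hc) as (l & Hl & Pl & Cl & Bl). now apply (Hkeep l). }
  destruct (Z_le_gt_dec (ba i) x) as [Hx | Hx].
  - right. split; [| split].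
    + intros l Hl Pl. rewrite HPr in Pl by assumption.
      apply orb_prop in Pl as [Pl | Pl]; [auto |]. apply Z.eqb_eq in Pl. now subst.
    + assert (Ebox : count n (fun l => Pr' l && inbox l) =
        count n (fun l => Pr l && inbox l) + (if inbox i then 1 else 0)).
      { unfold count, wsum.
        rewrite (zsum_split n i (fun l => if Pr' l && inbox l then 1 else 0)) by assumption.
        rewrite (zsum_split n i (fun l => if Pr l && inbox l then 1 else 0)) by assumption.
        rewrite HPr, Pi, Z.eqb_refl by assumption. simpl.
        rewrite (zsum_ext n (fun j => if j =? i then 0 else if Pr' j && inbox j then 1 else 0)
                            (fun j => if j =? i then 0 else if Pr j && inbox j then 1 else 0)); [lia |].
        intros j Hj. rewrite HPr by assumption. destruct (j =? i); [reflexivity |].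
        now rewrite orb_false_r. }
      assert (Hm : count (Z.to_nat N) (fun c => x <? reach c) <=
                   count (Z.to_nat N) (fun c => x <? reach' c)).
      { apply count_le. intros c Hc Hlt. destruct (Z.eq_dec c best) as [-> |]; [lia |].
        now rewrite Hr. }
      rewrite Ebox. destruct (inbox i) eqn:Bi; [| lia].
      (* If even the colour of least reach passes [x], all [N] colours do, and the minimum with [N]
         absorbs the new box. Otherwise the box adds a colour that passes [x]. *)
      destruct (Z_lt_le_dec x (reach best)) as [L | L].
      * rewrite (count_true (Z.to_nat N) (fun c => x <? reach c)) in Hm; [lia |].
        intros c Hc. specialize (Hmin c). lia.
      * assert (count (Z.to_nat N) (fun c => x <? reach c) <
                count (Z.to_nat N) (fun c => x <? reach' c)); [| lia].
        apply (count_lt _ _ _ best); try lia.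
        -- intros c Hc Hlt. destruct (Z.eq_dec c best) as [-> |]; [lia |]. now rewrite Hr.
        -- unfold inbox in Bi. lia.
    + intros c Hc Hxc. destruct (Z.eq_dec c best) as [-> |].
      * destruct (Z_lt_le_dec x (reach best)) as [L | L].
        -- destruct (H3 best Hc L) as (l & Hl & Pl & Cl & Bl). now apply (Hkeep l).
        -- exists i. split; [assumption |]. rewrite HPr, Z.eqb_refl, orb_true_r by assumption.
           split; [reflexivity |]. split; [assumption |]. unfold inbox. lia.
      * rewrite Hr in Hxc by assumption.
        destruct (H3 c Hc Hxc) as (l & Hl & Pl & Cl & Bl). now apply (Hkeep l).
  (* The first box to the right of [x]: all boxes at [x] have been handled. There are at least [N]
     of them, so all colours reach beyond [x]. *)
  - left. intros c Hc.
    assert (E : count n inbox <= count n (fun l => Pr l && inbox l)).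
    { apply count_le. intros l Hl Bl. rewrite Bl, Hord; [reflexivity | lia | assumption |].
      unfold inbox in Bl. lia. }
    pose proof (count_all (fun c => x <? reach c) (Z.to_nat N)) as A.
    destruct (H3 c Hc) as (l & Hl & Pl & Cl & Bl).
    + cbv beta in A. specialize (A ltac:(lia) c ltac:(lia)). lia.
    + now apply (Hkeep l).
Qed.
End Colouring.

(** * The greedy colouring as a program *)

Definition best_stm : stm :=
  SFor vj 0 (SWr 40 (Num 0)
    (tite (tand (Op Lt (scal vj) (scal 35)) (Op Lt (Read 37 (scal vj)) (Read 37 (scal 40))))
       (scal vj) (scal 40))).

(** Sorting by rounds: in round [r] only the boxes of rank [r] take effect, by increasing index.
    Loops run up to the number of sensors, since array 35 is not among the loop bounds; [best_stm]
    ignores indices beyond the number of colours by its guard. Empty boxes are coloured as well,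
    which does no harm. *)
Definition colour_stm : stm :=
  SFor 39 0 (SFor vi 0
    (SSq (SWr 40 (Num 0) (Num 0))
    (SSq best_stm
    (SSq (SWr 38 (scal vi)
           (tite (Op Eq (Read 36 (scal vi)) (scal 39)) (scal 40) (Read 38 (scal vi))))
         (SWr 37 (scal 40)
           (tite (tand (Op Eq (Read 36 (scal vi)) (scal 39))
                       (Op Lt (Read 37 (scal 40)) (Read 30 (scal vi))))
              (Read 30 (scal vi)) (Read 37 (scal 40)))))))).

Lemma run_best (m : mem) (n : nat) :
  m 0%nat 0 = Z.of_nat n -> m 40%nat 0 = 0 -> 1 <= m 35%nat 0 <= Z.of_nat n ->
  let m' := run best_stm m in
  0 <= m' 40%nat 0 < m 35%nat 0 /\
  (forall c, 0 <= c < m 35%nat 0 -> m 37%nat (m' 40%nat 0) <= m 37%nat c).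
Proof.
  intros Hn H0 HN. unfold best_stm. match goal with |- context [SFor _ _ ?b] => set (s := b) end.
  cbn [run].
  assert (H : (fun j m' => (forall z, m' 35%nat z = m 35%nat z) /\
      (forall z, m' 37%nat z = m 37%nat z) /\ m' vj 0 = j /\ 0 <= m' 40%nat 0 < m 35%nat 0 /\
      forall c, 0 <= c < m 35%nat 0 -> c < j -> m 37%nat (m' 40%nat 0) <= m 37%nat c)
     (0 + Z.of_nat (Z.to_nat (m 0%nat 0)))
     (loop (run s) vj (Z.to_nat (m 0%nat 0)) 0 (upd m vj 0 0))).
  { apply loop_ind.
    - refine (conj _ (conj _ (conj _ (conj _ _)))).
      + intros. now apply upd_array.
      + intros. now apply upd_array.
      + apply upd_same.
      + rewrite upd_array by discriminate. lia.
      + lia.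
    - intros j m' Hj (F1 & F2 & Ej & Hb & Hmin). unfold s. cbn [run].
      set (t := (j <? m 35%nat 0) && (m 37%nat j <? m 37%nat (m' 40%nat 0))).
      rewrite (ev_tite m' _ _ _ t).
      2:{ cbn [tand ev binop_sem]. rewrite Ej, F1, !F2. unfold t, b2z.
          destruct (_ <? _), (_ <? _); reflexivity. }
      cbn [ev]. rewrite Ej.
      refine (conj _ (conj _ (conj _ (conj _ _)))).
      + intros. now rewrite !upd_array by discriminate.
      + intros. now rewrite !upd_array by discriminate.
      + apply upd_same.
      + rewrite upd_array, upd_same by discriminate. unfold t. destruct (_ && _) eqn:E; lia.
      + intros c Hc Hcj. rewrite upd_array, upd_same by discriminate.
        destruct (Z.eq_dec c j) as [-> |].
        * destruct t eqn:E; unfold t in E; lia.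
        * specialize (Hmin c Hc). destruct t eqn:E; unfold t in E; lia. }
  cbv beta in H. destruct H as (_ & _ & _ & Hb & Hmin). split; [exact Hb |].
  intros c Hc. apply Hmin; [exact Hc | lia].
Qed.

Lemma run_colour (E : mem) (n : nat) (x : Z) :
  let ba := E 28%nat in let bb := E 30%nat in let N := E 35%nat 0 in
  E 0%nat 0 = Z.of_nat n ->
  1 <= N <= count n (fun i => (ba i <=? x) && (x <? bb i)) ->
  (forall i, rng n i -> E 36%nat i = count n (fun j => ba j <? ba i)) ->
  (forall c, 0 <= c < N -> E 37%nat c <= x) ->
  forall c, 0 <= c < N ->
    exists l, rng n l /\ run colour_stm E 38%nat l = c /\ ba l <= x < bb l.
Proof.
  intros ba bb N Hn HN Hrank Hreach.
  (* [Pr r i] is the set of boxes handled before turn [i] of round [r]. *)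
  set (Pr := fun r i l => (E 36%nat l <? r) || ((E 36%nat l =? r) && (l <? i))).
  assert (HNn : N <= Z.of_nat n) by (pose proof (count_le_n n (fun i => (ba i <=? x) && (x <? bb i))); lia).
  set (frame := fun m : mem => forall a z, In a [0; 30; 35; 36]%nat -> m a z = E a z).
  assert (H : (fun r m => frame m /\ m 39%nat 0 = r /\
      covered n ba bb N x (Pr r 0) (m 37%nat) (m 38%nat))
    (0 + Z.of_nat (Z.to_nat (E 0%nat 0))) (run colour_stm E)).
  { unfold colour_stm. cbn [run]. apply loop_ind.
    - split; [| split].
      + intros a z Ha. apply upd_array. intros ->. simpl in Ha. lia.
      + apply upd_same.
      + right.
        assert (HPr : forall l, rng n l -> Pr 0 0 l = false).
        { intros l Hl. pose proof (proj1 (count_le_n n (fun j => ba j <? ba l))).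
          rewrite <- Hrank in H by assumption. unfold Pr. lia. }
        split; [| split].
        * intros l Hl Pl. rewrite HPr in Pl by assumption. discriminate.
        * assert (count n (fun l => Pr 0 0 l && ((ba l <=? x) && (x <? bb l))) <= 0).
          { apply Z.le_trans with (zsum n (fun _ => 0)); [| rewrite zsum_const; lia].
            apply zsum_le. intros l Hl. rewrite HPr by assumption. simpl. lia. }
          pose proof (proj1 (count_le_n (Z.to_nat N)
            (fun c => x <? upd E 39 0 0 37%nat c))). lia.
        * intros c Hc Hxc. rewrite upd_array in Hxc by discriminate. specialize (Hreach c Hc). lia.
    - intros r m Hr (F & Er & Hcov). cbn [run].
      replace (m 0%nat 0) with (Z.of_nat n) by (rewrite F by (simpl; auto); now rewrite Hn).
      match goal with |- context [loop ?b vi _ _ _] => set (body := b) end.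
      assert (H : (fun i m' => frame m' /\ m' 39%nat 0 = r /\ m' vi 0 = i /\
          covered n ba bb N x (Pr r i) (m' 37%nat) (m' 38%nat))
        (0 + Z.of_nat (Z.to_nat (Z.of_nat n)))
        (loop body vi (Z.to_nat (Z.of_nat n)) 0 (upd m vi 0 0))).
      { apply loop_ind.
        - refine (conj _ (conj _ (conj _ _))).
          + intros a z Ha. rewrite upd_array; [now apply F |]. intros ->. simpl in Ha. lia.
          + now rewrite upd_array.
          + apply upd_same.
          + eapply covered_ext; [| | | exact Hcov]; intros; try reflexivity; symmetry; now apply upd_array.
        - clear m F Er Hcov. intros i m Hi (F & Er & Ei & Hcov).
          assert (Hin : rng n i) by lia.
          unfold body. clear body. cbn [ev].
          set (m1 := upd m 40 0 0).
          assert (F1 : forall a z, a <> 40%nat -> m1 a z = m a z) by (intros; now apply upd_array).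
          destruct (run_best m1 n) as [Hb Hmin].
          { rewrite F1, F by (simpl; auto; discriminate). exact Hn. }
          { apply upd_same. }
          { rewrite F1, F by (simpl; auto; discriminate). fold N. lia. }
          set (m2 := run best_stm m1) in *.
          assert (F2 : forall a z, a <> 40%nat -> a <> vj -> m2 a z = m a z).
          { intros a z Ha1 Ha2. unfold m2. rewrite run_frame; [now apply F1 |].
            cbn [writes best_stm]. apply Nat.eqb_neq in Ha1, Ha2. now rewrite Ha1, Ha2. }
          rewrite F1 in Hb, Hmin by discriminate.
          rewrite F in Hb, Hmin by (simpl; auto). fold N in Hb, Hmin.
          set (best := m2 40%nat 0) in *.
          set (t := E 36%nat i =? r).
          rewrite (ev_tite m2 _ _ _ t).
          2:{ cbn [ev binop_sem]. rewrite !F2 by discriminate. rewrite Ei, Er, F by (simpl; auto).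
              unfold t. destruct (_ =? _); reflexivity. }
          cbn [ev]. rewrite !F2 by discriminate. rewrite Ei. fold best.
          rewrite (F2 38%nat i) by discriminate.
          set (m3 := upd m2 38 i (if t then best else m 38%nat i)).
          assert (F3 : forall a z, a <> 40%nat -> a <> vj -> a <> 38%nat -> m3 a z = m a z).
          { intros a z Ha1 Ha2 Ha3. unfold m3. rewrite upd_array by assumption. now apply F2. }
          assert (Eb : m3 40%nat 0 = best) by (unfold m3; now rewrite upd_array).
          set (t' := t && (m 37%nat best <? bb i)).
          rewrite (ev_tite m3 _ _ _ t').
          2:{ cbn [tand ev binop_sem]. rewrite Eb, !F3 by discriminate.
              rewrite Ei, Er, (F 36%nat), (F 30%nat) by (simpl; auto). fold bb. unfold t', t.
              destruct (E 36%nat i =? r), (_ <? _); reflexivity. }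
          cbn [ev]. rewrite Eb, !F3 by discriminate. rewrite Ei, (F 30%nat) by (simpl; auto). fold bb.
          refine (conj _ (conj _ (conj _ _))).
          + intros a z Ha. rewrite !upd_array, F3; [now apply F | ..];
              intros ->; simpl in Ha; lia.
          + rewrite !upd_array by discriminate. now rewrite F3.
          + apply upd_same.
          + assert (R37 : forall c, upd (upd m3 37 best (if t' then bb i else m 37%nat best)) vi 0 (i + 1) 37%nat c
              = if c =? best then (if t' then bb i else m 37%nat best) else m 37%nat c).
            { intros c. rewrite upd_array by discriminate.
              destruct (Z.eqb_spec c best) as [-> |]; [apply upd_same |].
              rewrite upd_cell by assumption. now apply F3. }
            assert (R38 : forall l, upd (upd m3 37 best (if t' then bb i else m 37%nat best)) vi 0 (i + 1) 38%nat l
              = if l =? i then (if t then best else m 38%nat i) else m 38%nat l).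
            { intros l. rewrite !upd_array by discriminate. unfold m3.
              destruct (Z.eqb_spec l i) as [-> |]; [apply upd_same |].
              rewrite upd_cell by assumption. now apply F2. }
            destruct t eqn:Et; unfold t in Et.
            * apply (covered_step n ba bb N x (Pr r i) _ (m 37%nat) _ (m 38%nat) _ i best); try assumption.
              -- lia.
              -- unfold Pr. lia.
              -- intros j Hj. unfold Pr. destruct (Z.eq_dec j i) as [-> |]; lia.
              -- intros Hxi l Hl Hlx. unfold Pr.
                 assert (E 36%nat l < E 36%nat i); [| lia].
                 rewrite !Hrank by assumption. apply (count_lt n _ _ l); try assumption; lia.
              -- intros j Hj. rewrite R38. apply Z.eqb_neq in Hj. now rewrite Hj.
              -- rewrite R38. now rewrite Z.eqb_refl.
              -- intros c Hc. rewrite R37. apply Z.eqb_neq in Hc. now rewrite Hc.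
              -- rewrite R37, Z.eqb_refl. unfold t'. simpl. destruct (_ <? _) eqn:L; lia.
            * eapply covered_ext; [| | | exact Hcov].
              -- intros l Hl. unfold Pr. destruct (Z.eq_dec l i) as [-> |]; lia.
              -- intros c. rewrite R37. unfold t'. simpl. destruct (Z.eqb_spec c best) as [-> |]; reflexivity.
              -- intros l. rewrite R38. destruct (Z.eqb_spec l i) as [-> |]; reflexivity. }
      cbv beta in H. destruct H as (F' & Er' & _ & Hcov').
      set (m' := loop _ _ _ _ _) in *.
      split; [| split].
      + intros a z Ha. rewrite upd_array; [now apply F' |]. intros ->. simpl in Ha. lia.
      + apply upd_same.
      + eapply covered_ext; [| | | exact Hcov']; intros; try (symmetry; now apply upd_array).
        unfold Pr. lia. }
  cbv beta in H. destruct H as (_ & _ & H). set (m := run colour_stm E) in *.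
  (* Ranks are below [n], so after [n] rounds every box has been handled. *)
  assert (HPr : forall l, rng n l -> Pr (0 + Z.of_nat (Z.to_nat (E 0%nat 0))) 0 l = true).
  { intros l Hl. unfold Pr.
    assert (E 36%nat l < Z.of_nat n); [| lia]. rewrite Hrank by assumption.
    eapply Z.lt_le_trans; [apply (count_lt n _ (fun _ => true) l) | apply count_le_n]; auto; lia. }
  destruct H as [G | (H1 & H2 & H3)]; intros c Hc.
  - destruct (G c Hc) as (l & Hl & _ & Cl & Bl). exists l. repeat split; try lia; assumption.
  - assert (A : Z.of_nat (Z.to_nat N) <= count (Z.to_nat N) (fun c => x <? m 37%nat c)).
    { eapply Z.le_trans; [| exact H2]. apply Z.min_glb; [lia |].
      eapply Z.le_trans; [| apply (count_le n (fun i => (ba i <=? x) && (x <? bb i)))]; [lia |].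
      intros l Hl Bl. now rewrite HPr, Bl. }
    pose proof (count_all _ _ A c ltac:(lia)) as Hx. cbv beta in Hx.
    destruct (H3 c Hc ltac:(lia)) as (l & Hl & _ & Cl & Bl). exists l. repeat split; try lia; assumption.
Qed.

(** * The program *)

Inductive bexp :=
| BLt (e1 e2 : texp)
| BEq (e1 e2 : texp)
| BAnd (b1 b2 : bexp)
| BOr (b1 b2 : bexp)
| BNot (b : bexp).

(** Every condition becomes a test in the sense of [is_test]; this is why a disjunction is written
    as positivity of a sum. *)
Fixpoint bcomp (b : bexp) : texp :=
  match b with
  | BLt e1 e2 => TOp Lt e1 e2
  | BEq e1 e2 => TOp Eq e1 e2
  | BAnd b1 b2 => TOp Mul (bcomp b1) (bcomp b2)
  | BOr b1 b2 => TOp Lt (TNum 0) (TOp Add (bcomp b1) (bcomp b2))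
  | BNot b => TOp Eq (bcomp b) (TNum 0)
  end.

Fixpoint bev (E : mem) (i j acc : Z) (b : bexp) : bool :=
  match b with
  | BLt e1 e2 => tev E i j acc e1 <? tev E i j acc e2
  | BEq e1 e2 => tev E i j acc e1 =? tev E i j acc e2
  | BAnd b1 b2 => bev E i j acc b1 && bev E i j acc b2
  | BOr b1 b2 => bev E i j acc b1 || bev E i j acc b2
  | BNot b => negb (bev E i j acc b)
  end.

Lemma tev_bcomp (E : mem) (i j acc : Z) (b : bexp) :
  tev E i j acc (bcomp b) = b2z (bev E i j acc b).
Proof.
  induction b as [| | b1 IH1 b2 IH2 | b1 IH1 b2 IH2 | b IH];
    cbn [bcomp tev binop_sem bev]; try reflexivity; rewrite ?IH1, ?IH2, ?IH;
    repeat destruct (bev _ _ _ _ _); reflexivity.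
Qed.

Definition TIte (b : bexp) (x y : texp) : texp :=
  TOp Add (TOp Mul (bcomp b) x) (TOp Mul (bcomp (BNot b)) y).

Lemma tev_ite (E : mem) (i j acc : Z) (b : bexp) (x y : texp) :
  tev E i j acc (TIte b x y) = if bev E i j acc b then tev E i j acc x else tev E i j acc y.
Proof.
  unfold TIte. cbn [tev binop_sem]. rewrite !tev_bcomp. cbn [bev].
  destruct (bev E i j acc b); unfold b2z; cbn [negb]; ring.
Qed.

Lemma zfold_sum (k : nat) (f : Z -> Z) : zfold k (fun j acc => acc + f j) 0 = zsum k f.
Proof. induction k as [| k IH]; cbn [zfold zsum]; [reflexivity | now rewrite IH]. Qed.

Lemma zfold_id (k : nat) (z : Z) : zfold k (fun _ acc => acc) z = z.
Proof. induction k as [| k IH]; cbn [zfold]; congruence. Qed.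

Lemma zfold_addc (k : nat) (c z : Z) : zfold k (fun _ acc => acc + c) z = z + Z.of_nat k * c.
Proof. induction k as [| k IH]; cbn [zfold]; [lia | rewrite IH; lia]. Qed.

Lemma zfold_max (k : nat) (P : Z -> bool) (f : Z -> Z) (z : Z) :
  let v := zfold k (fun j acc => if P j && (acc <? f j) then f j else acc) z in
  z <= v /\ (forall j, rng k j -> P j = true -> f j <= v) /\
  (v = z \/ exists j, rng k j /\ P j = true /\ v = f j).
Proof.
  induction k as [| k IH]; cbn [zfold]; cbv zeta in *.
  - split; [lia |]. split; [lia | now left].
  - destruct IH as (H1 & H2 & H3). set (v := zfold k _ z) in *.
    destruct (P (Z.of_nat k) && (v <? f (Z.of_nat k))) eqn:E.
    + apply andb_prop in E as [E1 E2]. split; [lia |]. split.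
      * intros j Hj Pj. destruct (Z.eq_dec j (Z.of_nat k)) as [-> |]; [lia |].
        specialize (H2 j ltac:(lia) Pj). lia.
      * right. exists (Z.of_nat k). split; [lia | auto].
    + split; [lia |]. split.
      * intros j Hj Pj. destruct (Z.eq_dec j (Z.of_nat k)) as [-> |].
        -- rewrite Pj in E. simpl in E. lia.
        -- apply H2; [lia | assumption].
      * destruct H3 as [H3 | (j & Hj & Pj & Ej)]; [now left | right].
        exists j. split; [lia | auto].
Qed.

Lemma zfold_min (k : nat) (P : Z -> bool) (f : Z -> Z) (z : Z) :
  let v := zfold k (fun j acc => if P j && (f j <? acc) then f j else acc) z in
  v <= z /\ (forall j, rng k j -> P j = true -> v <= f j) /\
  (v = z \/ exists j, rng k j /\ P j = true /\ v = f j).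
Proof.
  induction k as [| k IH]; cbn [zfold]; cbv zeta in *.
  - split; [lia |]. split; [lia | now left].
  - destruct IH as (H1 & H2 & H3). set (v := zfold k _ z) in *.
    destruct (P (Z.of_nat k) && (f (Z.of_nat k) <? v)) eqn:E.
    + apply andb_prop in E as [E1 E2]. split; [lia |]. split.
      * intros j Hj Pj. destruct (Z.eq_dec j (Z.of_nat k)) as [-> |]; [lia |].
        specialize (H2 j ltac:(lia) Pj). lia.
      * right. exists (Z.of_nat k). split; [lia | auto].
    + split; [lia |]. split.
      * intros j Hj Pj. destruct (Z.eq_dec j (Z.of_nat k)) as [-> |].
        -- rewrite Pj in E. simpl in E. lia.
        -- apply H2; [lia | assumption].
      * destruct H3 as [H3 | (j & Hj & Pj & Ej)]; [now left | right].
        exists j. split; [lia | auto].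
Qed.

(** The result is independent of the initial value, so all members of a class elect the same
    leader. *)
Lemma zfold_last (k : nat) (P : Z -> bool) (z z' : Z) :
  (exists j, rng k j /\ P j = true) ->
  let v := zfold k (fun j acc => if P j then j else acc) z in
  rng k v /\ P v = true /\ v = zfold k (fun j acc => if P j then j else acc) z'.
Proof.
  induction k as [| k IH]; cbn [zfold]; cbv zeta in *; intros (j & Hj & Pj); [lia |].
  destruct (P (Z.of_nat k)) eqn:E; [split; [lia | auto] |].
  destruct IH as (H1 & H2 & H3); [| split; [lia | auto]].
  exists j. split; [| assumption].
  destruct (Z.eq_dec j (Z.of_nat k)) as [-> |]; [congruence | lia].
Qed.

(** A product by repeated addition: the rounds below [c] each add [D]. *)
Lemma zfold_upto (k : nat) (c D z : Z) :
  0 <= c -> zfold k (fun j acc => if j <? c then acc + D else acc) z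
    = z + Z.min c (Z.of_nat k) * D.
Proof.
  intros Hc. induction k as [| k IH]; cbn [zfold].
  - rewrite Z.min_r by lia. lia.
  - rewrite IH. destruct (Z.ltb_spec (Z.of_nat k) c).
    + rewrite !Z.min_r by lia. lia.
    + rewrite !Z.min_l by lia. lia.
Qed.

(** The largest power [2 ^ e] of which some multiple lies in [(a, b]]. *)
Lemma zfold_pow (k : nat) (a b : Z) :
  0 <= a < b -> b <= Z.of_nat k ->
  let w := zfold k (fun _ acc =>
    if a / (acc + acc) <? b / (acc + acc) then acc + acc else acc) 1 in
  exists e, w = 2 ^ e /\ 0 <= e <= Z.log2 (Z.of_nat k) /\
    a / w < b / w /\ b / (w + w) <= a / (w + w).
Proof.
  intros Hab Hb.
  (* An exponent smaller than the number of rounds shows that doubling has stopped. With [k] rounds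
     this must happen, because [2 ^ e <= b <= k] forces [e < k]. *)
  assert (H : forall k, let w := zfold k (fun _ acc =>
      if a / (acc + acc) <? b / (acc + acc) then acc + acc else acc) 1 in
    exists e, w = 2 ^ e /\ 0 <= e <= Z.of_nat k /\ a / w < b / w /\
      (e < Z.of_nat k -> b / (w + w) <= a / (w + w))).
  { clear k Hb. induction k as [| k IH]; cbn [zfold]; cbv zeta in *.
    - exists 0. rewrite !Z.div_1_r. repeat split; lia.
    - destruct IH as (e & Ew & He & H1 & H2). set (w := zfold k _ 1) in *.
      destruct (Z.ltb_spec (a / (w + w)) (b / (w + w))) as [L | L].
      + exists (Z.succ e). rewrite Z.pow_succ_r by lia. repeat split; try lia; assumption.
      + exists e. repeat split; try lia; assumption. }
  cbv zeta. specialize (H k). cbv zeta in H. destruct H as (e & Ew & He & H1 & H2).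
  set (w := zfold k _ 1) in *.
  assert (Hw : 0 < w) by (rewrite Ew; apply Z.pow_pos_nonneg; lia).
  assert (Ha : 0 <= a / w) by (apply Z.div_pos; lia).
  assert (Hwb : w <= b).
  { destruct (Z_le_gt_dec w b) as [| G]; [assumption |].
    rewrite (Z.div_small b w) in H1 by lia. lia. }
  assert (He' : e <= Z.log2 (Z.of_nat k)).
  { apply Z.log2_le_pow2; [lia |]. rewrite <- Ew. lia. }
  exists e. repeat split; try lia; try assumption. apply H2.
  pose proof (Z.log2_lt_lin (Z.of_nat k)). lia.
Qed.

Local Notation rI a := (TRd a TI).
Local Notation rJ a := (TRd a TJ).

Definition sum_tab (X : nat) (b : bexp) (x : texp) : tab :=
  Tab X 0 (TNum 0) (TOp Add TAcc (TOp Mul (bcomp b) x)).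
Definition map_tab (X : nat) (e : texp) : tab := Tab X 0 e TAcc.

Lemma sum_tab_val (E : mem) (n : nat) (X : nat) (b : bexp) (x : texp) (i : Z) :
  E 0%nat 0 = Z.of_nat n ->
  (forall j acc, bev E i j acc b = bev E i j 0 b) ->
  (forall j acc, tev E i j acc x = tev E i j 0 x) ->
  tab_val E (sum_tab X b x) i = wsum n (fun j => bev E i j 0 b) (fun j => tev E i j 0 x).
Proof.
  intros Hn Hb Hx. unfold tab_val, sum_tab. cbn [bnd ini stp tev binop_sem].
  rewrite Hn, Nat2Z.id. unfold wsum. rewrite <- zfold_sum. apply zfold_ext.
  intros j acc _. rewrite tev_bcomp, Hb, Hx. destruct (bev E i j 0 b); unfold b2z; lia.
Qed.

Lemma map_tab_val (E : mem) (X : nat) (e : texp) (i : Z) :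
  tab_val E (map_tab X e) i = tev E i 0 0 e.
Proof. unfold tab_val, map_tab. cbn [bnd ini stp tev]. apply zfold_id. Qed.

Definition bef_exp (a : nat) : bexp :=
  BOr (BLt (rJ a) (rI a)) (BAnd (BEq (rJ a) (rI a)) (BLt TJ TI)).
Definition bef_neg (a : nat) : bexp :=
  BOr (BLt (rI a) (rJ a)) (BAnd (BEq (rJ a) (rI a)) (BLt TJ TI)).
(** The test for [dmax > (1 + 1/k) * dmin], with [k * (dmax - dmin)] taken from array 10. *)
Definition caseB : bexp := BLt (rI 9) (rI 10).
Definition nodeb : bexp := BAnd (BEq (rJ 16) (rI 16)) (BEq (rJ 17) (rI 17)).
Definition sameb : bexp :=
  BAnd (BAnd nodeb (BEq (rJ 20) (rI 20))) (BEq (rJ 21) (rI 21)).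
Definition grpb : bexp := BAnd sameb (BEq (rJ 24) (rI 24)).
Definition coverb (x : texp) (a b : nat) : bexp := BAnd (BNot (BLt x (rJ a))) (BLt x (rJ b)).

(** The parameter is [k = 3 * (q / p + 2)], written as a sum because multiplying by a literal is not
    [slow]. The rounding down of [1 / eps] costs less than 1, so [k] exceeds [3 / eps + 3]. *)
Definition k_tab : tab :=
  let e := TOp Add (TOp Div (TRd 0 (TNum 2)) (TRd 0 (TNum 1))) (TNum 2) in
  map_tab 7 (TOp Add e (TOp Add e e)).

(** A scalar is stored in all [n] cells of its array, so that later tables can read it at their own
    index. *)
Definition first_tab : tab := Tab 8 0 (rI 3) (TIte (BLt TAcc (rJ 3)) (rJ 3) TAcc).

(** Arrays: 7 the parameter k, 8 and 9 the extreme durations, 10 k times their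
    difference, 11 the weight D' of a piece, 12 the duration D of a box, 13 the
    weight of a layer, 14 and 15 the ranks of the end points, 16 and 17 the node,
    18 and 19 the offsets in the node, 20 the side, 21 the layer, 22 the inner
    key, 23 the offset in the layer, 24 the piece, 25 the leader of the piece, 26
    the offset in the piece, 27 the weight of the piece, 28 to 30 its box, 31 to
    35 the least number of boxes at a point, 36 the rank of the box, 37 the reach
    of a colour, 38 the colour of a box. *)
Definition main_tabs : list tab :=
  [ Tab 9 0 (rI 3) (TIte (BLt (rJ 3) TAcc) (rJ 3) TAcc);
    Tab 10 7 (TNum 0) (TOp Add TAcc (TOp Sub (rI 8) (rI 9)));
    Tab 11 7 (rI 8) (TOp Add TAcc (rI 8));
    map_tab 12 (TIte caseB (TOp Sub (rI 11) (rI 8)) (rI 9));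
    Tab 13 7 (TNum 0) (TOp Add TAcc (rI 11));
    sum_tab 14 (BLt (rJ 1) (rI 1)) (TNum 1);
    sum_tab 15 (BLt (rJ 1) (rI 2)) (TNum 1);
    Tab 16 0 (TIte caseB (TNum 1) TI)
      (TIte (BAnd caseB (BLt (TOp Div (rI 14) (TOp Add TAcc TAcc))
                             (TOp Div (rI 15) (TOp Add TAcc TAcc))))
         (TOp Add TAcc TAcc) TAcc);
    map_tab 17 (TOp Div (rI 15) (rI 16));
    sum_tab 18 (BAnd nodeb (bef_exp 1)) (rJ 3);
    sum_tab 19 (BAnd nodeb (bef_neg 2)) (rJ 3);
    map_tab 20 (TOp Lt (rI 19) (rI 18));
    map_tab 21 (TOp Div (TIte (BEq (rI 20) (TNum 1)) (rI 19) (rI 18)) (rI 13));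
    map_tab 22 (TIte (BEq (rI 20) (TNum 1)) (rI 1) (TOp Sub (TNum 0) (rI 2)));
    sum_tab 23 (BAnd sameb (bef_exp 22)) (rJ 3);
    map_tab 24 (TOp Div (rI 23) (rI 11));
    Tab 25 0 TI (TIte grpb TJ TAcc);
    sum_tab 26 (BAnd grpb (bef_exp 22)) (rJ 3);
    sum_tab 27 grpb (rJ 3);
    Tab 28 0 (rI 1) (TIte (BAnd grpb (BLt TAcc (rJ 1))) (rJ 1) TAcc);
    Tab 29 0 (rI 2) (TIte (BAnd grpb (BLt (rJ 2) TAcc)) (rJ 2) TAcc);
    map_tab 30 (TIte (BAnd (BEq (rI 25) TI) (BNot (BLt (rI 27) (rI 12)))) (rI 29) (rI 28));
    sum_tab 31 (coverb (rI 1) 28 30) (TNum 1);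
    sum_tab 32 (coverb (rI 2) 1 2) (TNum 1);
    sum_tab 33 (coverb (rI 2) 28 30) (TNum 1);
    Tab 34 0 (rI 31) (TIte (BLt (rJ 31) TAcc) (rJ 31) TAcc);
    Tab 35 0 (rI 34) (TIte (BAnd (BLt (TNum 0) (rJ 32)) (BLt (rJ 33) TAcc)) (rJ 33) TAcc);
    sum_tab 36 (BLt (rJ 28) (rI 28)) (TNum 1);
    Tab 37 0 (rI 1) (TIte (BLt (rJ 1) TAcc) (rJ 1) TAcc) ].

(** The start time is the colour times [D] plus the offset within the piece. Sensors of pieces that
    form no box get a start time as well: additional activity does no harm. *)
Definition start_tab : tab :=
  Tab 4 0 (rI 26) (TIte (BLt TJ (TRd 38 (rI 25))) (TOp Add TAcc (rI 12)) TAcc).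

Lemma wf_k : wf_tabs [0; 1; 2; 3]%nat [k_tab] = true.
Proof. reflexivity. Qed.

Lemma wf_main : wf_tabs [7; 0; 1; 2; 3]%nat (first_tab :: main_tabs) = true.
Proof. vm_compute. reflexivity. Qed.

Definition rest_stm : stm :=
  SSq (tabs_stm first_tab main_tabs) (SSq colour_stm (tab_stm start_tab)).

Lemma ok_k : ok 200 [0]%nat (tab_stm k_tab) = true.
Proof. vm_compute. reflexivity. Qed.

(** Array 7 now bounds loops and must stay fixed; hence [k_tab], which writes it, is checked apart,
    with array 0 as the only bound. *)
Lemma ok_rest : ok 200 [0; 7]%nat rest_stm = true.
Proof. vm_compute. reflexivity. Qed.

(** * Equations of the filled arrays *)

Section Memory.
Context (E : mem) (n : nat).
Hypothesis n_pos : (0 < n)%nat.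
Hypothesis n_def : E 0%nat 0 = Z.of_nat n.
Hypothesis lo_lt_hi : forall i, rng n i -> E 1%nat i < E 2%nat i.
Hypothesis dur_pos : forall i, rng n i -> 1 <= E 3%nat i.
Hypothesis k_pos : 1 <= E 7%nat 0.
Hypothesis tabs_eq : Forall (fun T => forall i, 0 <= i < E 0%nat 0 -> E (tgt T) i = tab_val E T i)
  (first_tab :: main_tabs).

Let k := E 7%nat 0.
Let dm := E 8%nat 0.
Let dn := E 9%nat 0.
Let grpE := grp (E 16%nat) (E 17%nat) (E 20%nat) (E 21%nat) (E 24%nat).
Let sameE := same (E 16%nat) (E 17%nat) (E 20%nat) (E 21%nat).
Let nodeE := node (E 16%nat) (E 17%nat).
Let cov (x i : Z) : bool := (E 1%nat i <=? x) && (x <? E 2%nat i).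
Let inbox (x i : Z) : bool := (E 28%nat i <=? x) && (x <? E 30%nat i).
Let isB : bool := dn <? k * (dm - dn).

Lemma tab_eq (a : nat) :
  match nth_error (first_tab :: main_tabs) a with
  | Some T => forall i, rng n i -> E (tgt T) i = tab_val E T i
  | None => True
  end.
Proof.
  destruct (nth_error _ a) as [T |] eqn:H; [| exact I].
  apply nth_error_In in H. rewrite Forall_forall in tabs_eq.
  specialize (tabs_eq T H). rewrite n_def in tabs_eq. exact tabs_eq.
Qed.

Lemma E_dmax (i : Z) : rng n i ->
  (forall j, rng n j -> E 3%nat j <= E 8%nat i) /\ exists j, rng n j /\ E 8%nat i = E 3%nat j.
Proof.
  intros Hi. pose proof (tab_eq 0 i Hi) as Q. unfold tab_val in Q.
  cbn [nth_error tgt bnd ini stp first_tab] in Q. rewrite n_def, Nat2Z.id in Q.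
  rewrite (zfold_ext _ _ (fun j acc => if true && (acc <? E 3%nat j) then E 3%nat j else acc)) in Q
    by (intros; now rewrite tev_ite).
  destruct (zfold_max n (fun _ => true) (E 3%nat) (E 3%nat i)) as (H1 & H2 & H3).
  cbn [tev] in Q. rewrite <- Q in *. split; [auto |].
  destruct H3 as [-> | (j & Hj & _ & ->)]; [exists i | exists j]; auto.
Qed.

Lemma E_dmin (i : Z) : rng n i ->
  (forall j, rng n j -> E 9%nat i <= E 3%nat j) /\ exists j, rng n j /\ E 9%nat i = E 3%nat j.
Proof.
  intros Hi. pose proof (tab_eq 1 i Hi) as Q. unfold tab_val in Q.
  cbn [nth_error tgt bnd ini stp main_tabs] in Q. rewrite n_def, Nat2Z.id in Q.
  rewrite (zfold_ext _ _ (fun j acc => if true && (E 3%nat j <? acc) then E 3%nat j else acc)) in Q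
    by (intros; now rewrite tev_ite).
  destruct (zfold_min n (fun _ => true) (E 3%nat) (E 3%nat i)) as (H1 & H2 & H3).
  cbn [tev] in Q. rewrite <- Q in *. split; [auto |].
  destruct H3 as [-> | (j & Hj & _ & ->)]; [exists i | exists j]; auto.
Qed.

Lemma rng0 : rng n 0.
Proof. lia. Qed.

Lemma E_dmax0 (i : Z) : rng n i -> E 8%nat i = dm.
Proof.
  intros Hi. destruct (E_dmax i Hi) as (H1 & j & Hj & E1).
  destruct (E_dmax 0 rng0) as (H2 & j' & Hj' & E2).
  specialize (H1 j' Hj'). specialize (H2 j Hj). unfold dm. lia.
Qed.

Lemma E_dmin0 (i : Z) : rng n i -> E 9%nat i = dn.
Proof.
  intros Hi. destruct (E_dmin i Hi) as (H1 & j & Hj & E1).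
  destruct (E_dmin 0 rng0) as (H2 & j' & Hj' & E2).
  specialize (H1 j' Hj'). specialize (H2 j Hj). unfold dn. lia.
Qed.

Lemma dur_bounds (i : Z) : rng n i -> 1 <= E 3%nat i <= dm.
Proof. intros Hi. split; [now apply dur_pos | now apply (E_dmax 0 rng0)]. Qed.

Lemma dn_bounds (i : Z) : rng n i -> 1 <= dn <= E 3%nat i.
Proof.
  intros Hi. destruct (E_dmin 0 rng0) as (H1 & j & Hj & Ej). split; [| now apply H1].
  unfold dn. rewrite Ej. now apply dur_pos.
Qed.

Lemma dn_le_dm : 1 <= dn <= dm.
Proof. pose proof (dn_bounds 0 rng0). pose proof (dur_bounds 0 rng0). lia. Qed.

(** The table at position [a] of the list fills array [a + 8]. *)
Ltac by_tab a Hi :=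
  let Q := fresh "Q" in
  pose proof (tab_eq a _ Hi) as Q;
  cbn [nth_error first_tab main_tabs] in Q;
  first [ rewrite (sum_tab_val E n) in Q by (assumption || reflexivity)
        | rewrite map_tab_val in Q
        | unfold tab_val in Q ];
  cbn [tgt bnd ini stp sum_tab map_tab] in Q.

Lemma E_S (i : Z) : rng n i -> E 10%nat i = k * (dm - dn).
Proof.
  intros Hi. by_tab 2%nat Hi. cbn [tev binop_sem] in Q. rewrite Q, zfold_addc.
  rewrite E_dmax0, E_dmin0, Z2Nat.id by (assumption || (unfold k in *; lia)). unfold k. lia.
Qed.

Lemma E_Dp (i : Z) : rng n i -> E 11%nat i = (k + 1) * dm.
Proof.
  intros Hi. by_tab 3%nat Hi. cbn [tev binop_sem] in Q. rewrite Q, zfold_addc.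
  rewrite E_dmax0, Z2Nat.id by (assumption || (unfold k in *; lia)). fold k. lia.
Qed.

Lemma bev_caseB (i j acc : Z) : rng n i -> bev E i j acc caseB = isB.
Proof. intros Hi. cbn [bev caseB tev]. now rewrite E_S, E_dmin0. Qed.

Lemma E_D (i : Z) : rng n i -> E 12%nat i = if isB then k * dm else dn.
Proof.
  intros Hi. by_tab 4%nat Hi. rewrite Q, tev_ite, bev_caseB by assumption.
  cbn [tev binop_sem]. rewrite E_Dp, E_dmax0, E_dmin0 by assumption.
  destruct isB; lia.
Qed.

Let D := if isB then k * dm else dn.

Lemma E_M (i : Z) : rng n i -> E 13%nat i = k * ((k + 1) * dm).
Proof.
  intros Hi. by_tab 5%nat Hi. cbn [tev binop_sem] in Q. rewrite Q, zfold_addc.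
  rewrite E_Dp, Z2Nat.id by (assumption || (unfold k in *; lia)). fold k. lia.
Qed.

Lemma E_rl (i : Z) : rng n i -> E 14%nat i = count n (fun j => E 1%nat j <? E 1%nat i).
Proof. intros Hi. by_tab 6%nat Hi. exact Q. Qed.

Lemma E_rr (i : Z) : rng n i -> E 15%nat i = count n (fun j => E 1%nat j <? E 2%nat i).
Proof. intros Hi. by_tab 7%nat Hi. exact Q. Qed.

Lemma E_w (i : Z) : rng n i -> E 16%nat i =
  zfold n (fun _ acc =>
    if isB && (E 14%nat i / (acc + acc) <? E 15%nat i / (acc + acc)) then acc + acc else acc)
    (if isB then 1 else i).
Proof.
  intros Hi. by_tab 8%nat Hi. rewrite n_def, Nat2Z.id, tev_ite, bev_caseB in Q by assumption.
  rewrite Q. apply zfold_ext. intros j acc _. rewrite tev_ite. cbn [bev].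
  rewrite bev_caseB by assumption. reflexivity.
Qed.

Lemma E_w_B (i : Z) : rng n i -> isB = true ->
  exists e, E 16%nat i = 2 ^ e /\ 0 <= e <= Z.log2 (Z.of_nat n) /\
    E 14%nat i / E 16%nat i < E 15%nat i / E 16%nat i /\
    E 15%nat i / (E 16%nat i + E 16%nat i) <= E 14%nat i / (E 16%nat i + E 16%nat i).
Proof.
  intros Hi HB. rewrite E_w by assumption. rewrite HB. cbn [andb].
  apply zfold_pow.
  - rewrite E_rl, E_rr by assumption. specialize (lo_lt_hi i Hi). split; [apply count_le_n |].
    apply (count_lt _ _ _ i); [intros; lia | assumption | lia | lia].
  - rewrite E_rr by assumption. apply count_le_n.
Qed.

(** The values are pairwise distinct, so every node, and with it every piece, is a single sensor. *)
Lemma E_w_A (i : Z) : rng n i -> isB = false -> E 16%nat i = i.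
Proof. intros Hi HB. rewrite E_w by assumption. rewrite HB. cbn [andb]. apply zfold_id. Qed.

Lemma E_h (i : Z) : rng n i -> E 17%nat i = E 15%nat i / E 16%nat i.
Proof. intros Hi. by_tab 9%nat Hi. exact Q. Qed.

Lemma E_al (i : Z) : rng n i ->
  E 18%nat i = wsum n (fun j => nodeE i j && bef (E 1%nat) j i) (E 3%nat).
Proof. intros Hi. by_tab 10%nat Hi. exact Q. Qed.

Lemma E_be (i : Z) : rng n i ->
  E 19%nat i = wsum n (fun j => nodeE i j && bef (fun j => - E 2%nat j) j i) (E 3%nat).
Proof.
  intros Hi. by_tab 11%nat Hi. rewrite Q. apply wsum_ext. intros j _.
  unfold bef. cbn [bev nodeb bef_neg tev]. unfold nodeE, node. f_equal. lia.
Qed.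

Lemma E_side (i : Z) : rng n i -> E 20%nat i = if E 19%nat i <? E 18%nat i then 1 else 0.
Proof. intros Hi. by_tab 12%nat Hi. exact Q. Qed.

Lemma E_lay (i : Z) : rng n i ->
  E 21%nat i = (if E 20%nat i =? 1 then E 19%nat i else E 18%nat i) / (k * ((k + 1) * dm)).
Proof.
  intros Hi. by_tab 13%nat Hi. rewrite Q. cbn [tev binop_sem]. rewrite tev_ite, E_M by assumption.
  reflexivity.
Qed.

Lemma E_kap (i : Z) : rng n i -> E 22%nat i = if E 20%nat i =? 1 then E 1%nat i else - E 2%nat i.
Proof. intros Hi. by_tab 14%nat Hi. rewrite Q, tev_ite. reflexivity. Qed.

Lemma E_ga (i : Z) : rng n i ->
  E 23%nat i = wsum n (fun j => sameE i j && bef (E 22%nat) j i) (E 3%nat).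
Proof. intros Hi. by_tab 15%nat Hi. exact Q. Qed.

Lemma E_g (i : Z) : rng n i -> E 24%nat i = E 23%nat i / ((k + 1) * dm).
Proof. intros Hi. by_tab 16%nat Hi. cbn [tev binop_sem] in Q. now rewrite E_Dp in Q. Qed.

Lemma grp_refl (i : Z) : grpE i i = true.
Proof. unfold grpE, grp, same, node. now rewrite !Z.eqb_refl. Qed.

Lemma grp_same (i j l : Z) : grpE i j = true -> grpE i l = grpE j l.
Proof. unfold grpE, grp, same, node. intros H. lia. Qed.

Lemma E_lead (i : Z) : rng n i ->
  E 25%nat i = zfold n (fun j acc => if grpE i j then j else acc) i.
Proof.
  intros Hi. by_tab 17%nat Hi. rewrite n_def, Nat2Z.id in Q. rewrite Q.
  apply zfold_ext. intros j acc _. rewrite tev_ite. reflexivity.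
Qed.

Lemma lead_in (i : Z) : rng n i -> rng n (E 25%nat i) /\ grpE i (E 25%nat i) = true.
Proof.
  intros Hi. rewrite E_lead by assumption.
  destruct (zfold_last n (grpE i) i i) as (H1 & H2 & _); [| auto].
  exists i. split; [assumption | apply grp_refl].
Qed.

Lemma lead_eq (i j : Z) : rng n i -> rng n j -> grpE i j = true -> E 25%nat j = E 25%nat i.
Proof.
  intros Hi Hj G. rewrite !E_lead by assumption.
  destruct (zfold_last n (grpE i) i j) as (_ & _ & H).
  { exists i. split; [assumption | apply grp_refl]. }
  rewrite H. apply zfold_ext. intros l acc _. now rewrite (grp_same i j l G).
Qed.

Lemma E_off (i : Z) : rng n i ->
  E 26%nat i = wsum n (fun j => grpE i j && bef (E 22%nat) j i) (E 3%nat).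
Proof. intros Hi. by_tab 18%nat Hi. exact Q. Qed.

Lemma E_gw (i : Z) : rng n i -> E 27%nat i = wsum n (grpE i) (E 3%nat).
Proof. intros Hi. by_tab 19%nat Hi. exact Q. Qed.

Lemma E_ba (i : Z) : rng n i ->
  (forall j, rng n j -> grpE i j = true -> E 1%nat j <= E 28%nat i) /\
  exists j, rng n j /\ grpE i j = true /\ E 28%nat i = E 1%nat j.
Proof.
  intros Hi. by_tab 20%nat Hi. rewrite n_def, Nat2Z.id in Q.
  rewrite (zfold_ext _ _ (fun j acc => if grpE i j && (acc <? E 1%nat j) then E 1%nat j else acc)) in Q
    by (intros; now rewrite tev_ite).
  destruct (zfold_max n (grpE i) (E 1%nat) (E 1%nat i)) as (H1 & H2 & H3).
  cbn [tev] in Q. rewrite <- Q in *. split; [auto |].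
  destruct H3 as [-> | (j & Hj & Gj & ->)]; [exists i | exists j]; auto using grp_refl.
Qed.

Lemma E_bb0 (i : Z) : rng n i ->
  (forall j, rng n j -> grpE i j = true -> E 29%nat i <= E 2%nat j) /\
  exists j, rng n j /\ grpE i j = true /\ E 29%nat i = E 2%nat j.
Proof.
  intros Hi. by_tab 21%nat Hi. rewrite n_def, Nat2Z.id in Q.
  rewrite (zfold_ext _ _ (fun j acc => if grpE i j && (E 2%nat j <? acc) then E 2%nat j else acc)) in Q
    by (intros; now rewrite tev_ite).
  destruct (zfold_min n (grpE i) (E 2%nat) (E 2%nat i)) as (H1 & H2 & H3).
  cbn [tev] in Q. rewrite <- Q in *. split; [auto |].
  destruct H3 as [-> | (j & Hj & Gj & ->)]; [exists i | exists j]; auto using grp_refl.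
Qed.

(** A sensor that is not a leader, or whose piece is lighter than [D], receives the empty box from
    [E 28 i] to itself. *)
Lemma E_bb (i : Z) : rng n i ->
  E 30%nat i = if (E 25%nat i =? i) && negb (E 27%nat i <? D) then E 29%nat i else E 28%nat i.
Proof.
  intros Hi. by_tab 22%nat Hi. rewrite Q, tev_ite. cbn [bev tev]. now rewrite E_D.
Qed.

Lemma box_in (l x : Z) : rng n l -> E 25%nat l = l -> D <= E 27%nat l ->
  (forall j, rng n j -> grpE l j = true -> E 1%nat j <= x < E 2%nat j) ->
  E 28%nat l <= x < E 30%nat l.
Proof.
  intros Hl Ll Hw H. rewrite E_bb by assumption.
  replace ((E 25%nat l =? l) && negb (E 27%nat l <? D)) with true by lia.
  destruct (E_ba l Hl) as (_ & j & Hj & Gj & ->).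
  destruct (E_bb0 l Hl) as (_ & j' & Hj' & Gj' & ->).
  specialize (H j Hj Gj) as H1. specialize (H j' Hj' Gj') as H2. lia.
Qed.

Lemma box_out (l x : Z) : rng n l -> inbox x l = true ->
  E 25%nat l = l /\ D <= E 27%nat l /\
  forall j, rng n j -> grpE l j = true -> cov x j = true.
Proof.
  intros Hl Hx. unfold inbox in Hx. rewrite E_bb in Hx by assumption.
  destruct ((E 25%nat l =? l) && negb (E 27%nat l <? D)) eqn:F; [| lia].
  split; [lia |]. split; [lia |]. intros j Hj Gj.
  pose proof (proj1 (E_ba l Hl) j Hj Gj). pose proof (proj1 (E_bb0 l Hl) j Hj Gj).
  unfold cov. lia.
Qed.

(** * Lower bounds on the number of boxes at a point *)

Lemma D_pos : 1 <= D.
Proof. pose proof dn_le_dm. unfold D. destruct isB; [unfold k; nia | lia]. Qed.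

(** Here [D = k * dm] and [Dp = (k + 1) * dm], so [D + dm = Dp] and [k * Dp = (k + 1) * D]. The
    exponents of the nodes range from 0 to [log2 n], whence the number of levels. *)
Lemma boxes_B (x : Z) : isB = true ->
  (k - 2) * wsum n (cov x) (E 3%nat) - (Z.log2 (Z.of_nat n) + 1) * (k * (k + 1) * ((k + 1) * dm))
  <= (k + 1) * D * count n (inbox x).
Proof.
  intros HB. pose proof dn_le_dm. pose proof D_pos.
  assert (Hk : 1 <= k) by exact k_pos.
  pose proof (Z.log2_nonneg (Z.of_nat n)).
  assert (Hw : forall i, rng n i -> E 16%nat i = 2 ^ Z.log2 (E 16%nat i) /\
    rng (Z.to_nat (Z.log2 (Z.of_nat n) + 1)) (Z.log2 (E 16%nat i)) /\
    E 14%nat i / E 16%nat i < E 15%nat i / E 16%nat i /\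
    E 15%nat i / (E 16%nat i + E 16%nat i) <= E 14%nat i / (E 16%nat i + E 16%nat i)).
  { intros i Hi. destruct (E_w_B i Hi HB) as (e & Ee & He & H3 & H4).
    assert (Z.log2 (E 16%nat i) = e) as -> by (rewrite Ee; apply Z.log2_pow2; lia).
    repeat split; try assumption; lia. }
  pose proof (boxes_count n (E 1%nat) (E 2%nat) (E 3%nat) (E 16%nat) (E 17%nat) (E 18%nat)
    (E 19%nat) (E 20%nat) (E 21%nat) (E 22%nat) (E 23%nat) (E 24%nat) (E 25%nat) (E 27%nat)
    (E 28%nat) (E 30%nat) k dm D ((k + 1) * dm) (k * ((k + 1) * dm)) dur_bounds E_al E_be E_side
    E_lay E_kap E_ga E_g lead_in lead_eq E_gw box_in x) as B.
  specialize (B ltac:(lia)).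
  specialize (B ltac:(unfold D; rewrite HB; lia)).
  specialize (B ltac:(lia) ltac:(nia)).
  specialize (B _ _ (fun i => Z.log2 (E 16%nat i)) (Z.to_nat (Z.log2 (Z.of_nat n) + 1))
     E_rl E_rr Hw E_h ltac:(lia) eq_refl).
  rewrite Z2Nat.id in B by lia. fold (cov x) in B. fold (inbox x) in B.
  assert (ED : (k + 1) * D = k * ((k + 1) * dm)) by (unfold D; rewrite HB; ring).
  rewrite ED. lia.
Qed.

(** Each sensor is its own box. It lasts at most [dm], and [k * dm <= (k + 1) * dn], so shortening
    it to [dn] loses a factor of at most [(k + 1) / k]. *)
Lemma boxes_A (x : Z) : isB = false ->
  k * wsum n (cov x) (E 3%nat) <= (k + 1) * D * count n (inbox x).
Proof.
  intros HB. pose proof dn_le_dm. assert (Hk : 1 <= k) by exact k_pos.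
  assert (HD : D = dn) by (unfold D; now rewrite HB).
  assert (H1 : count n (cov x) <= count n (inbox x)).
  { apply count_le. intros i Hi Ci.
    assert (Gi : forall j, rng n j -> grpE i j = true -> j = i).
    { intros j Hj G. unfold grpE, grp, same, node in G.
      rewrite !(E_w_A _) in G by assumption. lia. }
    assert (E 28%nat i <= x < E 30%nat i); [| unfold inbox; lia].
    destruct (lead_in i Hi) as [Hl Gl].
    apply box_in; [assumption | now apply Gi | |].
    - rewrite HD, E_gw by assumption.
      apply Z.le_trans with (E 3%nat i); [now apply dn_bounds |].
      unfold wsum. eapply Z.le_trans; [| apply (zsum_ge_term n i); [assumption |]].
      + cbv beta. rewrite grp_refl. lia.
      + intros j Hj. specialize (dur_pos j Hj). destruct (grpE i j); lia.
    - intros j Hj G. rewrite (Gi j Hj G). unfold cov in Ci. lia. }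
  assert (H2 : wsum n (cov x) (E 3%nat) <= dm * count n (cov x)).
  { unfold count, wsum. rewrite <- zsum_scal. apply zsum_le. intros i Hi.
    pose proof (dur_bounds i Hi). destruct (cov x i); lia. }
  pose proof (proj1 (count_le_n n (cov x))).
  assert (H3 : k * dm <= (k + 1) * dn) by (unfold isB in HB; lia).
  rewrite HD.
  apply Z.le_trans with (k * (dm * count n (cov x))); [apply Z.mul_le_mono_nonneg_l; lia |].
  apply Z.le_trans with ((k + 1) * dn * count n (cov x)).
  - rewrite Z.mul_assoc. apply Z.mul_le_mono_nonneg_r; lia.
  - apply Z.mul_le_mono_nonneg_l; [nia | assumption].
Qed.

Lemma E_covlo (i : Z) : rng n i -> E 31%nat i = count n (inbox (E 1%nat i)).
Proof.
  intros Hi. by_tab 23%nat Hi. rewrite Q. apply wsum_ext. intros j _.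
  cbn [bev coverb tev]. unfold inbox. lia.
Qed.

Lemma E_inU (i : Z) : rng n i -> E 32%nat i = count n (cov (E 2%nat i)).
Proof.
  intros Hi. by_tab 24%nat Hi. rewrite Q. apply wsum_ext. intros j _.
  cbn [bev coverb tev]. unfold cov. lia.
Qed.

Lemma E_covhi (i : Z) : rng n i -> E 33%nat i = count n (inbox (E 2%nat i)).
Proof.
  intros Hi. by_tab 25%nat Hi. rewrite Q. apply wsum_ext. intros j _.
  cbn [bev coverb tev]. unfold inbox. lia.
Qed.

Lemma E_N1 (i : Z) : rng n i -> (forall j, rng n j -> E 34%nat i <= E 31%nat j) /\
  exists j, rng n j /\ E 34%nat i = E 31%nat j.
Proof.
  intros Hi. by_tab 26%nat Hi. rewrite n_def, Nat2Z.id in Q.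
  rewrite (zfold_ext _ _ (fun j acc => if true && (E 31%nat j <? acc) then E 31%nat j else acc)) in Q
    by (intros; now rewrite tev_ite).
  destruct (zfold_min n (fun _ => true) (E 31%nat) (E 31%nat i)) as (H1 & H2 & H3).
  cbn [tev] in Q. rewrite <- Q in *. split; [auto |].
  destruct H3 as [-> | (j & Hj & _ & ->)]; [exists i | exists j]; auto.
Qed.

Definition ncol := E 35%nat 0.

Lemma count_pos_ex (P : Z -> bool) : 0 < count n P -> exists i, rng n i /\ P i = true.
Proof.
  intros H. apply zsum_pos_ex in H as (i & Hi & H). exists i. split; [assumption |].
  destruct (P i); [reflexivity | lia].
Qed.

(** The number of colours is a minimum over the left ends and over those right ends that lie in the
    union. The last part says that it is attained at a covered point, where the load bound
    applies. *)
Lemma N_spec :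
  (forall j, rng n j -> ncol <= count n (inbox (E 1%nat j))) /\
  (forall j, rng n j -> 0 < count n (cov (E 2%nat j)) -> ncol <= count n (inbox (E 2%nat j))) /\
  exists x i, rng n i /\ cov x i = true /\ ncol = count n (inbox x).
Proof.
  pose proof rng0 as Hi. by_tab 27%nat Hi. rewrite n_def, Nat2Z.id in Q.
  rewrite (zfold_ext _ _ (fun j acc => if (0 <? E 32%nat j) && (E 33%nat j <? acc) then E 33%nat j else acc)) in Q
    by (intros; now rewrite tev_ite).
  destruct (zfold_min n (fun j => 0 <? E 32%nat j) (E 33%nat) (E 34%nat 0)) as (H1 & H2 & H3).
  cbn [tev] in Q. rewrite <- Q in *. fold ncol in *. clear Q.
  destruct (E_N1 0 rng0) as (H4 & j0 & Hj0 & E0). split; [| split].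
  - intros j Hj. rewrite <- E_covlo by assumption. specialize (H4 j Hj). lia.
  - intros j Hj Hc. rewrite <- E_covhi by assumption. apply H2; [assumption |].
    rewrite E_inU by assumption. lia.
  - destruct H3 as [H3 | (j & Hj & Pj & H3)].
    + exists (E 1%nat j0), j0. split; [assumption |]. specialize (lo_lt_hi j0 Hj0).
      split; [unfold cov; lia |]. rewrite H3, E0. now apply E_covlo.
    + rewrite E_inU in Pj by assumption. apply Z.ltb_lt in Pj.
      apply count_pos_ex in Pj as (i & Hi' & Ci).
      exists (E 2%nat j), i. split; [assumption |]. split; [assumption |].
      rewrite H3. now apply E_covhi.
Qed.

(** The number of boxes at [x] only drops at a right end of a box, hence at an
    end point of a sensor. *)
Lemma N_le (x i : Z) : rng n i -> cov x i = true -> ncol <= count n (inbox x).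
Proof.
  intros Hi Ci. destruct N_spec as (H1 & H2 & _).
  (* [v] is the last right end up to [x], or the left end of sensor [i] if that is larger. Sensor
     [i] contains [v], and no box ends in [(v, x]], so the boxes at [v] all contain [x]. *)
  set (v := zfold n (fun j acc => if (E 2%nat j <=? x) && (acc <? E 2%nat j) then E 2%nat j else acc)
    (E 1%nat i)).
  destruct (zfold_max n (fun j => E 2%nat j <=? x) (E 2%nat) (E 1%nat i)) as (V1 & V2 & V3).
  fold v in V1, V2, V3.
  assert (Hv : v <= x).
  { destruct V3 as [-> | (j & Hj & Pj & ->)]; [unfold cov in Ci; lia | lia]. }
  assert (HN : ncol <= count n (inbox v)).
  { destruct V3 as [-> | (j & Hj & Pj & E1)]; [now apply H1 |].
    rewrite E1. apply H2; [assumption |]. rewrite <- E1.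
    apply Z.lt_le_trans with (count n (fun j => j =? i)).
    - unfold count, wsum. rewrite (zsum_single n i (fun _ => 1)).
      replace ((0 <=? i) && (i <? Z.of_nat n)) with true by lia. lia.
    - apply count_le. intros l _ Hl. apply Z.eqb_eq in Hl. subst l.
      unfold cov in *. lia. }
  eapply Z.le_trans; [exact HN |]. apply count_le. intros l Hl B.
  unfold inbox in *. rewrite E_bb in * by assumption.
  destruct (_ && negb _); [| lia].
  destruct (E_bb0 l Hl) as (_ & j & Hj & _ & Ej). rewrite Ej in *.
  specialize (V2 j Hj). lia.
Qed.

Lemma E_rank (i : Z) : rng n i -> E 36%nat i = count n (fun j => E 28%nat j <? E 28%nat i).
Proof. intros Hi. by_tab 28%nat Hi. exact Q. Qed.

(** All reaches start at the leftmost end point, so no colour reaches beyond a covered point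
    initially. *)
Lemma E_reach (i j : Z) : rng n i -> rng n j -> E 37%nat i <= E 1%nat j.
Proof.
  intros Hi Hj. by_tab 29%nat Hi. rewrite n_def, Nat2Z.id in Q.
  rewrite (zfold_ext _ _ (fun j acc => if true && (E 1%nat j <? acc) then E 1%nat j else acc)) in Q
    by (intros; now rewrite tev_ite).
  destruct (zfold_min n (fun _ => true) (E 1%nat) (E 1%nat i)) as (H1 & H2 & _).
  cbn [tev] in Q. rewrite <- Q in *. now apply H2.
Qed.

Let E' := run colour_stm E.
Let E'' := run (tab_stm start_tab) E'.

Lemma E'_frame (a : nat) (z : Z) : In a [0; 12; 25; 26]%nat -> E' a z = E a z.
Proof.
  intros Ha. apply run_frame.
  simpl in Ha. destruct Ha as [<- | [<- | [<- | [<- | []]]]]; reflexivity.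
Qed.

Lemma E_start (i : Z) : rng n i -> 0 <= E' 38%nat (E 25%nat i) <= Z.of_nat n ->
  E'' 4%nat i = E 26%nat i + E' 38%nat (E 25%nat i) * D.
Proof.
  intros Hi Hc. destruct (run_tab [0; 12; 25; 26; 38]%nat E' start_tab) as [_ V];
    try (simpl; intuition discriminate); try reflexivity.
  unfold E''. change 4%nat with (tgt start_tab). rewrite V.
  2:{ rewrite E'_frame, n_def by (simpl; auto). assumption. }
  unfold tab_val. cbn [start_tab bnd ini stp]. rewrite (E'_frame 0%nat), n_def, Nat2Z.id by (simpl; auto).
  rewrite (zfold_ext _ _ (fun j acc => if j <? E' 38%nat (E 25%nat i) then acc + D else acc)).
  2:{ intros j acc _. rewrite tev_ite. cbn [bev tev binop_sem].
      rewrite (E'_frame 25%nat), (E'_frame 12%nat), E_D by (simpl; auto). reflexivity. }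
  cbn [tev]. rewrite zfold_upto, (E'_frame 26%nat) by (simpl; auto; lia).
  rewrite Z.min_l by lia. reflexivity.
Qed.

(** Time [u] belongs to colour [u / D]. Some box of this colour contains [x], and its sensors, run
    one after the other, last at least [D]; the one whose tile contains [u mod D] is active. *)
Lemma schedule_covers (x u i0 : Z) :
  rng n i0 -> cov x i0 = true -> 0 <= u < ncol * D ->
  exists i, rng n i /\ cov x i = true /\ 0 <= E'' 4%nat i /\
    E'' 4%nat i <= u < E'' 4%nat i + E 3%nat i.
Proof.
  intros Hi0 C0 Hu. pose proof D_pos as HD.
  assert (Hc : 0 <= u / D < ncol).
  { split; [apply Z.div_pos; lia | apply Z.div_lt_upper_bound; lia]. }
  pose proof (N_le x i0 Hi0 C0) as HN.
  pose proof (count_le_n n (inbox x)) as HNn.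
  destruct (run_colour E n x n_def ltac:(fold ncol; fold (inbox x); lia) E_rank) with (c := u / D)
    as (l & Hl & Cl & Bl).
  { intros c Hc'. fold ncol in Hc'. pose proof (E_reach c i0 ltac:(lia) Hi0). unfold cov in C0. lia. }
  { exact Hc. }
  fold E' in Cl.
  destruct (box_out l x Hl) as (Ll & Wl & Al); [unfold inbox; lia |].
  pose proof (Z.mod_pos_bound u D) as Hmod. pose proof (Z.div_mod u D) as Hdiv.
  rewrite E_gw in Wl by assumption.
  destruct (tile_at n (E 22%nat) (E 3%nat) dm (grpE l) dur_bounds (u mod D))
    as (i & Hi & Gi & Ti); [lia |].
  assert (Li : E 25%nat i = l) by (rewrite (lead_eq l i); assumption).
  assert (Oi : E 26%nat i = offset n (E 22%nat) (E 3%nat) (grpE l) i).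
  { rewrite E_off by assumption. apply wsum_ext. intros j _. now rewrite (grp_same l i j Gi). }
  exists i. split; [assumption |]. split; [now apply Al |].
  pose proof (offset_nonneg n (E 22%nat) (E 3%nat) dm (grpE l) dur_bounds i) as On.
  rewrite E_start; rewrite ?Li, ?Cl; try assumption; [| lia].
  rewrite Oi. nia.
Qed.
End Memory.

(** * Duration of the schedule *)

Close Scope Z_scope.
Open Scope R_scope.

(** From [1 + z <= exp z] at [z = - ln r]. *)
Lemma ln_ge_1_minus_inv (r : R) : 0 < r -> 1 - / r <= ln r.
Proof.
  intros Hr. pose proof (exp_ineq1_le (- ln r)) as H.
  rewrite exp_Ropp, exp_ln in H by assumption. lra.
Qed.

Lemma ln_mono (x y : R) : 0 < x -> x <= y -> ln x <= ln y.
Proof.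
  intros Hx [H | ->]; [left; now apply ln_increasing | right; reflexivity].
Qed.

(** Since [ln 2 > 1/2], both the logarithm to base 2 and the summand 1 are at most [2 * ln n]; the
    latter requires [n >= 2]. *)
Lemma log2_le_ln (n : nat) : (2 <= n)%nat ->
  IZR (Z.log2 (Z.of_nat n)) + 1 <= 4 * ln (INR n).
Proof.
  intros Hn. pose proof ln_lt_2 as H2.
  set (l := Z.to_nat (Z.log2 (Z.of_nat n))).
  assert (El : Z.log2 (Z.of_nat n) = Z.of_nat l).
  { unfold l. rewrite Z2Nat.id; [reflexivity | apply Z.log2_nonneg]. }
  assert (Hl : 2 ^ l <= INR n).
  { pose proof (Z.log2_spec (Z.of_nat n) ltac:(lia)) as [H _]. rewrite El in H.
    apply IZR_le in H. rewrite <- INR_IZR_INZ in H.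
    now rewrite <- pow_IZR in H. }
  assert (Hll : INR l * ln 2 <= ln (INR n)).
  { rewrite <- ln_pow by lra. apply ln_mono; [apply pow_lt; lra | assumption]. }
  assert (H1 : ln 2 <= ln (INR n)).
  { apply ln_mono; [lra |]. apply (le_INR 2) in Hn. simpl in Hn. lra. }
  rewrite El, <- INR_IZR_INZ. pose proof (pos_INR l). nra.
Qed.

(** The lower bound on [k] is what makes [(k - 2) / (k + 1) >= 1 / (1 + eps)]. The additive loss is
    at most [360 * dm * ln n / eps ^ 2], and [ln (dm / dn) >= eps / 10] pays for the third factor
    [1 / eps], whence 3600. *)
Lemma bound_B (n : nat) (k dm dn L T : Z) (eps : R) :
  (2 <= n)%nat -> 0 < eps < 1 -> 3 / eps + 2 <= IZR k <= 9 / eps ->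
  (1 <= dn)%Z -> (dn < k * (dm - dn))%Z -> (0 <= L)%Z ->
  ((k - 2) * L - (Z.log2 (Z.of_nat n) + 1) * (k * (k + 1) * ((k + 1) * dm)) <= (k + 1) * T)%Z ->
  IZR L / (1 + eps) - 3600 * (IZR dm * ln (INR n) * (1 / eps ^ 3) * ln (IZR dm / IZR dn)) <= IZR T.
Proof.
  intros Hn He Hk Hdn HB HL HT.
  pose proof (log2_le_ln n Hn) as Hlog.
  apply IZR_le in Hdn, HL, HT. apply IZR_lt in HB.
  rewrite ?minus_IZR, ?plus_IZR, ?mult_IZR, ?minus_IZR, ?plus_IZR, ?mult_IZR, ?plus_IZR in HT.
  rewrite mult_IZR, minus_IZR in HB.
  set (K := IZR k) in *. set (M := IZR dm) in *. set (m := IZR dn) in *.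
  set (l := IZR (Z.log2 (Z.of_nat n))) in *. set (ll := ln (INR n)) in *.
  assert (He' : 0 < / eps) by (apply Rinv_0_lt_compat; lra).
  assert (Hee : eps * / eps = 1) by (apply Rinv_r; lra).
  assert (Hinv1 : 1 < / eps) by nra.
  unfold Rdiv in Hk. set (y := / eps) in *.
  assert (HK : 0 < K) by lra.
  assert (Hm : 0 < m) by lra.
  assert (HM : m * (K + 1) < K * M) by lra.
  assert (HM0 : 0 < M) by nra.
  assert (Hl : 0 <= l) by (apply IZR_le, Z.log2_nonneg).
  (* [dn / dm < k / (k + 1)], so the logarithm exceeds [1 / (k + 1)], and
     [k + 1 <= 9 / eps + 1 <= 10 / eps]. *)
  assert (Hr : eps / 10 <= ln (M / m)).
  { assert (Hr0 : 0 < M / m) by (apply Rdiv_lt_0_compat; assumption).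
    eapply Rle_trans; [| apply ln_ge_1_minus_inv; assumption].
    rewrite Rinv_div.
    assert (m / M <= 1 - eps / 10); [| lra].
    apply Rmult_le_reg_r with M; [assumption |].
    unfold Rdiv at 1. rewrite Rmult_assoc, Rinv_l, Rmult_1_r by lra.
    assert (Q : eps * (K + 1) <= 10) by nra.
    apply Rmult_le_reg_r with (K + 1); [lra |].
    assert (M * (eps * (K + 1)) <= M * 10) by (apply Rmult_le_compat_l; lra).
    nra. }
  assert (Hpen : 360 * (M * ll) * (y * y) <= 3600 * (M * ll * (1 / eps ^ 3) * ln (M / m))).
  { replace (1 / eps ^ 3) with (y * y * y) by (unfold y; field; lra).
    assert (Hc : 0 <= 3600 * (M * ll * (y * y * y))).
    { assert (0 < ll) by lra. repeat (apply Rmult_le_pos; try lra). }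
    replace (360 * (M * ll) * (y * y)) with (3600 * (M * ll * (y * y * y)) * (eps / 10)).
    - replace (3600 * (M * ll * (y * y * y) * ln (M / m)))
        with (3600 * (M * ll * (y * y * y)) * ln (M / m)) by ring.
      apply Rmult_le_compat_l; assumption.
    - unfold y. field. lra. }
  assert (Hadd : (l + 1) * (K * (K + 1) * M) <= 360 * (M * ll) * (y * y)).
  { assert (K * (K + 1) <= 90 * (y * y)) by nra.
    assert (K * (K + 1) * M <= 90 * (y * y) * M) by (apply Rmult_le_compat_r; lra).
    assert (0 <= K * (K + 1) * M) by (repeat apply Rmult_le_pos; lra).
    apply Rle_trans with (4 * ll * (K * (K + 1) * M)).
    - apply Rmult_le_compat_r; lra.
    - replace (360 * (M * ll) * (y * y)) with (4 * ll * (90 * (y * y) * M)) by ring.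
      apply Rmult_le_compat_l; lra. }
  assert (HLL : IZR L / (1 + eps) <= IZR L * ((K - 2) / (K + 1))).
  { unfold Rdiv at 1. apply Rmult_le_compat_l; [assumption |].
    apply Rmult_le_reg_r with (1 + eps); [lra |]. rewrite Rinv_l by lra.
    apply Rmult_le_reg_r with (K + 1); [lra |].
    replace ((K - 2) / (K + 1) * (1 + eps) * (K + 1)) with ((K - 2) * (1 + eps)) by (field; lra).
    nra. }
  assert (HT' : IZR L * ((K - 2) / (K + 1)) - (l + 1) * (K * (K + 1) * M) <= IZR T).
  { apply Rmult_le_reg_l with (K + 1); [lra |].
    replace ((K + 1) * (IZR L * ((K - 2) / (K + 1)) - (l + 1) * (K * (K + 1) * M)))
      with ((K - 2) * IZR L - (l + 1) * (K * (K + 1) * ((K + 1) * M))) by (field; lra).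
    exact HT. }
  lra.
Qed.

(** The penalty is nonnegative, and [k * eps >= 1] already gives [k / (k + 1) >= 1 / (1 + eps)]. *)
Lemma bound_A (n : nat) (k dm dn L T : Z) (eps : R) :
  (1 <= n)%nat -> 0 < eps < 1 -> 3 / eps + 2 <= IZR k ->
  (1 <= dn <= dm)%Z -> (0 <= L)%Z -> (k * L <= (k + 1) * T)%Z ->
  IZR L / (1 + eps) - 3600 * (IZR dm * ln (INR n) * (1 / eps ^ 3) * ln (IZR dm / IZR dn)) <= IZR T.
Proof.
  intros Hn He Hk [Hdn Hdm] HL HT.
  apply IZR_le in Hdn, Hdm, HL, HT. rewrite ?mult_IZR, ?plus_IZR in HT.
  assert (Hln : 0 <= ln (INR n)).
  { rewrite <- ln_1. apply ln_mono; [lra |]. apply (le_INR 1) in Hn. exact Hn. }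
  assert (Hr : 0 <= ln (IZR dm / IZR dn)).
  { rewrite <- ln_1. apply ln_mono; [lra |].
    apply Rmult_le_reg_r with (IZR dn); [lra |].
    unfold Rdiv. rewrite Rmult_assoc, Rinv_l by lra. lra. }
  assert (Hpen : 0 <= 3600 * (IZR dm * ln (INR n) * (1 / eps ^ 3) * ln (IZR dm / IZR dn))).
  { assert (0 < 1 / eps ^ 3) by (apply Rdiv_lt_0_compat; [lra | apply pow_lt; lra]).
    repeat (apply Rmult_le_pos; try lra). }
  assert (He' : 0 < / eps) by (apply Rinv_0_lt_compat; lra).
  assert (Hee : eps * / eps = 1) by (apply Rinv_r; lra).
  unfold Rdiv in Hk. set (y := / eps) in *. set (K := IZR k) in *.
  assert (HLL : IZR L / (1 + eps) <= IZR T); [| lra].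
  apply Rmult_le_reg_r with (1 + eps); [lra |].
  unfold Rdiv. rewrite Rmult_assoc, Rinv_l, Rmult_1_r by lra.
  assert (HT0 : 0 <= IZR T) by nra.
  apply Rmult_le_reg_l with K; [lra |].
  assert (1 <= K * eps) by nra.
  assert (IZR T * 1 <= IZR T * (K * eps)) by (apply Rmult_le_compat_l; lra).
  lra.
Qed.

Close Scope R_scope.
Open Scope Z_scope.

(** * Instances as integer-indexed arrays, and real points as integers *)

Definition no_sensor : sensor := Sensor 0 0 0.

Definition sen (I : instance) (i : Z) : sensor := nth (Z.to_nat i) I no_sensor.

Lemma cells_map (f : sensor -> Z) (I : instance) (i : Z) :
  f no_sensor = 0 -> 0 <= i -> cells (map f I) i = f (sen I i).
Proof.
  intros Hf Hi. unfold cells, sen. replace (i <? 0) with false by lia.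
  rewrite <- Hf at 1. apply map_nth.
Qed.

Lemma sen_in (I : instance) (i : Z) : rng (length I) i -> In (sen I i) I.
Proof. intros Hi. apply nth_In. lia. Qed.

Lemma in_sen (I : instance) (s : sensor) :
  In s I -> exists i, rng (length I) i /\ sen I i = s.
Proof.
  intros Hs. apply (In_nth I s no_sensor) in Hs as (j & Hj & Ej).
  exists (Z.of_nat j). unfold sen. rewrite Nat2Z.id. split; [lia | assumption].
Qed.

Lemma zsum_cons (n : nat) (f : Z -> Z) : zsum (S n) f = f 0 + zsum n (fun i => f (i + 1)).
Proof.
  induction n as [| n IH]; [cbn [zsum]; change (Z.of_nat 0) with 0; lia |].
  change (zsum (S (S n)) f) with (zsum (S n) f + f (Z.of_nat (S n))). rewrite IH.
  cbn [zsum]. replace (Z.of_nat (S n)) with (Z.of_nat n + 1) by lia. lia.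
Qed.

Lemma zsum_list (g : sensor -> Z) (I : instance) :
  zsum (length I) (fun i => g (sen I i)) = fold_right (fun s acc => g s + acc) 0 I.
Proof.
  induction I as [| s I IH]; [reflexivity |].
  cbn [length]. rewrite zsum_cons. cbn [fold_right]. rewrite <- IH. f_equal.
  apply zsum_ext. intros i Hi. unfold sen.
  replace (Z.to_nat (i + 1)) with (S (Z.to_nat i)) by lia. reflexivity.
Qed.

(** [up x - 1] is the floor of [x]: with integer end points, a half-open interval contains a point
    exactly if it contains its floor. *)
Lemma in_range_floor (s : sensor) (x : R) :
  in_range s x <-> lo s <= up x - 1 < hi s.
Proof.
  unfold in_range. destruct (archimed x) as [H1 H2]. split.
  - intros [H3 H4]. split.
    + assert (IZR (lo s) < IZR (up x))%R as H by lra. apply lt_IZR in H. lia.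
    + assert (IZR (up x - 1) < IZR (hi s))%R as H by (rewrite minus_IZR; lra).
      now apply lt_IZR in H.
  - intros [H3 H4]. apply IZR_le in H3. assert (up x <= hi s) as H5 by lia.
    apply IZR_le in H5. rewrite minus_IZR in H3. lra.
Qed.

Lemma in_range_IZR (s : sensor) (z : Z) : in_range s (IZR z) <-> lo s <= z < hi s.
Proof.
  unfold in_range. split; intros [H1 H2].
  - split; [now apply le_IZR | now apply lt_IZR].
  - split; [now apply IZR_le | now apply IZR_lt].
Qed.

Lemma load_wsum (I : instance) (z : Z) :
  load I (IZR z) =
  wsum (length I) (fun i => (lo (sen I i) <=? z) && (z <? hi (sen I i))) (fun i => dur (sen I i)).
Proof.
  unfold wsum. rewrite (zsum_list (fun s => if (lo s <=? z) && (z <? hi s) then dur s else 0)).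
  unfold load. induction I as [| s I IH]; cbn [fold_right]; [reflexivity |]. rewrite IH. f_equal.
  destruct (in_range_dec s (IZR z)) as [H | H]; rewrite in_range_IZR in H.
  - replace ((lo s <=? z) && (z <? hi s)) with true by lia. reflexivity.
  - replace ((lo s <=? z) && (z <? hi s)) with false by lia. reflexivity.
Qed.

Lemma dmax_spec (I : instance) : I <> [] ->
  (forall s, In s I -> dur s <= dmax I) /\ exists s, In s I /\ dmax I = dur s.
Proof.
  destruct I as [| s0 I]; [congruence | intros _]. cbn [dmax].
  induction I as [| s I [H1 (s' & H2 & H3)]]; cbn [fold_right].
  - split; [intros s [<- | []]; lia | exists s0; simpl; auto].
  - set (v := fold_right _ _ I) in *. split.
    + intros s1 [<- | [<- | H]]; [| lia |].
      * specialize (H1 s0 (or_introl eq_refl)). lia.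
      * specialize (H1 s1 (or_intror H)). lia.
    + destruct (Z_le_gt_dec (dur s) v).
      * exists s'. rewrite Z.max_r by lia. split; [| assumption]. simpl in *. tauto.
      * exists s. rewrite Z.max_l by lia. simpl. auto.
Qed.

Lemma dmin_spec (I : instance) : I <> [] ->
  (forall s, In s I -> dmin I <= dur s) /\ exists s, In s I /\ dmin I = dur s.
Proof.
  destruct I as [| s0 I]; [congruence | intros _]. cbn [dmin].
  induction I as [| s I [H1 (s' & H2 & H3)]]; cbn [fold_right].
  - split; [intros s [<- | []]; lia | exists s0; simpl; auto].
  - set (v := fold_right _ _ I) in *. split.
    + intros s1 [<- | [<- | H]]; [| lia |].
      * specialize (H1 s0 (or_introl eq_refl)). lia.
      * specialize (H1 s1 (or_intror H)). lia.
    + destruct (Z_le_gt_dec (dur s) v).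
      * exists s. rewrite Z.min_l by lia. simpl. auto.
      * exists s'. rewrite Z.min_r by lia. split; [| assumption]. simpl in *. tauto.
Qed.

Lemma abs_max_list (l : list Z) (v : Z) :
  In v l -> Z.abs v <= fold_right (fun v acc => Z.max (Z.abs v) acc) 0 l.
Proof.
  induction l as [| x l IH]; [intros [] |]. cbn [fold_right]. intros [-> | H]; [lia |].
  specialize (IH H). lia.
Qed.

Lemma cells_in (l : list Z) (j : Z) : cells l j = 0 \/ In (cells l j) l.
Proof.
  unfold cells. destruct (j <? 0); [now left |].
  destruct (nth_in_or_default (Z.to_nat j) l 0); auto.
Qed.

Lemma input_fits (I : instance) (p q : Z) :
  0 < p -> 1 <= input_bits I p q /\ fits (input I p q) (input_bits I p q).
Proof.
  intros Hp. unfold input_bits. set (l := _ ++ _).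
  set (v := fold_right _ 0 l).
  assert (Hv : forall z, In z l -> Z.abs z <= v) by (intros z; apply abs_max_list).
  (* Positivity of [p] keeps the maximum away from 0, where [Z.log2_spec] does not apply. *)
  assert (Hv0 : 0 < v).
  { specialize (Hv p). simpl in Hv. specialize (Hv (or_intror (or_introl eq_refl))). lia. }
  pose proof (Z.log2_nonneg v). split; [lia |].
  assert (Hz : forall z, z = 0 \/ In z l -> Z.abs z < 2 ^ (1 + Z.log2 v)).
  { intros z H0. apply Z.le_lt_trans with v.
    - destruct H0 as [-> |]; [lia | now apply Hv].
    - pose proof (Z.log2_spec v Hv0) as [_ L]. now replace (1 + Z.log2 v) with (Z.succ (Z.log2 v)) by lia. }
  intros a z. apply Hz. unfold l.
  destruct a as [| [| [| [| a]]]]; cbn [input]; try (now left).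
  - destruct (cells_in [Z.of_nat (length I); p; q] z) as [-> | K]; [now left | right].
    apply in_or_app. now left.
  - destruct (cells_in (map lo I) z) as [-> | K]; [now left | right].
    apply in_or_app. right. apply in_or_app. now left.
  - destruct (cells_in (map hi I) z) as [-> | K]; [now left | right].
    apply in_or_app. right. apply in_or_app. right. apply in_or_app. now left.
  - destruct (cells_in (map dur I) z) as [-> | K]; [now left | right].
    apply in_or_app. right. apply in_or_app. right. apply in_or_app. now right.
Qed.

Definition prog_stm : stm := SSq (tab_stm k_tab) rest_stm.

Lemma length_pos (I : instance) : wf_instance I -> (0 < length I)%nat.
Proof. intros [H _]. destruct I; [congruence | simpl; lia]. Qed.

Lemma run_seq (s1 s2 : stm) (m : mem) : run (SSq s1 s2) m = run s2 (run s1 m).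
Proof. reflexivity. Qed.

(** * Correctness and running time of the program on an instance *)

Section Program.
Context (I : instance) (p q : Z).
Hypothesis wf_I : wf_instance I.
Hypothesis p_pos : 0 < p.
Hypothesis q_pos : 0 < q.

Let n := length I.
Let k := 3 * (q / p + 2).
Lemma q_div_p : 0 <= q / p.
Proof. apply Z.div_pos; lia. Qed.

Lemma n_pos : (0 < n)%nat.
Proof. now apply length_pos. Qed.

Lemma zero_rng : rng n 0.
Proof. pose proof n_pos. lia. Qed.

Section FinalMemory.
Context (E Efin : mem).
Hypothesis E_in : forall a z, In a [0; 1; 2; 3]%nat -> E a z = input I p q a z.
Hypothesis E_7 : E 7%nat 0 = k.
Hypothesis E_tabs : Forall (fun T => forall i, 0 <= i < E 0%nat 0 -> E (tgt T) i = tab_val E T i)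
  (first_tab :: main_tabs).
Hypothesis Efin_eq : Efin = run (tab_stm start_tab) (run colour_stm E).

Lemma E_n : E 0%nat 0 = Z.of_nat n.
Proof. now rewrite E_in by (simpl; auto). Qed.

Lemma E_lo (i : Z) : rng n i -> E 1%nat i = lo (sen I i).
Proof.
  intros Hi. rewrite E_in by (simpl; auto).
  apply (cells_map lo); [reflexivity | lia].
Qed.

Lemma E_hi (i : Z) : rng n i -> E 2%nat i = hi (sen I i).
Proof.
  intros Hi. rewrite E_in by (simpl; auto).
  apply (cells_map hi); [reflexivity | lia].
Qed.

Lemma E_dur (i : Z) : rng n i -> E 3%nat i = dur (sen I i).
Proof.
  intros Hi. rewrite E_in by (simpl; auto).
  apply (cells_map dur); [reflexivity | lia].
Qed.

Lemma sen_wf (i : Z) : rng n i -> wf_sensor (sen I i).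
Proof.
  intros Hi. destruct wf_I as [_ H]. rewrite Forall_forall in H. apply H. now apply sen_in.
Qed.

Lemma E_lo_lt_hi (i : Z) : rng n i -> E 1%nat i < E 2%nat i.
Proof. intros Hi. rewrite E_lo, E_hi by assumption. now destruct (sen_wf i Hi). Qed.

Lemma E_dur_pos (i : Z) : rng n i -> 1 <= E 3%nat i.
Proof. intros Hi. rewrite E_dur by assumption. destruct (sen_wf i Hi). lia. Qed.

Lemma E_k_pos : 1 <= E 7%nat 0.
Proof. rewrite E_7. pose proof q_div_p. unfold k. lia. Qed.

Lemma E_dmax_eq : E 8%nat 0 = dmax I.
Proof.
  destruct (E_dmax E n E_n E_tabs 0 zero_rng) as (H1 & j & Hj & H2).
  destruct (dmax_spec I (proj1 wf_I)) as (H3 & s & Hs & H4).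
  destruct (in_sen I s Hs) as (i & Hi & Ei). fold n in Hi.
  specialize (H1 i Hi). rewrite E_dur in H1, H2 by assumption.
  specialize (H3 (sen I j) (sen_in I j Hj)). rewrite Ei in H1. lia.
Qed.

Lemma E_dmin_eq : E 9%nat 0 = dmin I.
Proof.
  destruct (E_dmin E n E_n E_tabs 0 zero_rng) as (H1 & j & Hj & H2).
  destruct (dmin_spec I (proj1 wf_I)) as (H3 & s & Hs & H4).
  destruct (in_sen I s Hs) as (i & Hi & Ei). fold n in Hi.
  specialize (H1 i Hi). rewrite E_dur in H1, H2 by assumption.
  specialize (H3 (sen I j) (sen_in I j Hj)). rewrite Ei in H1. lia.
Qed.

Let D := if E 9%nat 0 <? E 7%nat 0 * (E 8%nat 0 - E 9%nat 0)
         then E 7%nat 0 * E 8%nat 0 else E 9%nat 0.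

Lemma output_valid : valid I (output Efin) (IZR (ncol E * D)).
Proof.
  split.
  - intros i ti _ H. unfold output in H. destruct (Z.ltb_spec (Efin 4%nat (Z.of_nat i)) 0); [discriminate |].
    injection H as <-. now apply IZR_le.
  - intros x u (s & Hs & Rs) [Hu0 Hu1].
    destruct (in_sen I s Hs) as (i0 & Hi0 & Es). fold n in Hi0.
    (* Both the point and the time are replaced by their floors, which is harmless as end points,
       start times and durations are integers. *)
    apply in_range_floor in Rs. destruct (archimed u) as [U1 U2].
    destruct (schedule_covers E n n_pos E_n E_lo_lt_hi E_dur_pos E_k_pos
      E_tabs (up x - 1) (up u - 1) i0 Hi0) as (i & Hi & Ci & Ti & Wi).
    + rewrite E_lo, E_hi, Es by assumption. lia.
    + fold D. split.
      * assert (0 < IZR (up u))%R as H by lra. apply lt_IZR in H. lia.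
      * assert (IZR (up u - 1) < IZR (ncol E * D))%R as H by (rewrite minus_IZR; lra).
        now apply lt_IZR in H.
    + rewrite <- Efin_eq in Ti, Wi. rewrite E_lo, E_hi in Ci by assumption. rewrite E_dur in Wi by assumption.
      exists (Z.to_nat i), (sen I i), (IZR (Efin 4%nat i)). split; [| split; [| split]].
      * unfold sen. apply nth_error_nth'. unfold n in Hi. lia.
      * unfold output. rewrite Z2Nat.id by lia. replace (Efin 4%nat i <? 0) with false by lia.
        reflexivity.
      * apply in_range_floor. lia.
      * destruct Wi as [W1 W2]. apply IZR_le in W1. rewrite minus_IZR in W1.
        assert (up u <= Efin 4%nat i + dur (sen I i)) as W3 by lia.
        apply IZR_le in W3. rewrite plus_IZR in W3. lra.
Qed.

(** The box counts are applied at a covered point where the number of boxes equals the number of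
    colours; its load is at least [L]. *)
Lemma duration_bound (L : Z) (eps : R) :
  eps = (IZR p / IZR q)%R -> (eps < 1)%R -> is_min_load I L ->
  (IZR L / (1 + eps) - 3600 * (IZR (dmax I) * ln (INR (length I)) * (1 / eps ^ 3)
      * ln (IZR (dmax I) / IZR (dmin I))) <= IZR (ncol E * D))%R.
Proof.
  intros Eeps Heps [(x1 & _ & Lx1) HL].
  assert (Hp : (0 < IZR p)%R) by now apply IZR_lt.
  assert (Hq : (0 < IZR q)%R) by now apply IZR_lt.
  assert (He : (0 < eps)%R) by (rewrite Eeps; now apply Rdiv_lt_0_compat).
  assert (Eq : (/ eps = IZR q / IZR p)%R) by (rewrite Eeps; field; lra).
  assert (Hfl : (/ eps - 1 <= IZR (q / p) <= / eps)%R).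
  { rewrite Eq. pose proof (Z.mul_div_le q p p_pos) as H1.
    pose proof (Z.mul_succ_div_gt q p p_pos) as H2.
    apply IZR_le in H1. apply IZR_lt in H2. rewrite mult_IZR in H1, H2. rewrite succ_IZR in H2.
    split; apply Rmult_le_reg_r with (IZR p); try assumption;
      [rewrite Rmult_minus_distr_r |]; unfold Rdiv; rewrite Rmult_assoc, Rinv_l by lra; lra. }
  assert (Hinv : (1 < / eps)%R).
  { rewrite <- Rinv_1. apply Rinv_lt_contravar; lra. }
  assert (Hk : (3 / eps + 2 <= IZR (E 7%nat 0%Z) <= 9 / eps)%R).
  { rewrite E_7. unfold k. rewrite mult_IZR, plus_IZR.
    unfold Rdiv. lra. }
  destruct (N_spec E n n_pos E_n E_lo_lt_hi E_tabs)
    as (_ & _ & x & i & Hi & Ci & EN).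
  assert (Hload : L <= wsum n (fun i => (E 1%nat i <=? x) && (x <? E 2%nat i)) (E 3%nat)).
  { specialize (HL (IZR x)). rewrite load_wsum in HL. eapply Z.le_trans; [apply HL |].
    - exists (sen I i). split; [now apply sen_in |]. apply in_range_IZR.
      rewrite E_lo, E_hi in Ci by assumption. lia.
    - apply Z.eq_le_incl. unfold wsum. apply zsum_ext. intros j Hj. fold n in Hj.
      now rewrite E_lo, E_hi, E_dur by assumption. }
  assert (HL0 : 0 <= L).
  { rewrite <- Lx1. unfold load. destruct wf_I as [_ W]. clear - W.
    induction W as [| s I' [_ Hs] _ IH]; simpl; [lia |]. destruct (in_range_dec s x1); lia. }
  pose proof (dn_le_dm E n n_pos E_n E_dur_pos E_tabs) as Hd.
  rewrite <- E_dmax_eq, <- E_dmin_eq.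
  pose proof (boxes_B E n n_pos E_n E_lo_lt_hi E_dur_pos E_k_pos E_tabs x) as HB.
  pose proof (boxes_A E n n_pos E_n E_dur_pos E_k_pos E_tabs x) as HA.
  cbv beta zeta in HA, HB. fold D in HA, HB. rewrite <- EN in HA, HB.
  set (W := wsum n _ (E 3%nat)) in *.
  assert (Hk1 : 2 <= E 7%nat 0).
  { rewrite E_7. pose proof q_div_p. unfold k. lia. }
  destruct (E 9%nat 0 <? E 7%nat 0 * (E 8%nat 0 - E 9%nat 0)) eqn:F.
  - specialize (HB eq_refl). apply (bound_B _ (E 7%nat 0)); try assumption; try lra; try lia.
    (* A single sensor has [dmax = dmin], contrary to the case at hand; so [n >= 2] and [ln n] is
       bounded away from 0. *)
    + destruct (Nat.eq_dec n 1) as [E1n |]; [| pose proof n_pos; fold n; lia]. exfalso.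
      destruct (E_dmax E n E_n E_tabs 0 zero_rng) as (_ & j & Hj & J1).
      destruct (E_dmin E n E_n E_tabs 0 zero_rng) as (_ & j' & Hj' & J2).
      assert (j = j') as <- by lia. rewrite <- J2 in J1. rewrite J1 in F. lia.
    + fold n. eapply Z.le_trans; [| eapply Z.le_trans; [exact HB |]].
      * apply Z.sub_le_mono_r. apply Z.mul_le_mono_nonneg_l; lia.
      * apply Z.eq_le_incl. ring.
  - specialize (HA eq_refl). apply (bound_A _ (E 7%nat 0)); try assumption; try lra; try lia.
    eapply Z.le_trans; [| eapply Z.le_trans; [exact HA |]].
    + apply Z.mul_le_mono_nonneg_l; lia.
    + apply Z.eq_le_incl. ring.
Qed.

End FinalMemory.

Let E1 := run (tab_stm k_tab) (input I p q).
Let E := run (tabs_stm first_tab main_tabs) E1.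

Lemma E1_spec : (forall a z, In a [0; 1; 2; 3]%nat -> E1 a z = input I p q a z) /\
  E1 7%nat 0 = k.
Proof.
  destruct (run_tabs [] k_tab [0; 1; 2; 3]%nat (input I p q)) as [F V];
    [exact wf_k | simpl; auto | simpl; intuition discriminate | simpl; intuition discriminate |].
  cbn [tabs_stm] in F, V. fold E1 in F, V. split; [exact F |].
  inversion_clear V as [| ? ? V0 _]. pose proof n_pos.
  specialize (V0 0). cbn [tgt k_tab map_tab] in V0. rewrite V0.
  - unfold k_tab. rewrite map_tab_val. cbn [tev binop_sem]. rewrite !F by (simpl; auto).
    change (input I p q 0%nat 2) with q. change (input I p q 0%nat 1) with p. unfold k. lia.
  - change (input I p q 0%nat 0) with (Z.of_nat n). lia.
Qed.

Lemma E_spec :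
  (forall a z, In a [0; 1; 2; 3]%nat -> E a z = input I p q a z) /\ E 7%nat 0 = k /\
  Forall (fun T => forall i, 0 <= i < E 0%nat 0 -> E (tgt T) i = tab_val E T i)
    (first_tab :: main_tabs).
Proof.
  destruct E1_spec as [F1 K1].
  destruct (run_tabs main_tabs first_tab [7; 0; 1; 2; 3]%nat E1) as [F V];
    [exact wf_main | simpl; auto | simpl; intuition discriminate | simpl; intuition discriminate |].
  fold E in F, V. split; [| split].
  - intros a z Ha. rewrite (F a z (or_intror Ha)). now apply F1.
  - rewrite F by (simpl; auto). exact K1.
  - rewrite (F 0%nat) by (simpl; auto). exact V.
Qed.

Lemma program_correct :
  exists T : R, valid I (output (run prog_stm (input I p q))) T /\
    forall (L : Z) (eps : R), eps = (IZR p / IZR q)%R -> (eps < 1)%R -> is_min_load I L ->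
      (IZR L / (1 + eps) - 3600 * (IZR (dmax I) * ln (INR (length I)) * (1 / eps ^ 3)
        * ln (IZR (dmax I) / IZR (dmin I))) <= T)%R.
Proof.
  unfold prog_stm, rest_stm. rewrite !run_seq. fold E1. fold E.
  destruct E_spec as (F & K & V). generalize dependent E. intros E2 F K V.
  eexists. split.
  - now apply (output_valid E2).
  - intros L eps. now apply duration_bound.
Qed.

(** [n + k] bounds both loop bounds, the cells 0 of arrays 0 and 7. Each step adds at most 200 bits,
    so the cost also determines a sufficient word length. *)
Lemma program_runs :
  let ct := cost (Z.of_nat n + k) prog_stm in
  exists t, exec (input_bits I p q + 200 * ct) (compile prog_stm) (input I p q)
      (run prog_stm (input I p q)) t /\
    Z.of_nat t <= ct.
Proof.
  cbv zeta. pose proof q_div_p. destruct (input_fits I p q p_pos) as [Hb Bd].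
  set (w := input_bits I p q + _). cbn [cost prog_stm] in w.
  pose proof (cost_pos (Z.of_nat n + k) (tab_stm k_tab) ltac:(unfold k; lia)).
  pose proof (cost_pos (Z.of_nat n + k) rest_stm ltac:(unfold k; lia)).
  assert (HN : 0 <= Z.of_nat n + k) by (unfold k; lia).
  assert (Hb1 : forall a, In a [0]%nat -> input I p q a 0 <= Z.of_nat n + k).
  { intros a [<- | []]. change (input I p q 0%nat 0) with (Z.of_nat n). unfold k. lia. }
  destruct (exec_run w 200 [0]%nat _ _ ltac:(lia) HN ok_k (input I p q) (input_bits I p q)
    ltac:(lia) Bd Hb1 ltac:(unfold w; lia)) as (t1 & X1 & T1 & B1).
  assert (Hb2 : forall a, In a [0; 7]%nat -> E1 a 0 <= Z.of_nat n + k).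
  { destruct E1_spec as [F1 K1]. intros a [<- | [<- | []]]; [| rewrite K1; lia].
    rewrite F1 by (simpl; auto). change (input I p q 0%nat 0) with (Z.of_nat n). unfold k. lia. }
  destruct (exec_run w 200 [0; 7]%nat _ _ ltac:(lia) HN ok_rest E1
    (input_bits I p q + 200 * cost (Z.of_nat n + k) (tab_stm k_tab))
    ltac:(lia) B1 Hb2 ltac:(unfold w; lia)) as (t2 & X2 & T2 & _).
  exists (t1 + t2)%nat. split; [| cbn [cost prog_stm]; lia].
  unfold prog_stm. rewrite run_seq. fold E1. cbn [compile]. econstructor; eassumption.
Qed.
End Program.

Close Scope Z_scope.
Open Scope R_scope.

(** Loops are nested at most three deep, in [colour_stm], which gives the cube. As [n >= 1], the
    loop bound plus 1 is at most [n + 3 * q / p + 7 <= 10 * y], whence [1000 = 10 ^ 3]. *)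
Lemma cost_poly (n : nat) (p q : Z) :
  (1 <= n)%nat -> (0 < p)%Z -> (0 < q)%Z ->
  let y := INR n + 1 / (IZR p / IZR q) in
  1 <= y /\
  IZR (cost (Z.of_nat n + 3 * (q / p + 2)) prog_stm) <= 1000 * IZR (weight prog_stm) * y ^ 3.
Proof.
  intros Hn Hp Hq y.
  assert (Hp' : 0 < IZR p) by now apply IZR_lt.
  assert (Hq' : 0 < IZR q) by now apply IZR_lt.
  assert (Ey : y = INR n + IZR q / IZR p) by (unfold y; field; lra).
  assert (Hqp : 0 < IZR q / IZR p) by now apply Rdiv_lt_0_compat.
  assert (Hn' : 1 <= INR n) by now apply (le_INR 1).
  assert (Hdiv : IZR (q / p) <= IZR q / IZR p).
  { apply Rmult_le_reg_r with (IZR p); [assumption |].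
    unfold Rdiv. rewrite Rmult_assoc, Rinv_l, Rmult_1_r, <- mult_IZR by lra.
    apply IZR_le. rewrite Z.mul_comm. now apply Z.mul_div_le. }
  split; [lra |].
  pose proof (Z.div_pos q p ltac:(lia) Hp) as H0.
  destruct (cost_le (Z.of_nat n + 3 * (q / p + 2)) prog_stm ltac:(lia)) as [Hc Hw].
  change (Z.of_nat (depth prog_stm)) with 3%Z in Hc.
  apply IZR_le in Hc, Hw. rewrite mult_IZR in Hc.
  eapply Rle_trans; [exact Hc |].
  set (z := (Z.of_nat n + 3 * (q / p + 2) + 1)%Z).
  assert (Hz : 0 <= IZR z <= 10 * y).
  { split; [apply IZR_le; unfold z; lia |].
    unfold z. rewrite !plus_IZR, mult_IZR, plus_IZR, <- INR_IZR_INZ. lra. }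
  change (z ^ 3)%Z with (z ^ Z.of_nat 3)%Z. rewrite <- pow_IZR.
  replace (1000 * IZR (weight prog_stm) * y ^ 3) with (IZR (weight prog_stm) * (10 * y) ^ 3) by ring.
  apply Rmult_le_compat_l; [lra |]. now apply pow_incr.
Qed.

Theorem theorem6 :
  exists (prog : cmd) (K : nat) (C eps0 : R),
    0 < C /\ 0 < eps0 /\
    forall (I : instance) (p q : Z) (eps : R),
      wf_instance I ->
      (0 < p)%Z -> (0 < q)%Z -> eps = IZR p / IZR q -> eps < eps0 ->
      exists t : schedule,
        computes_in_poly_time prog K I p q t /\
        forall L : Z, is_min_load I L ->
          exists T : R,
            IZR L / (1 + eps)
              - C * (IZR (dmax I) * ln (INR (length I)) * (1 / eps ^ 3)
                     * ln (IZR (dmax I) / IZR (dmin I))) <= T /\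
            valid I t T.
Proof.
  (* [K] serves as coefficient and as exponent: it exceeds 3, and it dominates the factor
     [1 + 200 * 1000 * weight] of the word length, which also bounds the time. *)
  destruct (INR_unbounded (3 + 200000 * IZR (weight prog_stm))) as [K HK].
  exists (compile prog_stm), K, 3600, 1. split; [lra |]. split; [lra |].
  intros I p q eps HI Hp Hq Eeps Heps.
  exists (output (run prog_stm (input I p q))). split.
  - destruct (program_runs I p q HI Hp Hq) as (t & X & Ht).
    destruct (input_fits I p q Hp) as [Hbits _].
    destruct (cost_poly (length I) p q (length_pos I HI) Hp Hq) as [Hy Hc].
    set (ct := cost _ prog_stm) in *. set (y := INR (length I) + _) in *.
    assert (Hw : 1 <= IZR (weight prog_stm)).
    { apply IZR_le. now apply (cost_le 0 prog_stm). }
    set (W := IZR (weight prog_stm)) in *.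
    assert (HyK : y ^ 3 <= y ^ K).
    { apply Rle_pow; [assumption |]. apply INR_le. simpl. lra. }
    assert (Hy3 : 1 <= y ^ 3) by (apply pow_R1_Rle; assumption).
    assert (Hct : 1 + 200 * IZR ct <= poly_bound K (length I) (IZR p / IZR q)).
    { unfold poly_bound. fold y.
      apply Rle_trans with ((3 + 200000 * W) * y ^ 3); [nra |].
      apply Rmult_le_compat; nra. }
    assert (Hct0 : 0 <= IZR ct).
    { apply IZR_le. lia. }
    apply IZR_le in Ht, Hbits. rewrite <- INR_IZR_INZ in Ht.
    eexists _, _, t. split; [| split; [| split; [exact X | reflexivity]]].
    + rewrite plus_IZR, mult_IZR.
      (* The additive growth becomes a factor, because the input has at least one bit. *)
      apply Rle_trans with ((1 + 200 * IZR ct) * IZR (input_bits I p q)); [nra |].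
      apply Rmult_le_compat_r; lra.
    + lra.
  - destruct (program_correct I p q HI Hp Hq) as (T & HT & HL).
    intros L Lmin. exists T. split; [now apply HL | exact HT].
Qed.
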